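(* Let $M$ be an AdS manifold, let $G(M)$ be the space of time-like maximal geodesics in $M$, and let $m_l$ and $m_r$ be the degenerate metrics on $G(M)$ induced by $M_l$ and $M_r$. Then $(G(M),m_l\oplus m_r)$ is locally isometric to $\mathbb H^2\times\mathbb H^2$.
   Context: An AdS manifold is an oriented, time-oriented Lorentzian 3-manifold locally isometric to $AdS_3=\{x\in\mathbb R^{2,2}:\langle x,x\rangle=-1\}$ (curvature $-1$). With $\nabla$ the Levi-Civita connection and cross product $(v\times y)^*=*(v^*\wedge y^* )$ ($v^*$ the dual 1-form, $*$ the Hodge star), consider the connections $D^l_vu=\nabla_vu+u\times v$ and $D^r_vu=\nabla_vu-u\times v$; they are flat and compatible with the metric. $T^{1,t}M$ is the bundle of future-directed unit time-like vectors. For $\xi\in T_{(x,v)}(T^{1,t}M)$, let $P^l(\xi)=\frac{D^lV}{dt}(0)$, $P^r(\xi)=\frac{D^rV}{dt}(0)$ for any curve $V(t)=(x(t),v(t))$ in $T^{1,t}M$ with $\dot V(0)=\xi$; these are orthogonal to $v$. Set $M_l(\xi)=\|P^l(\xi)\|^2$, $M_r(\xi)=\|P^r(\xi)\|^2$: semi-positive quadratic forms of rank 2 at every point of $T^{1,t}M$. They vanish along the orbits of the geodesic flow and are invariant under it, so they descend to degenerate metrics $m_l$, $m_r$ on the space $G(M)$ of maximal time-like geodesics (the quotient of $T^{1,t}M$ by the geodesic flow). $m_l\oplus m_r$ denotes the sum of the two quadratic forms on $TG(M)$. $\mathbb H^2\times\mathbb H^2$ has the product of hyperbolic metrics.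
   Formalization: G(M) can fail to be a manifold (e.g. SL_2(R) modulo an order-3 elliptic element); the local isometry of G(M) is stated where G(M) is a manifold onto which T^{1,t}M submerses, and for every M it is stated for the geodesic-flow quotient of a small open set around each unit vector. *)

(* Defs.v *)
From HB Require Import structures.
From mathcomp Require Import all_boot all_order all_algebra.
From mathcomp Require Import all_classical all_reals all_analysis.
Set Implicit Arguments.
Unset Strict Implicit.
Unset Printing Implicit Defensive.
Import Order.TTheory GRing.Theory Num.Theory.
Import numFieldNormedType.Exports.
Local Open Scope classical_set_scope.
Local Open Scope ring_scope.

(* [U] is meant to be open. *)
Fixpoint Ck (R : realType) (V W : normedModType R) (k : nat) (U : set V)
    (f : V -> W) : Prop :=
  if k is k'.+1 then
    (forall x, U x -> differentiable f x) /\
    (forall v : V, Ck k' U (fun x => 'D_v f x))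
  else forall x, U x -> {for x, continuous f}.

Definition smooth (R : realType) (V W : normedModType R) (U : set V)
  (f : V -> W) : Prop := forall k, Ck k U f.

(* Tangent vectors are row vectors; [G] is the matrix of a bilinear form. *)
Definition form (R : realType) (n : nat) (G : 'M[R]_n) (v w : 'rV[R]_n) : R :=
  (v *m G *m w^T) 0 0.

Definition lorentz_mx (R : realType) : 'M[R]_3 :=
  diag_mx (\row_(k < 3) (if k == ord0 then -1 else 1)).

(* An oriented, time-oriented Lorentzian 3-manifold: a Hausdorff second
   countable space with an oriented smooth atlas [phi i : dom i -> R^3]
   (inverse [psi i]), a metric given by its matrices [met i x] at the points
   [x] of the image of each chart, and a time-orientation given by a
   continuous time-like vector field with coordinates [tfield i x]. *)
Record lorentz3 (R : realType) := Lorentz3 {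
  pt :> topologicalType;
  pt_hausdorff : hausdorff_space pt;
  pt_second_countable : @second_countable pt;
  idx : Type;
  dom : idx -> set pt;
  phi : idx -> pt -> 'rV[R]_3;
  psi : idx -> 'rV[R]_3 -> pt;
  dom_cover : forall p, exists i, dom i p;
  dom_open : forall i, open (dom i);
  cod_open : forall i, open (phi i @` dom i);
  phiK : forall i p, dom i p -> psi i (phi i p) = p;
  phi_continuous : forall i p, dom i p -> {for p, continuous (phi i)};
  psi_continuous : forall i x, (phi i @` dom i) x -> {for x, continuous (psi i)};
  trans_smooth : forall i j,
    smooth (phi i @` (dom i `&` dom j)) (phi j \o psi i);
  trans_oriented : forall i j p, dom i p -> dom j p ->
    0 < \det (jacobian (phi j \o psi i) (phi i p));
  met : idx -> 'rV[R]_3 -> 'M[R]_3;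
  met_smooth : forall i, smooth (phi i @` dom i) (met i);
  met_sym : forall i x, (phi i @` dom i) x -> (met i x)^T = met i x;
  met_lorentz : forall i x, (phi i @` dom i) x ->
    exists2 P : 'M[R]_3, P \in unitmx & P *m met i x *m P^T = lorentz_mx R;
  met_trans : forall i j p v w, dom i p -> dom j p ->
    form (met j (phi j p)) ('d (phi j \o psi i) (phi i p) v)
                           ('d (phi j \o psi i) (phi i p) w)
    = form (met i (phi i p)) v w;
  tfield : idx -> 'rV[R]_3 -> 'rV[R]_3;
  tfield_continuous : forall i x, (phi i @` dom i) x ->
    {for x, continuous (tfield i)};
  tfield_timelike : forall i x, (phi i @` dom i) x ->
    form (met i x) (tfield i x) (tfield i x) < 0;
  tfield_trans : forall i j p, dom i p -> dom j p ->
    tfield j (phi j p) = 'd (phi j \o psi i) (phi i p) (tfield i (phi i p)) }.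

Definition ads_mx (R : realType) : 'M[R]_4 :=
  diag_mx (\row_(k < 4) (if (k < 2)%N then -1 else 1)).

Definition AdS3 (R : realType) : set 'rV[R]_4 :=
  [set x | form (ads_mx R) x x = -1].

(* Around every point of [M], in some chart, an isometry [F] from an open set
   onto a relatively open subset [AdS3 `&` O'] of AdS_3.  Both [F] and its
   inverse are given as smooth maps between open sets of R^3 and R^4. *)
Definition locally_AdS (R : realType) (M : lorentz3 R) : Prop :=
  forall p : M, exists (i : idx M) (O : set 'rV[R]_3) (O' : set 'rV[R]_4)
                       (F : 'rV[R]_3 -> 'rV[R]_4) (H : 'rV[R]_4 -> 'rV[R]_3),
    [/\ dom i p, open O, O (phi i p), O `<=` phi i @` dom i & open O'] /\
    [/\ smooth O F, smooth O' H, F @` O = @AdS3 R `&` O',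
        forall x, O x -> H (F x) = x &
        forall x v w, O x ->
          form (ads_mx R) ('d F x v) ('d F x w) = form (met i x) v w].

Section Coordinates.
Variables (R : realType) (M : lorentz3 R) (i : idx M) (x : 'rV[R]_3).
Local Notation g := (met i x).

(* Levi-Civita connection of the metric *)
Definition dmet (a b c : 'I_3) : R :=
  'D_(delta_mx 0 a) (fun y => met i y b c) x.

Definition christoffel (k a b : 'I_3) : R :=
  2^-1 * \sum_(l < 3)
    invmx g k l * (dmet a b l + dmet b a l - dmet l a b).

Definition gamma (v u : 'rV[R]_3) : 'rV[R]_3 :=
  \row_k \sum_a \sum_b christoffel k a b * v 0 a * u 0 b.

(* cross product; 2-forms are antisymmetric matrices, and the charts being
   positively oriented the volume form is [Num.sqrt `|\det g| dx0 dx1 dx2] *)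
Definition flat (v : 'rV[R]_3) : 'rV[R]_3 := v *m g.
Definition sharp (a : 'rV[R]_3) : 'rV[R]_3 := a *m invmx g.
Definition wedge (a b : 'rV[R]_3) : 'M[R]_3 := a^T *m b - b^T *m a.

Definition levi_civita_symbol (a b c : 'I_3) : R :=
  \det (\matrix_(r < 3, s < 3) ((nth a [:: a; b; c] r == s)%:R : R)).

Definition hodge (beta : 'M[R]_3) : 'rV[R]_3 :=
  \row_c (2^-1 * \sum_a \sum_b
    Num.sqrt `|\det g| * levi_civita_symbol a b c
      * (invmx g *m beta *m invmx g) a b).

Definition cross (v y : 'rV[R]_3) : 'rV[R]_3 :=
  sharp (hodge (wedge (flat v) (flat y))).

(* For a curve [t |-> (x(t), v(t))] of tangent vectors with derivative
   [(dx, dv)], the covariant derivatives D^l V/dt and D^r V/dt of [V]. *)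
Definition nablaV (v dx dv : 'rV[R]_3) := dv + gamma dx v.
Definition Pl (v dx dv : 'rV[R]_3) := nablaV v dx dv + cross v dx.
Definition Pr (v dx dv : 'rV[R]_3) := nablaV v dx dv - cross v dx.

End Coordinates.

(* A quadratic form on the tangent bundle of T^{1,t}M, in the chart [i]:
   arguments are the coordinates [(x, v)] of a point of T^{1,t}M and [(dx, dv)]
   of a tangent vector at that point. *)
Definition T1_form (R : realType) (M : lorentz3 R) : Type :=
  idx M -> 'rV[R]_3 * 'rV[R]_3 -> 'rV[R]_3 * 'rV[R]_3 -> R.

Definition Ml (R : realType) (M : lorentz3 R) : T1_form M :=
  fun i xv d => form (met i xv.1) (Pl i xv.1 xv.2 d.1 d.2)
                                  (Pl i xv.1 xv.2 d.1 d.2).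

Definition Mr (R : realType) (M : lorentz3 R) : T1_form M :=
  fun i xv d => form (met i xv.1) (Pr i xv.1 xv.2 d.1 d.2)
                                  (Pr i xv.1 xv.2 d.1 d.2).

(* T^{1,t}M.  A tangent vector is given by its components in all the charts
   around its base point (0 in the other charts, so that Leibniz equality is
   equality of tangent vectors). *)
Record T1t (R : realType) (M : lorentz3 R) := MkT1t {
  base : M;
  comp : idx M -> 'rV[R]_3;
  comp_out : forall i, ~ dom i base -> comp i = 0;
  comp_trans : forall i j, dom i base -> dom j base ->
    comp j = 'd (phi j \o psi i) (phi i base) (comp i);
  comp_unit : forall i, dom i base ->
    form (met i (phi i base)) (comp i) (comp i) = -1;
  comp_future : forall i, dom i base ->
    form (met i (phi i base)) (comp i) (tfield i (phi i base)) < 0 }.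

Section UnitTimelike.
Variables (R : realType) (M : lorentz3 R).
Local Notation T1 := (T1t M).

Definition coord (i : idx M) (xi : T1) : 'rV[R]_3 * 'rV[R]_3 :=
  (phi i (base xi), comp xi i).

Definition T1_open (S : set T1) : Prop :=
  forall xi i, S xi -> dom i (base xi) ->
    exists O : set ('rV[R]_3 * 'rV[R]_3),
      [/\ open O, O (coord i xi) &
          forall eta, dom i (base eta) -> O (coord i eta) -> S eta].

(* Smoothness on an open set of T^{1,t}M: in charts, [f] is locally the
   restriction of a smooth map on an open set of R^3 x R^3 (of which T^{1,t}M
   is a hypersurface). *)
Definition T1_smooth (W : normedModType R) (S : set T1) (f : T1 -> W) : Prop :=
  forall xi i, S xi -> dom i (base xi) ->
    exists (O : set ('rV[R]_3 * 'rV[R]_3)%type)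
           (F : ('rV[R]_3 * 'rV[R]_3)%type -> W),
      [/\ open O, O (coord i xi), smooth O F &
          forall eta, S eta -> dom i (base eta) -> O (coord i eta) ->
            f eta = F (coord i eta)].

(* [V] is a smooth curve in T^{1,t}M near the time [t]. *)
Definition smooth_curve (V : R -> T1) (t : R) : Prop :=
  forall i, dom i (base (V t)) ->
    exists J : set R, [/\ open J, J t,
      forall s, J s -> dom i (base (V s)) &
      smooth (J : set R^o) (fun s : R^o => coord i (V s))].

Definition velocity (i : idx M) (V : R -> T1) (t : R) : 'rV[R]_3 * 'rV[R]_3 :=
  derive1 (fun s => coord i (V s)) t.

Definition T1_submersion (W : normedModType R) (S : set T1) (f : T1 -> W) :
    Prop :=
  forall xi w, S xi -> exists2 V : R -> T1,
    V 0 = xi /\ smooth_curve V 0 & derive1 (f \o V) 0 = w.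

(* orbit of the geodesic flow over the time set [I] *)
Definition geodesic (I : set R) (c : R -> T1) : Prop :=
  forall t i, I t -> dom i (base (c t)) ->
    [/\ \forall s \near t, dom i (base (c s)),
        derivable (fun s => coord i (c s)) t 1,
        (velocity i c t).1 = comp (c t) i &
        nablaV i (phi i (base (c t))) (comp (c t) i)
          (velocity i c t).1 (velocity i c t).2 = 0].

Definition flow_equiv (U : set T1) (xi eta : T1) : Prop :=
  exists (I : set R) (c : R -> T1) (a b : R),
    [/\ open I, is_interval I, I a & I b] /\
    [/\ geodesic I c, c @` I `<=` U, c a = xi & c b = eta].

(* [geodesics U] is the quotient of the open set [U] by the geodesic flow in
   [U], [leaf U] is the projection; G(M) is [geodesics setT]. *)
Definition leaf (U : set T1) (xi : T1) : set T1 :=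
  [set eta | flow_equiv U xi eta].

Definition geodesics (U : set T1) : set (set T1) := leaf U @` U.

(* quotient topology *)
Definition geodesics_open (U : set T1) (V : set (set T1)) : Prop :=
  V `<=` geodesics U /\ T1_open (U `&` leaf U @^-1` V).

(* The 4-dimensional model space, R^2 x R^2. *)
Definition R4 : normedModType R := ('rV[R]_2 * 'rV[R]_2)%type.

(* [f] is a chart, defined on [V], of the smooth structure on the quotient for
   which the projection from [U] is a smooth submersion. *)
Definition geodesics_chart (U : set T1) (V : set (set T1)) (f : set T1 -> R4) :
    Prop :=
  [/\ geodesics_open U V,
      forall c d, V c -> V d -> f c = f d -> c = d,
      forall V', geodesics_open U V' -> V' `<=` V -> open (f @` V'),
      T1_smooth (U `&` leaf U @^-1` V) (f \o leaf U) &
      T1_submersion (U `&` leaf U @^-1` V) (f \o leaf U)].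

(* The quotient is, near [c], a 4-manifold onto which [U] submerses.  For
   [U = setT] this can fail: if [M] is the quotient of AdS_3 = SL_2(R) by left
   multiplication by an elliptic element of order 3, then G(M) is the quotient
   of H^2 x H^2 by a rotation of order 3 of the first factor. *)
Definition manifold_at (U : set T1) (c : set T1) : Prop :=
  exists (V : set (set T1)) (f : set T1 -> R4), V c /\ geodesics_chart U V f.

(* [m] is the expression in the chart [(V, f)] of the quadratic form on the
   quotient whose pull-back to [U] is [Q], i.e. the form induced by [Q]. *)
Definition induced_form (U : set T1) (V : set (set T1)) (f : set T1 -> R4)
    (Q : T1_form M) (m : R4 -> R4 -> R) : Prop :=
  forall (X : R -> T1) (t : R) (i : idx M),
    U (X t) -> V (leaf U (X t)) -> smooth_curve X t -> dom i (base (X t)) ->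
    m (f (leaf U (X t))) (derive1 (f \o leaf U \o X) t)
    = Q i (coord i (X t)) (velocity i X t).

End UnitTimelike.

(* The upper half-plane [{(x, y) | y > 0}] with [(dx^2 + dy^2) / y^2]. *)
Definition H2 (R : realType) : set 'rV[R]_2 := [set z | 0 < z 0 1].

Definition hyp (R : realType) (z w : 'rV[R]_2) : R :=
  (w 0 0 ^+ 2 + w 0 1 ^+ 2) / z 0 1 ^+ 2.

(* Around [c], the quotient of [U] by the geodesic flow, with the sum of the
   forms induced by [Ml] and [Mr], is isometric to an open set of H^2 x H^2. *)
Definition isometric_H2H2_at (R : realType) (M : lorentz3 R)
    (U : set (T1t M)) (c : set (T1t M)) : Prop :=
  exists (V : set (set (T1t M))) (f : set (T1t M) -> R4 R)
         (ml mr : R4 R -> R4 R -> R),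
    [/\ V c, geodesics_chart U V f & f @` V `<=` @H2 R `*` @H2 R] /\
    [/\ induced_form U V f (@Ml R M) ml, induced_form U V f (@Mr R M) mr &
        forall z w, (f @` V) z ->
          ml z w + mr z w = hyp z.1 w.1 + hyp z.2 w.2].

(* Main.v *)
Require Import Defs.
From HB Require Import structures.
From mathcomp Require Import all_boot all_order all_algebra.
From mathcomp Require Import all_classical all_reals all_analysis.
From mathcomp Require Import ring lra.
Import Defs.
Import Order.TTheory GRing.Theory Num.Theory.
Import numFieldNormedType.Exports.
Local Open Scope classical_set_scope.
Local Open Scope ring_scope.
Set Implicit Arguments.
Unset Strict Implicit.
Unset Printing Implicit Defensive.

(* Identify R^{2,2} with the 2x2 real matrices, the quadratic form being -det, so
   that AdS_3 is SL_2(R).  A unit time-like vector w at y gives two elliptic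
   elements of SL_2(R), adj(y) w and w adj(y), hence the pair Phi(y, w) of their
   fixed points in H^2 x H^2.  Phi is invariant under the geodesic flow, which is
   the rotation of the pair (y, w), its fibres are the orbits, and since the left
   and right invariant frames of SL_2(R) are parallel for D^l and D^r, M_l and M_r
   are the pull-backs by Phi of the metrics of the two factors.

   On M one composes Phi with a local developing map.  The chart so obtained on a
   small set of geodesics extends to every unit vector of those geodesics by sliding
   neighbourhoods along the flow.  It is injective when flow equivalent vectors near
   a given one have the same Phi: this holds by invariance when geodesics are cut to
   the domain of the developing map, and when G(M) is a manifold it follows from the
   local injectivity of submersions between manifolds of the same dimension. *)

(** * Germs of smooth maps *)

(** A vector can flow out of the domain of a developing map and return to it with another value of
    [Phi], by holonomy; its leaf then meets the domain in several orbits of the local flow.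
    Injectivity of the chart is therefore the one property that depends on how the geodesics are
    cut; all the others are common to both cases. No flow on T^{1,t}M is constructed: in the model
    it is [rot], and [sect] is an explicit section of [Phi], so that openness and submersivity come
    from explicit preimages and curves. Reversing the orientation changes the sign of the cross
    product, hence exchanges D^l and D^r; the developing map has to preserve the orientation for M_l
    to correspond to the first factor. No scaling constant appears, because minus the determinant of
    the velocity of adj(y) w is at once the value of M_l and the squared hyperbolic speed of the
    fixed point. *)

Section Germs.
Variable R : realType.
Implicit Types U V W : normedModType R.

(** Quantifying over the points near [x] at every level makes the class depend only on the germ of
    [f], so functions can be replaced by others that agree near [x] without an open set being
    carried along. *)
Fixpoint Ck_germ V W (k : nat) (f : V -> W) (x : V) : Prop :=
  if k is k'.+1 then
    (\forall y \near x, differentiable f y) /\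
    (forall v : V, Ck_germ k' (fun y => 'D_v f y) x)
  else \forall y \near x, {for y, continuous f}.

Definition smooth_at V W (f : V -> W) (x : V) := forall k, Ck_germ k f x.

Lemma Ck_germ_ext V W k (f g : V -> W) x :
  (\near x, f x = g x) -> Ck_germ k f x -> Ck_germ k g x.
Proof.
(* The little-o expansion of [f1] at [y] is also one for [g1], and such an expansion determines the
   differential. *)
have near_diff (f1 g1 : V -> W) y : (\near y, f1 y = g1 y) ->
    differentiable f1 y -> differentiable g1 y.
  move=> fg df; suff : is_diff y g1 ('d f1 y) by case.
  have fgy : f1 y = g1 y by exact: nbhs_singleton fg.
  have fgo : g1 \o shift y = cst (g1 y) + 'd f1 y +o_ 0 id.
    apply/eqaddoP => _/posnumP[e].
    have /eqaddoP /(_ e%:num) /(_ [gt0 of e%:num]) := diff_locally df.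
    apply: filter_app.
    have : \forall h \near (0 : V), f1 (h + y) = g1 (h + y).
      have := fg; rewrite (near_shift 0 y) /=.
      by apply: filterS => h /=; rewrite subr0.
    by apply: filterS => h /= E; rewrite /= !fctE /= E fgy.
  have dE := diff_unique (diff_continuous df) fgo.
  by apply: DiffDef => //; apply/diff_locallyP; rewrite dE; split=> //;
    exact: diff_continuous.
elim: k f g => [|k IH] f g fg /=.
  move=> cf; near=> y.
  have fgy : {near y, f =1 g} by near: y; exact: near_join.
  rewrite /prop_for /continuous_at -(nbhs_singleton fgy).
  have cfy : {for y, continuous f} by near: y.
  apply: cvg_trans cfy.
  by apply: near_eq_cvg.
move=> [df Df]; split.
  near=> y.
  apply: (near_diff f); last by near: y.
  by near: y; exact: near_join.
move=> v; apply: IH (Df v); near=> y.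
by apply: near_eq_derive; near: y; exact: near_join.
Unshelve. all: by end_near. Qed.

Lemma Ck_germW V W k (f : V -> W) x : Ck_germ k.+1 f x -> Ck_germ k f x.
Proof.
elim: k f => [|k IH] f [df Df] /=.
  by apply: filterS df => y; exact: differentiable_continuous.
by split => // v; apply: IH (Df v).
Qed.

Lemma Ck_germP V W k (U : set V) (f : V -> W) : open U ->
  Ck k U f <-> forall x, U x -> Ck_germ k f x.
Proof.
move=> oU; elim: k f => [|k IH] f /=.
  split=> cf x Ux; last exact: nbhs_singleton (cf x Ux).
  by apply: filterS (open_nbhs_nbhs (conj oU Ux)) => y; exact: cf.
split=> [[df Df] x Ux|cf]; first split.
- by apply: filterS (open_nbhs_nbhs (conj oU Ux)) => y; exact: df.
- by move=> v; apply/IH: x Ux.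
- by split=> [x /cf[/nbhs_singleton]|v]//; apply/IH => x /cf[].
Qed.

Lemma smoothP V W (U : set V) (f : V -> W) : open U ->
  smooth U f <-> forall x, U x -> smooth_at f x.
Proof.
move=> oU; split=> [sf x Ux k|sf k]; first exact: (Ck_germP k f oU).1.
by apply/Ck_germP => // x /sf.
Qed.

Lemma smooth_at_ext V W (f g : V -> W) x :
  (\near x, f x = g x) -> smooth_at f x -> smooth_at g x.
Proof. by move=> fg sf k; apply: Ck_germ_ext (sf k). Qed.

Lemma smooth_at_differentiable V W (f : V -> W) x :
  smooth_at f x -> differentiable f x.
Proof. by move=> /(_ 1%N)[df _]; exact: nbhs_singleton df. Qed.

Lemma smooth_at_near_differentiable V W (f : V -> W) x :
  smooth_at f x -> \forall y \near x, differentiable f y.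
Proof. by move=> /(_ 1%N)[]. Qed.

Lemma smooth_at_continuous V W (f : V -> W) x :
  smooth_at f x -> {for x, continuous f}.
Proof. by move=> /smooth_at_differentiable; exact: differentiable_continuous. Qed.

Lemma smooth_at_derive V W (f : V -> W) v x :
  smooth_at f x -> smooth_at (fun y => 'D_v f y) x.
Proof. by move=> sf k; have [_] := sf k.+1; exact. Qed.

Lemma smooth_at_cst V W (c : W) (x : V) : smooth_at (cst c) x.
Proof.
move=> k; elim: k c => [|k IH] c /=.
  by apply: nearW => y; exact: cst_continuous.
split; first by apply: nearW => y.
move=> v; apply: Ck_germ_ext (IH 0); apply: nearW => y.
by rewrite derive_cst.
Qed.

Lemma Ck_germ_lin V W W' k (L : {linear W -> W'}) (f : V -> W) x :
  continuous L -> Ck_germ k f x -> Ck_germ k (L \o f) x.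
Proof.
move=> cL; elim: k f => [|k IH] f /=.
  apply: filterS => y cf; apply: continuous_comp => //; exact: cL.
move=> [df Df]; split.
  apply: filterS df => y dfy; apply: differentiable_comp => //.
  exact: linear_differentiable.
move=> v; apply: Ck_germ_ext (IH _ (Df v)).
near=> y; have dfy : differentiable f y by near: y.
have dL : differentiable L (f y) by exact: linear_differentiable.
rewrite /= !deriveE//; last exact: differentiable_comp.
by rewrite (diff_comp dfy dL) /= diff_lin.
Unshelve. all: by end_near. Qed.

Lemma Ck_germD V W k (f g : V -> W) x :
  Ck_germ k f x -> Ck_germ k g x -> Ck_germ k (f \+ g) x.
Proof.
elim: k f g => [|k IH] f g /=.
  by apply: filterS2 => y cf cg; exact: cvgD.
move=> [df Df] [dg Dg]; split.
  by move: df dg; apply: filterS2 => y; exact: differentiableD.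
move=> v; apply: Ck_germ_ext (IH _ _ (Df v) (Dg v)); near=> y.
by rewrite /= deriveD //; apply: diff_derivable; near: y.
Unshelve. all: by end_near. Qed.

Lemma Ck_germ_sum V W k (I : Type) (r : seq I) (P : pred I) (f : I -> V -> W) x :
  (forall i, P i -> Ck_germ k (f i) x) ->
  Ck_germ k (fun y => \sum_(i <- r | P i) f i y) x.
Proof.
move=> sf; elim: r => [|i r IH].
  by apply: Ck_germ_ext (@smooth_at_cst V W 0 x k); apply: nearW => y; rewrite big_nil.
case Pi : (P i); last first.
  by apply: Ck_germ_ext IH; apply: nearW => y; rewrite big_cons Pi.
apply: Ck_germ_ext (Ck_germD (sf i Pi) IH).
by apply: nearW => y; rewrite big_cons Pi.
Qed.

Lemma Ck_germM V k (f g : V -> R) x :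
  Ck_germ k f x -> Ck_germ k g x -> Ck_germ k (f \* g) x.
Proof.
elim: k f g => [|k IH] f g /=.
  by apply: filterS2 => y cf cg; exact: cvgM.
move=> [df Df] [dg Dg]; split.
  by move: df dg; apply: filterS2 => y; exact: differentiableM.
move=> v.
have cf : Ck_germ k f x by apply: Ck_germW; split.
have cg : Ck_germ k g x by apply: Ck_germW; split.
apply: Ck_germ_ext (Ck_germD (IH _ _ cf (Dg v)) (IH _ _ cg (Df v))); near=> y.
by rewrite /= deriveM //; apply: diff_derivable; near: y.
Unshelve. all: by end_near. Qed.

(* Directional derivatives control the differential only in finite dimension:
   [x = \sum_i l i x *: e i] is what the chain rule for [Ck_germ] uses. *)
Class findim V : Prop := FinDim {
  findim_basis : exists (I : finType) (e : I -> V) (l : I -> {linear V -> R}),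
    [/\ forall i, continuous (l i), forall x, x = \sum_i l i x *: e i &
      forall i j, l i (e j) = (i == j)%:R] }.

(** The existential form hides the packed linear structure, so that only the values and the
    continuity of [L] enter later proofs. *)
Lemma coord_linear m n i j : exists2 L : {linear 'M[R]_(m, n) -> R},
  continuous L & forall M, L M = M i j.
Proof.
have lin : linear (fun v : 'M[R]_(m, n) => v i j : R).
  by move=> a u v; rewrite !mxE.
pose p := GRing.isLinear.Build _ _ _ _ _ lin.
pose L : {linear 'M[R]_(m, n) -> R} := HB.pack (fun v : 'M[R]_(m, n) => v i j : R) p.
by exists L => //; exact: coord_continuous.
Qed.

Lemma fst_linear V W : exists2 L : {linear (V * W)%type -> V},
  continuous L & forall q, L q = q.1.
Proof.
have lin : linear (fst : (V * W)%type -> V) by [].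
pose p := GRing.isLinear.Build _ _ _ _ _ lin.
pose L : {linear (V * W)%type -> V} := HB.pack (fst : (V * W)%type -> V) p.
by exists L => // x; exact: cvg_fst.
Qed.

Lemma snd_linear V W : exists2 L : {linear (V * W)%type -> W},
  continuous L & forall q, L q = q.2.
Proof.
have lin : linear (snd : (V * W)%type -> W) by [].
pose p := GRing.isLinear.Build _ _ _ _ _ lin.
pose L : {linear (V * W)%type -> W} := HB.pack (snd : (V * W)%type -> W) p.
by exists L => // x; exact: cvg_snd.
Qed.

Lemma scalel_linear V (e : V) : exists2 L : {linear R -> V},
  continuous L & forall t, L t = t *: e.
Proof.
have lin : linear ( *:%R ^~ e : R -> V).
  by move=> a y z; rewrite scalerDl scalerA.
pose m := GRing.isLinear.Build _ _ _ _ _ lin.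
pose L : {linear R -> V} := HB.pack ( *:%R ^~ e : R -> V) m.
by exists L => //; exact: scalel_continuous.
Qed.

#[global] Instance findim_R : findim (R : normedModType R).
Proof.
split; exists unit, (fun=> 1), (fun=> idfun); split => [_ x //|x|[] []] //.
by rewrite big_const card_unit /= addr0 [_ *: _]mulr1.
Qed.

#[global] Instance findim_rV n : findim 'rV[R]_n.
Proof.
have coord (i : 'I_n) : exists L : {linear 'rV[R]_n -> R},
    continuous L /\ forall v, L v = v 0 i.
  by have [L cL EL] := @coord_linear 1 n 0 i; exists L.
have [l lP] := choice coord.
split; exists 'I_n, (fun i => delta_mx 0 i), l; split=> [i|x|i j].
- exact: (lP i).1.
- rewrite {1}[x]row_sum_delta; apply: eq_bigr => i _.
  by rewrite (lP i).2.
- by rewrite (lP i).2 mxE eqxx.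
Qed.

Lemma pairD V W (a c : V) (b d : W) : (a, b) + (c, d) = (a + c, b + d).
Proof. by []. Qed.

#[global] Instance findim_prod V W : findim V -> findim W -> findim (V * W)%type.
Proof.
move=> -[[I [e [l [cl El dl]]]]] [[J [f [m [cm Em dm]]]]].
have fstL (i : I) : exists L : {linear (V * W)%type -> R},
    continuous L /\ forall v, L v = l i v.1.
  have lin : linear (fun v : (V * W)%type => l i v.1).
    by move=> a u v; rewrite /= linearP.
  pose p := GRing.isLinear.Build _ _ _ _ _ lin.
  pose L : {linear (V * W)%type -> R} := HB.pack (fun v : (V * W)%type => l i v.1) p.
  exists L; split => // v; apply: continuous_comp; [exact: cvg_fst|exact: cl].
have sndL (i : J) : exists L : {linear (V * W)%type -> R},
    continuous L /\ forall v, L v = m i v.2.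
  have lin : linear (fun v : (V * W)%type => m i v.2).
    by move=> a u v; rewrite /= linearP.
  pose p := GRing.isLinear.Build _ _ _ _ _ lin.
  pose L : {linear (V * W)%type -> R} := HB.pack (fun v : (V * W)%type => m i v.2) p.
  exists L; split => // v; apply: continuous_comp; [exact: cvg_snd|exact: cm].
have [l1 l1P] := choice fstL; have [m1 m1P] := choice sndL.
split; exists (I + J)%type.
exists (fun k => match k with inl i => (e i, 0) | inr j => (0, f j) end).
exists (fun k => match k with inl i => l1 i | inr j => m1 j end).
split=> [[i|j]|x|[i|i] [j|j]]; [exact: (l1P i).1|exact: (m1P j).1| | | | |];
  rewrite ?(l1P _).2 ?(m1P _).2 /= ?dl ?dm ?linear0//.
rewrite big_sumType /=.
under eq_bigr do rewrite (l1P _).2.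
under [X in _ + X]eq_bigr do rewrite (m1P _).2.
have E1 : \sum_i l i x.1 *: (e i, 0 : W) = (x.1, 0).
  rewrite {2}(El x.1); elim/big_ind2 : _ => // [a b c d -> ->|i _].
    by rewrite pairD addr0.
  by congr pair; rewrite scaler0.
have E2 : \sum_j m j x.2 *: (0 : V, f j) = (0, x.2).
  rewrite {2}(Em x.2); elim/big_ind2 : _ => // [a b c d -> ->|i _].
    by rewrite pairD addr0.
  by congr pair; rewrite scaler0.
by rewrite E1 E2 pairD addr0 add0r -surjective_pairing.
Qed.

Lemma Ck_germ_coords V W k (f : V -> W) x : findim W ->
  (forall L : {linear W -> R}, continuous L -> Ck_germ k (L \o f) x) ->
  Ck_germ k f x.
Proof.
case=> -[I [e [l [cl El _]]]] H.
have E y : f y = \sum_i l i (f y) *: e i by rewrite -El.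
apply: (@Ck_germ_ext V W k (fun y => \sum_i l i (f y) *: e i)).
  by apply: nearW => y; rewrite -E.
apply: Ck_germ_sum => i _.
have [L cL EL] := scalel_linear (e i).
apply: Ck_germ_ext (Ck_germ_lin cL (H (l i) (cl i))).
by apply: nearW => y /=; rewrite EL.
Qed.

Lemma diff_basis V W (I : finType) (e : I -> V) (l : I -> V -> R)
    (g : V -> W) x : (forall x, x = \sum_i l i x *: e i) ->
  differentiable g x -> forall v, 'd g x v = \sum_i l i v *: 'D_(e i) g x.
Proof.
move=> El dg v; rewrite {1}(El v) linear_sum; apply: eq_bigr => i _.
by rewrite linearZ /= deriveE.
Qed.

(** Scalar [g] suffices, vector values being recovered by [Ck_germ_coords]. In a basis of [V'] the
    chain rule is a finite sum of products of derivatives of [f] with partial derivatives of [g], so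
    the induction on [k], general in [g], closes with [Ck_germM], while [Ck_germW] lowers the order
    of [f]. *)
Lemma Ck_germ_comp1 V V' k (f : V -> V') (g : V' -> R) x : findim V' ->
  Ck_germ k f x -> Ck_germ k g (f x) -> Ck_germ k (g \o f) x.
Proof.
case=> -[I [e [l [cl El _]]]]; elim: k g => [|k IH] g.
  move=> /= cf cg; have cfx := nbhs_singleton cf.
  have cg' : \forall y \near x, {for f y, continuous g} by exact: (cfx _ cg).
  by move: cf cg'; apply: filterS2 => y cfy cgy; apply: (continuous_comp cfy).
move=> sf sg; have [df Df] := sf; have [dg Dg] := sg.
have cfx : {for x, continuous f}.
  exact/differentiable_continuous/(nbhs_singleton df).
have dg' : \forall y \near x, differentiable g (f y) by exact: (cfx _ dg).
split.
  by move: df dg'; apply: filterS2 => y; exact: differentiable_comp.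
move=> v.
apply: (@Ck_germ_ext V _ k
  (fun y => \sum_i (l i ('D_v f y)) * ('D_(e i) g (f y)))).
  near=> y.
  have dfy : differentiable f y by near: y.
  have dgy : differentiable g (f y) by near: y.
  rewrite [in RHS]deriveE; last exact: differentiable_comp.
  by rewrite (diff_comp dfy dgy) /= (diff_basis El)// deriveE.
apply: Ck_germ_sum => i _; apply: Ck_germM.
  exact: (Ck_germ_lin (cl i) (Df v)).
by apply: (IH (fun z => 'D_(e i) g z)); [exact: Ck_germW|exact: Dg].
Unshelve. all: by end_near. Qed.

Lemma smooth_at_lin V W W' (L : {linear W -> W'}) (f : V -> W) x :
  continuous L -> smooth_at f x -> smooth_at (fun y => L (f y)) x.
Proof. by move=> cL sf k; exact: Ck_germ_lin. Qed.

Lemma smooth_at_comp V V' W (f : V -> V') (g : V' -> W) x :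
  findim V' -> findim W ->
  smooth_at f x -> smooth_at g (f x) -> smooth_at (fun y => g (f y)) x.
Proof.
move=> fV' fW sf sg k; apply: Ck_germ_coords => // L cL.
apply: (@Ck_germ_comp1 V V' k f (L \o g)) => //; exact: Ck_germ_lin.
Qed.

Lemma smooth_atD V W (f g : V -> W) x :
  smooth_at f x -> smooth_at g x -> smooth_at (fun y => f y + g y) x.
Proof. by move=> sf sg k; exact: Ck_germD. Qed.

Lemma smooth_at_sum V W (I : Type) (r : seq I) (P : pred I) (f : I -> V -> W) x :
  (forall i, P i -> smooth_at (f i) x) ->
  smooth_at (fun y => \sum_(i <- r | P i) f i y) x.
Proof. by move=> sf k; apply: Ck_germ_sum => i Pi; exact: sf. Qed.

Lemma smooth_atM V (f g : V -> R) x :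
  smooth_at f x -> smooth_at g x -> smooth_at (fun y => f y * g y) x.
Proof. by move=> sf sg k; exact: Ck_germM. Qed.

Lemma smooth_at_id V (x : V) : smooth_at id x.
Proof.
case=> [|k] /=; first by apply: nearW => y.
split; first by apply: nearW => y.
move=> v; apply: Ck_germ_ext (@smooth_at_cst V V v x k).
by apply: nearW => y; rewrite derive_id.
Qed.

Lemma smooth_atN V W (f : V -> W) x :
  smooth_at f x -> smooth_at (fun y => - f y) x.
Proof.
have [L cL EL] : exists2 L : {linear W -> W}, continuous L & forall t, L t = - t.
  have lin : linear (-%R : W -> W) by move=> a y z; rewrite opprD scalerN.
  pose m := GRing.isLinear.Build _ _ _ _ _ lin.
  pose L : {linear W -> W} := HB.pack (-%R : W -> W) m.
  by exists L => //; exact: opp_continuous.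
move=> sf; apply: smooth_at_ext (smooth_at_lin cL sf).
by apply: nearW => y.
Qed.

Lemma smooth_at_scale V (c : V) (x : R) : smooth_at (fun t : R => t *: c) x.
Proof.
have [L cL EL] := scalel_linear c.
have -> : (fun t => t *: c) = (fun t => L t) by apply/funext => t; rewrite EL.
exact: smooth_at_lin cL (@smooth_at_id R x).
Qed.

Lemma derive_R W (f : R -> W) (v x : R) :
  differentiable f x -> 'D_v f x = v *: 'D_1 f x.
Proof. by move=> df; rewrite !deriveE// -{1}[v]mulr1 linearZ. Qed.

Lemma smooth_at_cos_sin (x : R) :
  smooth_at (cos : R -> R) x /\ smooth_at (sin : R -> R) x.
Proof.
have dc (y : R) : differentiable (cos : R -> R) y.
  by apply/derivable1_diffP; case: (is_derive_cos y).
have ds (y : R) : differentiable (sin : R -> R) y.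
  by apply/derivable1_diffP; case: (is_derive_sin y).
(* Each derivative is a multiple of the other function, so a single induction treats both. *)
suff H k : Ck_germ k (cos : R -> R) x /\ Ck_germ k (sin : R -> R) x.
  by split=> k; case: (H k).
elim: k => [|k [IHc IHs]].
  by split; [exact: (@filterE _ (nbhs x) _ _ (fun y => differentiable_continuous (dc y)))|
    exact: (@filterE _ (nbhs x) _ _ (fun y => differentiable_continuous (ds y)))].
split; split; [exact: (@filterE _ (nbhs x) _ _ dc)| |exact: (@filterE _ (nbhs x) _ _ ds)|];
  move=> v.
  have -> : 'D_v (cos : R -> R) = fun y => - v * sin y.
    apply/funext => y; rewrite derive_R//.
    by have [_ ->] := is_derive_cos y; rewrite mulNr; exact: mulrN.
  by apply: Ck_germM => //; exact: smooth_at_cst.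
have -> : 'D_v (sin : R -> R) = fun y => v * cos y.
  by apply/funext => y; rewrite derive_R//; have [_ ->] := is_derive_sin y.
by apply: Ck_germM => //; exact: smooth_at_cst.
Qed.

Lemma smooth_at_pair U V W (f : U -> V) (g : U -> W) x :
  smooth_at f x -> smooth_at g x -> smooth_at (fun y => (f y, g y)) x.
Proof.
move=> sf sg k; elim: k f g sf sg => [|k IH] f g sf sg /=.
  move: (sf 0%N) (sg 0%N) => /=; apply: filterS2 => y cf cg.
  exact: cvg_pair cf cg.
have df := smooth_at_near_differentiable sf.
have dg := smooth_at_near_differentiable sg.
split.
  by move: df dg; apply: filterS2 => y; exact: differentiable_pair.
move=> v; apply: Ck_germ_ext (IH _ _ (smooth_at_derive v sf) (smooth_at_derive v sg)).
near=> y.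
have dfy : differentiable f y by near: y.
have dgy : differentiable g y by near: y.
rewrite (deriveE _ dfy) (deriveE _ dgy) deriveE ?diff_pair//.
exact: differentiable_pair.
Unshelve. all: by end_near. Qed.

Lemma smooth_at_fst U V W (f : U -> (V * W)%type) x :
  smooth_at f x -> smooth_at (fun y => (f y).1) x.
Proof.
have [L cL EL] := fst_linear V W => /(smooth_at_lin cL).
by have -> : (fun y => L (f y)) = (fun y => (f y).1) by apply/funext => y.
Qed.

Lemma smooth_at_snd U V W (f : U -> (V * W)%type) x :
  smooth_at f x -> smooth_at (fun y => (f y).2) x.
Proof.
have [L cL EL] := snd_linear V W => /(smooth_at_lin cL).
by have -> : (fun y => L (f y)) = (fun y => (f y).2) by apply/funext => y.
Qed.

Lemma smooth_at_coord U m n (f : U -> 'M[R]_(m, n)) i j x :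
  smooth_at f x -> smooth_at (fun y => f y i j : R) x.
Proof.
have [L cL EL] := coord_linear i j => /(smooth_at_lin cL).
by have -> : (fun y => L (f y)) = (fun y => f y i j) by apply/funext => y.
Qed.

Lemma smooth_at_row U n (f : 'I_n -> U -> R) x :
  (forall i, smooth_at (f i) x) -> smooth_at (fun y => \row_i f i y) x.
Proof.
move=> sf.
have -> : (fun y => \row_i f i y) = fun y => \sum_i f i y *: delta_mx 0 i.
  apply/funext => y; rewrite [LHS]row_sum_delta.
  by apply: eq_bigr => i _; rewrite mxE.
apply: smooth_at_sum => i _.
exact: (smooth_at_comp _ _ (sf i) (smooth_at_scale (delta_mx 0 i) (f i x))).
Qed.

Lemma smooth_at_inv (x : R) : x != 0 -> smooth_at (GRing.inv : R -> R) x.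
Proof.
move=> x0.
have dinv (y : R) : y != 0 -> differentiable (GRing.inv : R -> R) y.
  exact: differentiable_Rinv.
have nz : \forall y \near x, y != 0 by exact: (@cvgr_neq0 R R R (nbhs x) _ idfun x cvg_id x0).
have cinv : \forall y \near x, differentiable (GRing.inv : R -> R) y.
  by apply: filterS nz => y; exact: dinv.
elim=> [|k IH] /=.
  by apply: filterS cinv => y; exact: differentiable_continuous.
split=> // v.
(* The derivative in the direction [v] is [- v] times the square of the inverse, a product of
   functions already of class [k]. *)
apply: Ck_germ_ext (Ck_germM (@smooth_at_cst R R (- v) x k) (Ck_germM IH IH)).
near=> y; rewrite /= deriveE; last by near: y.
rewrite diff_Rinv; last by near: y.
by rewrite /= -expr2 exprVn mulNr mulrC -mulNr.
Unshelve. all: by end_near. Qed.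

Lemma smooth_at_sqrt (x : R) : 0 < x -> smooth_at (Num.sqrt : R -> R) x.
Proof.
move=> x0.
have pos : \forall y \near x, 0 < y by exact: lt_nbhsr.
have dsq (y : R) : 0 < y -> differentiable (Num.sqrt : R -> R) y.
  by move=> y0; apply/derivable1_diffP; have := is_derive1_sqrt y0; case.
have dsqrt : \forall y \near x, differentiable (Num.sqrt : R -> R) y.
  by apply: filterS pos => y; exact: dsq.
elim=> [|k IH].
  by apply: filterS dsqrt => y; exact: differentiable_continuous.
split=> // v.
have sx : Num.sqrt x * 2 != 0 by rewrite mulf_neq0// ?pnatr_eq0// gt_eqF// sqrtr_gt0.
apply: (@Ck_germ_ext R R k (fun y => v * (Num.sqrt y * 2)^-1)).
  near=> y; have y0 : 0 < y by near: y.
  rewrite derive_R; last exact: dsq.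
  by have [_ ->] := is_derive1_sqrt y0; rewrite mulrC [2 * _]mulrC mulrC.
apply: Ck_germM; first exact: smooth_at_cst.
apply: (@Ck_germ_comp1 R R k (fun y => Num.sqrt y * 2) GRing.inv).
- by apply: Ck_germM => //; exact: smooth_at_cst.
- exact: smooth_at_inv.
Unshelve. all: by end_near. Qed.

Lemma smooth_atB V W (f g : V -> W) (x : V) :
  smooth_at f x -> smooth_at g x -> smooth_at (fun y => f y - g y) x.
Proof. by move=> sf sg; apply: smooth_atD => //; exact: smooth_atN. Qed.

Lemma smooth_atV V (f : V -> R) (x : V) :
  f x != 0 -> smooth_at f x -> smooth_at (fun y => (f y)^-1) x.
Proof.
by move=> f0 sf; apply: (@smooth_at_comp _ _ _ f GRing.inv) => //; exact: smooth_at_inv.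
Qed.

Lemma is_derive_lin U V W (L : {linear V -> W}) (f : U -> V) x v d :
  continuous L -> is_derive x v f d -> is_derive x v (fun y => L (f y)) (L d).
Proof.
move=> cL [fx fd].
have E : (fun h => h^-1 *: (((fun y => L (f y)) \o shift x) (h *: v) - L (f x))) =
    L \o (fun h => h^-1 *: ((f \o shift x) (h *: v) - f x)).
  apply/funext => h; rewrite /= (linearZ_LR L) (linearB L); exact: erefl.
have cv : (fun h => h^-1 *: (((fun y => L (f y)) \o shift x) (h *: v) - L (f x)))
    @ 0^' --> L d.
  rewrite E -fd; apply: continuous_cvg; first exact: cL.
  exact: fx.
split; first by apply/cvg_ex; exists (L d).
by apply/cvg_lim.
Qed.

Lemma is_derive_fst U V W (f : U -> (V * W)%type) x v d :
  is_derive x v f d -> is_derive x v (fun y => (f y).1) d.1.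
Proof.
have [L cL EL] := fst_linear V W => /(is_derive_lin cL).
rewrite EL; have -> : (fun y => L (f y)) = (fun y => (f y).1) by apply/funext => y.
by [].
Qed.

Lemma is_derive_snd U V W (f : U -> (V * W)%type) x v d :
  is_derive x v f d -> is_derive x v (fun y => (f y).2) d.2.
Proof.
have [L cL EL] := snd_linear V W => /(is_derive_lin cL).
rewrite EL; have -> : (fun y => L (f y)) = (fun y => (f y).2) by apply/funext => y.
by [].
Qed.

Lemma is_derive_coord U m n (f : U -> 'M[R]_(m, n)) x v d i j :
  is_derive x v f d -> is_derive x v (fun y => f y i j : R) (d i j).
Proof.
have [L cL EL] := coord_linear i j => /(is_derive_lin cL).
rewrite EL; have -> : (fun y => L (f y)) = (fun y => f y i j) by apply/funext => y.
by [].
Qed.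

Lemma is_derive_pair U V W (f : U -> V) (g : U -> W) x v a b :
  is_derive x v f a -> is_derive x v g b -> is_derive x v (fun y => (f y, g y)) (a, b).
Proof.
move=> [fx fa] [gx gb].
have cv : (fun h => h^-1 *: (((fun y => (f y, g y)) \o shift x) (h *: v) - (f x, g x)))
    @ 0^' --> (a, b).
  by rewrite -fa -gb; apply: cvg_pair; [exact: fx|exact: gx].
split; first by apply/cvg_ex; exists (a, b).
by apply/cvg_lim.
Qed.

Lemma is_derive_rV U n (f : U -> 'rV[R]_n) x v (d : 'rV[R]_n) :
  (forall k, is_derive x v (fun y => f y 0 k : R) (d 0 k)) -> is_derive x v f d.
Proof.
move=> H; have fx : derivable f x v.
  by apply/derivable_mxP => i j; rewrite ord1; case: (H j).
split => //; apply/rowP => k; rewrite derive_mx// mxE.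
by case: (H k).
Qed.

Lemma is_derive_scale U n (f : U -> R) (g : U -> 'rV[R]_n) x v (a : R) b :
  is_derive x v f a -> is_derive x v g b ->
  is_derive x v (fun y => f y *: g y) (a *: g x + f x *: b).
Proof.
move=> fa gb; apply: is_derive_rV => k.
have -> : (fun y => (f y *: g y) 0 k : R) = f * (fun y => g y 0 k).
  by apply/funext => y; rewrite mxE.
apply: is_derive_eq (is_deriveM fa (is_derive_coord 0 k gb)) _.
by rewrite !mxE [LHS]addrC; congr (_ + _); exact: mulrC.
Qed.

Lemma smooth_atZ V W (f : V -> R) (g : V -> W) x : findim W ->
  smooth_at f x -> smooth_at g x -> smooth_at (fun y => f y *: g y) x.
Proof.
move=> fW sf sg k; apply: Ck_germ_coords => L cL.
have -> : L \o (fun y => f y *: g y) = fun y => f y * L (g y).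
  by apply/funext => y; rewrite /= (linearZ_LR L).
by apply: smooth_atM => //; exact: smooth_at_lin.
Qed.

End Germs.

Ltac smooth_step := first
  [ exact: smooth_at_id | exact: smooth_at_cst
  | apply: smooth_at_coord | apply: smooth_at_fst | apply: smooth_at_snd
  | apply: smooth_atD | apply: smooth_atN | apply: smooth_atM ].

(** * Mean value theorem: symmetry of second derivatives, local injectivity *)

Section MeanValue.
Variable R : realType.
Implicit Types V W : normedModType R.

Lemma is_derive_line V W (f : V -> W) (x u : V) (t : R) :
  differentiable f (x + t *: u) ->
  is_derive t 1 (fun s : R => f (x + s *: u)) ('D_u f (x + t *: u)).
Proof.
move=> df.
have [dl El] : is_diff t (fun s : R => x + s *: u) (fun s => 0 + s *: u).
  by apply: is_diffD.
have dc : differentiable (f \o (fun s : R => x + s *: u)) t.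
  exact: differentiable_comp.
split; first exact: diff_derivable.
by rewrite (deriveE _ dc) (diff_comp dl df) /= El /= add0r scale1r deriveE.
Qed.

Lemma mvt_line V (f : V -> R) (x u : V) (s : R) : 0 < s ->
  (forall t : R, 0 <= t <= s -> differentiable f (x + t *: u)) ->
  exists2 t : R, 0 < t < s & f (x + s *: u) - f x = 'D_u f (x + t *: u) * s.
Proof.
move=> s0 df.
have dl (t : R) : 0 <= t <= s -> is_derive t 1 (fun r : R => f (x + r *: u)) ('D_u f (x + t *: u)).
  by move=> ts; apply: is_derive_line; exact: df.
have dl' t : t \in `]0, s[ -> is_derive t 1 (fun r : R => f (x + r *: u)) ('D_u f (x + t *: u)).
  by rewrite in_itv /= => /andP[t0 ts]; apply: dl; rewrite !ltW.
have cl : {within `[0, s], continuous (fun r : R => f (x + r *: u))}.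
  apply: derivable_within_continuous => t; rewrite in_itv /= => ts.
  by have [] := dl t ts.
have [t] := MVT s0 dl' cl.
rewrite in_itv /= scale0r addr0 subr0 => ts E; by exists t.
Qed.

Lemma derive_shift_arg V W (f : V -> W) (c x u : V) :
  differentiable f (x + c) ->
  differentiable (fun y => f (y + c)) x /\
  'D_u (fun y => f (y + c)) x = 'D_u f (x + c).
Proof.
move=> df.
have [dl El] : is_diff x (fun y => y + c) (fun y => y + 0) by apply: is_diffD.
have dc : differentiable (f \o (fun y => y + c)) x by exact: differentiable_comp.
split => //.
by rewrite (deriveE _ dc) (diff_comp dl df) /= El /= addr0 deriveE.
Qed.

(** The mean value theorem is applied twice: along [u] to the increment of [f] by [s *: v], then
    along [v] to ['D_u f]. The left-hand side is symmetric in [u] and [v], which is what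
    [derive_comm] exploits. *)
Lemma second_difference V (f : V -> R) (x u v : V) (s : R) : 0 < s ->
  (forall a b : R, 0 <= a <= s -> 0 <= b <= s ->
     differentiable f (x + a *: u + b *: v) /\
     differentiable ('D_u f) (x + a *: u + b *: v)) ->
  exists a b : R, [/\ 0 <= a <= s, 0 <= b <= s &
    f (x + s *: u + s *: v) - f (x + s *: u) - (f (x + s *: v) - f x)
    = 'D_v ('D_u f) (x + a *: u + b *: v) * s * s].
Proof.
move=> s0 H.
have ss : 0 <= s <= s by rewrite lexx ltW.
have s00 : 0 <= (0 : R) <= s by rewrite lexx ltW.
have df (t : R) : 0 <= t <= s -> differentiable f (x + t *: u).
  by move=> ts; have [] := H t 0 ts s00; rewrite scale0r addr0.
have ds (t : R) : 0 <= t <= s ->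
    differentiable (fun y => f (y + s *: v)) (x + t *: u) /\
    'D_u (fun y => f (y + s *: v)) (x + t *: u) = 'D_u f (x + t *: u + s *: v).
  by move=> ts; apply: derive_shift_arg; have [] := H t s ts ss.
have [t ts] := @mvt_line V (fun y => f (y + s *: v) - f y) x u s s0
  (fun t ts => differentiableB (ds t ts).1 (df t ts)).
have ts' : 0 <= t <= s by case/andP: ts => ? ?; rewrite !ltW.
have dt1 := @diff_derivable _ _ _ _ _ u (ds t ts').1.
have dt2 := @diff_derivable _ _ _ _ _ u (df t ts').
rewrite (deriveB dt1 dt2).
rewrite (ds t ts').2 => E.
have [r rs] := @mvt_line V ('D_u f) (x + t *: u) v s s0
  (fun r rs => (H t r ts' rs).2).
move=> Er; exists t, r; split => //.
  by case/andP: rs => ? ?; rewrite !ltW.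
by rewrite -Er -E.
Qed.

Let mid (a b c d e : R) :
  `|a - c| < e / 2 -> `|b - d| < e / 2 -> d = c -> `|a - b| <= e.
Proof.
move=> h1 h2 E; apply: ltW; rewrite [ltRHS]splitr -(subrKA c).
by apply: le_lt_trans (ler_normD _ _) _; apply: ltrD => //; rewrite -E distrC.
Qed.

Let sq (p q s a b c d a' : R) : 0 < s -> a - b - (c - d) = p * s * s ->
  a' - c - (b - d) = q * s * s -> a = a' -> p = q.
Proof.
move=> s0 E1 E2 E; have sN0 : s != 0 by rewrite gt_eqF.
by apply: (mulIf sN0); apply: (mulIf sN0); rewrite -E1 -E2 E; ring.
Qed.

(** Evaluating one second difference in both orders yields two points close to [x] at which the two
    mixed derivatives take a common value; both derivatives are continuous at [x]. *)
Lemma derive_comm V (f : V -> R) (x u v : V) : smooth_at f x ->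
  'D_u ('D_v f) x = 'D_v ('D_u f) x.
Proof.
move=> sf.
have suv := smooth_at_derive u (smooth_at_derive v sf).
have svu := smooth_at_derive v (smooth_at_derive u sf).
have cuv := smooth_at_continuous suv.
have cvu := smooth_at_continuous svu.
apply/eqP; rewrite -subr_eq0 -normr_le0; apply/ler_addgt0Pr => e e0; rewrite add0r.
have e2 : 0 < e / 2 by rewrite divr_gt0.
have Huv : \forall y \near x, `|'D_u ('D_v f) x - 'D_u ('D_v f) y| < e / 2.
  by move/cvgrPdist_lt : cuv => /(_ _ e2).
have Hvu : \forall y \near x, `|'D_v ('D_u f) x - 'D_v ('D_u f) y| < e / 2.
  by move/cvgrPdist_lt : cvu => /(_ _ e2).
have Hf := smooth_at_near_differentiable sf.
have Hu := smooth_at_near_differentiable (smooth_at_derive u sf).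
have Hv := smooth_at_near_differentiable (smooth_at_derive v sf).
have /nbhs_ballP[d /= d0 Hd] : \forall y \near x,
    (`|'D_u ('D_v f) x - 'D_u ('D_v f) y| < e / 2 /\
     `|'D_v ('D_u f) x - 'D_v ('D_u f) y| < e / 2) /\
    (differentiable f y /\ differentiable ('D_u f) y /\ differentiable ('D_v f) y).
  exact: filterI (filterI Huv Hvu) (filterI Hf (filterI Hu Hv)).
pose N : R := `|u| + `|v| + 1.
have N0 : 0 < N by apply: ltr_wpDl => //; apply: addr_ge0.
(* The parallelogram with sides [s *: u] and [s *: v] stays within [s * N = d / 2] of [x]. *)
pose s := d / 2 / N.
have s0 : 0 < s by rewrite !divr_gt0.
have inb (a b : R) : 0 <= a <= s -> 0 <= b <= s -> ball x d (x + a *: u + b *: v).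
  move=> /andP[a0 as_] /andP[b0 bs].
  rewrite -ball_normE /= opprD opprD addrA addrA subrr add0r -opprD normrN.
  have h1 : `|a *: u + b *: v| <= s * N.
    rewrite (le_trans (ler_normD _ _))// !normrZ !ger0_norm// /N !mulrDr.
    by rewrite -[leLHS]addr0 !lerD// ?ler_wpM2r// mulr1 ltW.
  apply: le_lt_trans h1 _; rewrite divfK ?gt_eqF//.
  by rewrite ltr_pdivrMr// ltr_pMr// ltr1n.
have [a [b [as_ bs E1]]] := @second_difference V f x u v s s0
  (fun a b as_ bs => let: conj _ (conj p (conj q _)) := Hd _ (inb a b as_ bs) in conj p q).
have inb' (a' b' : R) : 0 <= a' <= s -> 0 <= b' <= s -> ball x d (x + a' *: v + b' *: u).
  by move=> h1 h2; rewrite addrAC; exact: inb.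
have [a' [b' [as' bs' E2]]] := @second_difference V f x v u s s0
  (fun a b as_ bs => let: conj _ (conj p (conj _ q)) := Hd _ (inb' a b as_ bs) in conj p q).
have E : 'D_v ('D_u f) (x + a *: u + b *: v) = 'D_u ('D_v f) (x + a' *: v + b' *: u).
  by apply: (sq s0 E1 E2); rewrite addrAC.
have [[_ h2] _] := Hd _ (inb a b as_ bs).
have [[h1 _] _] := Hd _ (inb' a' b' as' bs').
exact: mid h1 h2 E.
Unshelve. all: by end_near. Qed.

Lemma near_eq_const (f : R -> R) (t e : R) : 0 < e ->
  (forall s, `|s - t| < e -> is_derive s 1 f 0) ->
  forall s, `|s - t| < e -> f s = f t.
Proof.
move=> e0 df s se.
have on_line (r : R) : 0 <= r <= 1 -> `|t + r *: (s - t) - t| < e.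
  move=> /andP[r0 r1]; rewrite addrAC subrr add0r normrZ ger0_norm//.
  by apply: le_lt_trans se; rewrite ler_piMl.
have drv (r : R) : 0 <= r <= 1 -> differentiable f (t + r *: (s - t)).
  move=> r01; apply/derivable1_diffP.
  by have [] := df _ (on_line r r01).
have [r /andP[r0 r1]] := @mvt_line R f t (s - t) 1 ltr01 drv.
have r01 : 0 <= r <= 1 by rewrite !ltW.
have [_ d0] := df _ (on_line r r01).
rewrite derive_R; last exact: drv.
rewrite d0 scaler0 mul0r scale1r addrCA subrr addr0.
by move=> /eqP; rewrite subr_eq0 => /eqP.
Qed.

(** Preimages [w i] of the basis vectors define a right inverse [S] of [L]. In coordinates this is a
    product of square matrices equal to the identity, and [mulmx1C] exchanges the factors. *)
Lemma surjective_endo_inverse V (L : {linear V -> V}) : findim V ->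
  (forall w, exists v, L v = w) ->
  exists2 S : {linear V -> V}, continuous S & forall v, S (L v) = v.
Proof.
move=> fV; case: (fV) => -[I [e [l [cl El dl]]]] sL.
have [w Lw] := choice (fun i => sL (e i)).
have lin : linear (fun v => \sum_i l i v *: w i).
  move=> a u v; rewrite scaler_sumr -big_split /=; apply: eq_bigr => i _.
  by rewrite linearP scalerDl scalerA.
pose m := GRing.isLinear.Build _ _ _ _ _ lin.
pose S : {linear V -> V} := HB.pack (fun v => \sum_i l i v *: w i) m.
have SE v : S v = \sum_i l i v *: w i by [].
exists S.
  move=> v; apply: smooth_at_continuous; apply: smooth_at_sum => i _.
  have sl : smooth_at (fun v => l i v) v by apply: smooth_at_lin => //; exact: smooth_at_id.
  exact: (smooth_at_comp _ _ sl (smooth_at_scale (w i) (l i v))).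
pose n := #|I|.
pose A : 'M[R]_n := \matrix_(i, j) l (enum_val i) (L (e (enum_val j))).
pose B : 'M[R]_n := \matrix_(i, j) l (enum_val i) (w (enum_val j)).
have reindexI (U : nmodType) (F : I -> U) : \sum_i F i = \sum_(i < n) F (enum_val i).
  by rewrite (reindex (@enum_val I predT))//; apply: onW_bij; exact: enum_val_bij.
have AB : A *m B = 1%:M.
  apply/matrixP => i j; rewrite !mxE -[RHS]/((i == j)%:R : R).
  rewrite -(inj_eq enum_val_inj) -dl -(Lw (enum_val j)) [in RHS](El (w (enum_val j))).
  rewrite !linear_sum reindexI; apply: eq_bigr => k _.
  by rewrite !linearZ !mxE /= mulrC.
have BA : B *m A = 1%:M by exact: mulmx1C.
have lS j k : l k (\sum_i l i (L (e j)) *: w i) = (k == j)%:R.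
  have := congr1 (fun M : 'M[R]_n => M (enum_rank k) (enum_rank j)) BA.
  rewrite !mxE (inj_eq enum_rank_inj) => <-.
  rewrite linear_sum reindexI; apply: eq_bigr => i _.
  by rewrite linearZ !mxE /= !enum_rankK mulrC.
have SL j : S (L (e j)) = e j.
  rewrite SE [LHS]El.
  under eq_bigr => k _ do rewrite lS.
  rewrite (bigD1 j)//= eqxx scale1r big1 ?addr0// => k /negPf->.
  by rewrite scale0r.
move=> v; transitivity (\sum_j l j v *: S (L (e j))).
  rewrite {1}(El v) (linear_sum L) (linear_sum S).
  by apply: eq_bigr => j _; rewrite (linearZ_LR L) (linearZ_LR S).
by rewrite [RHS]El; apply: eq_bigr => j _; rewrite SL.
Qed.

(** With [S] a left inverse of ['d g x], the map [h = S o g - id] has zero differential at [x]. If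
    [g z = g z'], the increment of [h] from [z'] to [z] is [z' - z], and mean values in the
    coordinates bound the l^1 norm of [z - z'] by half of itself. *)
Lemma locally_injective V (g : V -> V) (x : V) : findim V -> smooth_at g x ->
  (forall w, exists v, 'd g x v = w) ->
  exists2 N : set V, nbhs x N & {in N &, injective g}.
Proof.
move=> fV sg sL; have [S cS SL] := surjective_endo_inverse fV sL.
case: (fV) => -[I [e [l [cl El dl]]]].
pose h z := S (g z) - z.
have sh : smooth_at h x.
  apply: smooth_atD; first exact: smooth_at_lin.
  by apply: smooth_atN; exact: smooth_at_id.
have dh0 j : 'D_(e j) h x = 0.
  have dg := smooth_at_differentiable sg.
  have dSg : differentiable (S \o g) x.
    by apply: differentiable_comp => //; exact: linear_differentiable.
  have did : derivable (id : V -> V) x (e j) by exact: derivable_id.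
  rewrite /h (deriveB (diff_derivable dSg) did) derive_id.
  rewrite (deriveE _ dSg) (diff_comp dg (linear_differentiable _ cS)) /=.
  by rewrite diff_lin// SL subrr.
(* Summing [#|I|] coordinate estimates with constant [(2 * n)^-1] gives a factor at most 1/2; the
   added 1 keeps [n] positive when [I] is empty. *)
pose n : R := #|I|%:R + 1.
have n0 : 0 < n by rewrite ltr_wpDl.
have [d d0 Hd] : exists2 d : R, 0 < d & forall y, ball x d y ->
    differentiable h y /\ forall i j, `|l i ('D_(e j) h y)| <= (2 * n)^-1.
  have : \forall y \near x, differentiable h y /\
      forall ij : I * I, `|l ij.1 ('D_(e ij.2) h y)| <= (2 * n)^-1.
    near=> y; split; first by near: y; exact: smooth_at_near_differentiable.
    near: y; apply: filter_forall => -[i j] /=.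
    have sl : smooth_at (fun y => l i ('D_(e j) h y)) x.
      by apply: smooth_at_lin => //; exact: smooth_at_derive.
    have := smooth_at_continuous sl; rewrite /prop_for /continuous_at dh0 linear0.
    move/cvgr0Pnorm_le; apply.
    by rewrite invr_gt0 mulr_gt0.
  move=> /nbhs_ballP[d /= d0 Hd]; exists d => // y /Hd[dhy H]; split => // i j.
  exact: (H (i, j)).
exists (ball x d); first exact: nbhsx_ballx.
move=> z z' /set_mem zB /set_mem z'B E.
pose u i := l i (z - z').
suff /eqP u0 : \sum_i `|u i| == 0.
  apply/eqP; rewrite -subr_eq0 (El (z - z')) big1// => i _.
  suff -> : l i (z - z') = 0 by rewrite scale0r.
  apply/eqP; rewrite -normr_eq0; move/eqP : u0.
  by rewrite psumr_eq0// => /allP/(_ i); rewrite mem_index_enum => /(_ isT).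
have seg (t : R) : 0 <= t <= 1 -> ball x d (z' + t *: (z - z')).
  move=> /andP[t0 t1]; move: zB z'B; rewrite -!ball_normE /= => zB z'B.
  have -> : x - (z' + t *: (z - z')) = t *: (x - z) + (1 - t) *: (x - z').
    rewrite scalerBl scale1r [RHS]addrCA -scalerBr.
    have -> : x - z - (x - z') = z' - z by rewrite opprB addrC subrKA.
    by rewrite opprD addrA -scalerN opprB.
  rewrite (le_lt_trans (ler_normD _ _))// !normrZ !ger0_norm ?subr_ge0//.
  have [->|tn0] := eqVneq t 0; first by rewrite mul0r subr0 mul1r add0r.
  have tp : 0 < t by rewrite lt_def tn0.
  rewrite [ltRHS](_ : d = t * d + (1 - t) * d); last by ring.
  apply: ltr_leD; first by rewrite ltr_pM2l.
  by apply: ler_wpM2l; rewrite ?subr_ge0// ltW.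
have ub i : `|u i| <= (2 * n)^-1 * \sum_j `|u j|.
  pose f y := l i (h y).
  have df y : ball x d y -> differentiable f y.
    move=> /Hd[dhy _]; apply: differentiable_comp => //.
    exact: linear_differentiable.
  have [t /andP[t0 t1]] := @mvt_line V f z' (z - z') 1 ltr01 (fun t t01 => df _ (seg t t01)).
  have t01 : 0 <= t <= 1 by rewrite !ltW.
  have [dhy Hn] := Hd _ (seg t t01).
  rewrite scale1r [z' + _]addrC subrK mulr1 deriveE; last exact/df/seg.
  rewrite (diff_comp dhy (linear_differentiable _ (cl i))) /= diff_lin//.
  have hz : h z - h z' = - (z - z') by rewrite /h E opprB addrC subrKA opprB.
  rewrite (diff_basis El)// linear_sum /f -linearB hz linearN.
  move=> /(congr1 Num.norm); rewrite normrN => ->.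
  rewrite mulr_sumr (le_trans (ler_norm_sum _ _ _))// ler_sum// => j _.
  by rewrite (linearZ_LR (l i)) normrM [leLHS]mulrC; apply: ler_wpM2r; [exact: normr_ge0|exact: Hn].
have u_ge0 : 0 <= \sum_i `|u i| by rewrite sumr_ge0.
have : \sum_i `|u i| <= 2^-1 * \sum_i `|u i|.
  apply: le_trans (ler_sum _ (fun i _ => ub i)) _.
  set s := \sum_i `|u i| in u_ge0 *.
  rewrite sumr_const -[X in X <= _]mulr_natl mulrA; apply: ler_wpM2r => //.
  rewrite invfM mulrCA ger_pMr ?invr_gt0// ler_pdivrMr// mul1r /n.
  by rewrite lerDl.
by move=> ?; rewrite eq_le; apply/andP; split => //; lra.
Unshelve. all: by end_near. Qed.

End MeanValue.

(** * The unit tangent bundle of AdS_3 *)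

Notation i0 := (ord0 : 'I_4).
Notation i1 := (lift ord0 (ord0 : 'I_3) : 'I_4).
Notation i2 := (lift ord0 (lift ord0 (ord0 : 'I_2)) : 'I_4).
Notation i3 := (lift ord0 (lift ord0 (lift ord0 (ord0 : 'I_1))) : 'I_4).

Section Scalars.
Variable R : realFieldType.
Implicit Types (a b c p q r s P Q S T : R).

(** The coefficient is a certificate that [x - y] lies in the ideal generated by the hypothesis;
    [ring] or [field] then only has to check an identity. *)
Lemma lincomb1 (x y k a b : R) : a = b -> x - y = k * (a - b) -> x = y.
Proof. by move=> -> /eqP; rewrite subrr mulr0 subr_eq0 => /eqP. Qed.

Lemma lincomb2 (x y k a b l c d : R) : a = b -> c = d ->
  x - y = k * (a - b) + l * (c - d) -> x = y.
Proof. by move=> -> -> /eqP; rewrite !subrr !mulr0 addr0 subr_eq0 => /eqP. Qed.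

Lemma lincomb3 (x y k a b l c d m p q : R) : a = b -> c = d -> p = q ->
  x - y = k * (a - b) + l * (c - d) + m * (p - q) -> x = y.
Proof. by move=> -> -> -> /eqP; rewrite !subrr !mulr0 !addr0 subr_eq0 => /eqP. Qed.

End Scalars.

Section Model.
Variable R : realType.
Local Notation vec := 'rV[R]_4.
Implicit Types (x y z w : vec) (a b c p q r s : R).

Definition ads y w : R := form (ads_mx R) y w.

Lemma adsE y w : ads y w =
  - (y 0 i0 * w 0 i0) - y 0 i1 * w 0 i1 + y 0 i2 * w 0 i2 + y 0 i3 * w 0 i3.
Proof.
rewrite /ads /form /ads_mx mul_mx_diag !mxE !big_ord_recl big_ord0 !mxE /=.
by ring.
Qed.

Lemma adsC y w : ads y w = ads w y.
Proof. by rewrite !adsE; ring. Qed.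

Lemma adsDl x y w : ads (x + y) w = ads x w + ads y w.
Proof. by rewrite !adsE !mxE; ring. Qed.

Lemma adsZl a y w : ads (a *: y) w = a * ads y w.
Proof. by rewrite !adsE !mxE; ring. Qed.

Lemma adsDr x y w : ads w (x + y) = ads w x + ads w y.
Proof. by rewrite !adsE !mxE; ring. Qed.

Lemma adsZr a y w : ads w (a *: y) = a * ads w y.
Proof. by rewrite !adsE !mxE; ring. Qed.

Lemma adsNl y w : ads (- y) w = - ads y w.
Proof. by rewrite !adsE !mxE; ring. Qed.

Lemma ads_nondeg y : (forall w, ads y w = 0) -> y = 0.
Proof.
move=> H; apply/rowP => i.
have := H (delta_mx 0 i); rewrite adsE !mxE /=.
by case: (@unliftP _ ord0 i) => [j|] -> /=; [case: (@unliftP _ ord0 j) => [k|] -> /=;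
 [case: (@unliftP _ ord0 k) => [l|] -> /=; [rewrite (ord1 l)|]|]|] => /eqP;
 rewrite ?mulr0 ?mulr1 ?subr0 ?sub0r ?addr0 ?add0r ?oppr0 ?add0r ?oppr_eq0 => /eqP.
Qed.

(* [R^{2,2}] is identified with the 2x2 real matrices [[e11 y, e12 y], [e21 y, e22 y]],
   with [ads y y = - det y]; then AdS_3 is SL_2. *)
Definition e11 y : R := y 0 i0 + y 0 i2.
Definition e12 y : R := y 0 i3 - y 0 i1.
Definition e21 y : R := y 0 i3 + y 0 i1.
Definition e22 y : R := y 0 i0 - y 0 i2.

Definition of_entries (p q r s : R) : vec :=
  \row_(k < 4) nth 0 [:: (p + s) / 2; (r - q) / 2; (p - s) / 2; (q + r) / 2] k.

Lemma entries_of p q r s : ((e11 (of_entries p q r s) = p) *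
  (e12 (of_entries p q r s) = q) * (e21 (of_entries p q r s) = r) *
  (e22 (of_entries p q r s) = s))%type.
Proof. by rewrite /e11 /e12 /e21 /e22 !mxE /=; do !split; field. Qed.

Lemma entriesK y : of_entries (e11 y) (e12 y) (e21 y) (e22 y) = y.
Proof.
apply/rowP => i; rewrite mxE /e11 /e12 /e21 /e22.
by case: (@unliftP _ ord0 i) => [j|] -> /=; [case: (@unliftP _ ord0 j) => [k|] -> /=;
 [case: (@unliftP _ ord0 k) => [l|] -> /=; [rewrite (ord1 l) /=|]|]|]; field.
Qed.

Lemma entries_inj y w : e11 y = e11 w -> e12 y = e12 w -> e21 y = e21 w ->
  e22 y = e22 w -> y = w.
Proof. by move=> E1 E2 E3 E4; rewrite -[y]entriesK E1 E2 E3 E4 entriesK. Qed.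

Lemma entriesD y w :
  (((e11 (y + w) = e11 y + e11 w)%R * (e12 (y + w) = e12 y + e12 w)%R) *
   ((e21 (y + w) = e21 y + e21 w)%R * (e22 (y + w) = e22 y + e22 w)%R))%type.
Proof. by rewrite /e11 /e12 /e21 /e22 !mxE; do !split; ring. Qed.

Lemma entriesZ a y :
  (((e11 (a *: y) = a * e11 y)%R * (e12 (a *: y) = a * e12 y)%R) *
   ((e21 (a *: y) = a * e21 y)%R * (e22 (a *: y) = a * e22 y)%R))%type.
Proof. by rewrite /e11 /e12 /e21 /e22 !mxE; do !split; ring. Qed.

Lemma entriesN y :
  (((e11 (- y) = - e11 y)%R * (e12 (- y) = - e12 y)%R) *
   ((e21 (- y) = - e21 y)%R * (e22 (- y) = - e22 y)%R))%type.
Proof. by rewrite /e11 /e12 /e21 /e22 !mxE; do !split; ring. Qed.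

Definition entriesE := (entriesD, entriesZ, entriesN, entries_of).

Lemma ads_entries y w : ads y w =
  - 2^-1 * (e11 y * e22 w + e22 y * e11 w - e12 y * e21 w - e21 y * e12 w).
Proof. by rewrite adsE /e11 /e12 /e21 /e22; field. Qed.

(* entries of [adj y * w] (index l) and of [w * adj y] (index r) *)
Definition la y w := e22 y * e11 w - e12 y * e21 w.
Definition lb y w := e22 y * e12 w - e12 y * e22 w.
Definition lc y w := e11 y * e21 w - e21 y * e11 w.
Definition ld y w := e11 y * e22 w - e21 y * e12 w.
Definition ra y w := e11 w * e22 y - e12 w * e21 y.
Definition rb y w := e12 w * e11 y - e11 w * e12 y.
Definition rc y w := e21 w * e22 y - e22 w * e21 y.
Definition rd y w := e22 w * e11 y - e21 w * e12 y.

(* the unit time-like tangent bundle of AdS_3 *)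
Definition TAdS : set (vec * vec) :=
  [set q | [/\ ads q.1 q.1 = -1, ads q.2 q.2 = -1 & ads q.1 q.2 = 0]].

Lemma TAdS_entries y w : TAdS (y, w) <->
  [/\ e11 y * e22 y - e12 y * e21 y = 1, e11 w * e22 w - e12 w * e21 w = 1 &
      e11 y * e22 w + e22 y * e11 w - e12 y * e21 w - e21 y * e12 w = 0].
Proof.
rewrite /TAdS /= !ads_entries; split=> -[h1 h2 h3]; split.
- by apply: (lincomb1 (k := -1) h1); field.
- by apply: (lincomb1 (k := -1) h2); field.
- by apply: (lincomb1 (k := -2) h3); field.
- by apply: (lincomb1 (k := -1) h1); field.
- by apply: (lincomb1 (k := -1) h2); field.
- by apply: (lincomb1 (k := -2^-1) h3); field.
Qed.

Definition rot (t : R) (q : vec * vec) : vec * vec :=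
  (cos t *: q.1 + sin t *: q.2, - sin t *: q.1 + cos t *: q.2).

Lemma rot0 (q : vec * vec) : rot 0 q = q.
Proof. by case: q => y w; rewrite /rot cos0 sin0 oppr0 !scale1r !scale0r addr0 add0r. Qed.

Lemma rotD s t (q : vec * vec) : rot s (rot t q) = rot (s + t) q.
Proof.
by congr pair; apply/rowP => i; rewrite !mxE cosD sinD /=; ring.
Qed.

Lemma TAdS_rot t (q : vec * vec) : TAdS q -> TAdS (rot t q).
Proof.
case: q => y w [/= h1 h2 h3]; have c2 := cos2Dsin2 t.
rewrite /TAdS /rot /= !(adsDl, adsDr, adsZl, adsZr) (adsC w y) h1 h2 h3; split.
- by apply: (lincomb1 (k := -1) c2); ring.
- by apply: (lincomb1 (k := -1) c2); ring.
- by ring.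
Qed.

(** The trace of [adj y * w] is [-2 * ads y w], which vanishes on [TAdS]. *)
Lemma la_ld y w : TAdS (y, w) -> ld y w = - la y w.
Proof.
by move=> /TAdS_entries[_ _ h3]; apply: (lincomb1 (k := 1) h3); rewrite /la /ld; ring.
Qed.

(** For a matrix of trace zero the determinant is [- (a^2 + b c)], and here it is the product of the
    determinants of [y] and [w]. Such a matrix squares to minus the identity, so it is elliptic. *)
Lemma l_det y w : TAdS (y, w) -> la y w ^+ 2 + lb y w * lc y w = -1.
Proof.
move=> /TAdS_entries[h1 h2 h3].
have -> : la y w ^+ 2 + lb y w * lc y w = la y w *
    (e11 y * e22 w + e22 y * e11 w - e12 y * e21 w - e21 y * e12 w)
  - (e11 y * e22 y - e12 y * e21 y) * (e11 w * e22 w - e12 w * e21 w).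
  by rewrite /la /lb /lc; ring.
by rewrite h1 h2 h3; ring.
Qed.

Lemma r_det y w : TAdS (y, w) -> ra y w ^+ 2 + rb y w * rc y w = -1.
Proof.
move=> /TAdS_entries[h1 h2 h3].
have -> : ra y w ^+ 2 + rb y w * rc y w = ra y w *
    (e11 y * e22 w + e22 y * e11 w - e12 y * e21 w - e21 y * e12 w)
  - (e11 y * e22 y - e12 y * e21 y) * (e11 w * e22 w - e12 w * e21 w).
  by rewrite /ra /rb /rc; ring.
by rewrite h1 h2 h3; ring.
Qed.

(* [w = y * (adj y * w)] *)
Lemma w_entries y w : TAdS (y, w) ->
  [/\ e11 w = e11 y * la y w + e12 y * lc y w,
      e12 w = e11 y * lb y w - e12 y * la y w,
      e21 w = e21 y * la y w + e22 y * lc y w &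
      e22 w = e21 y * lb y w - e22 y * la y w].
Proof.
move=> Q; have ld_ := la_ld Q; case/TAdS_entries: Q => h1 _ h3.
split.
- by apply: (lincomb1 (k := - e11 w) h1); rewrite /la /lc; ring.
- by apply: (lincomb2 (k := - e12 w) (l := e12 y) h1 ld_); rewrite /la /lb /ld; ring.
- by apply: (lincomb1 (k := - e21 w) h1); rewrite /la /lc; ring.
- by apply: (lincomb2 (k := - e22 w) (l := e22 y) h1 ld_); rewrite /la /lb /ld; ring.
Qed.

Lemma rc_lc y w : TAdS (y, w) ->
  rc y w * lc y w = (e22 y * lc y w + e21 y * la y w) ^+ 2 + e21 y ^+ 2.
Proof.
move=> Q; have d := l_det Q; have [_ _ h3 h4] := w_entries Q.
rewrite {1}/rc h3 h4; apply: (lincomb1 (k := - e21 y ^+ 2) d); ring.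
Qed.

(** [w * adj y] is the conjugate of [adj y * w] by [y] in SL_2(R), so both fixed points lie in the
    same half-plane. The sum of squares in [rc_lc] makes this explicit, and [0 < lc] becomes the
    single sign condition for both factors. *)
Lemma rc_gt0 y w : TAdS (y, w) -> 0 < lc y w -> 0 < rc y w.
Proof.
move=> Q l0; have E := rc_lc Q.
rewrite -(pmulr_lgt0 _ l0) E lt_def; apply/andP; split; last first.
  by rewrite addr_ge0// sqr_ge0.
rewrite paddr_eq0 ?sqr_ge0// !sqrf_eq0; apply/negP => /andP[/eqP h /eqP h'].
case/TAdS_entries: Q => h1 _ _; move: h; rewrite h' mul0r addr0 => /eqP.
rewrite mulf_eq0 (gt_eqF l0) orbF => /eqP h.
by move: h1; rewrite h h' !mulr0 subr0 => /eqP; rewrite eq_sym oner_eq0.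
Qed.

Definition row2 (a b : R) : 'rV[R]_2 := \row_(k < 2) (if k == 0 then a else b).

Lemma row2E a b : row2 a b 0 0 = a /\ row2 a b 0 1 = b.
Proof. by rewrite !mxE. Qed.

Lemma row2K (z : 'rV[R]_2) : row2 (z 0 0) (z 0 1) = z.
Proof.
apply/rowP => i; rewrite mxE; have [->//|] := eqVneq i 0.
by case: i => -[|[|]]//= ? _; congr (z _ _); apply: val_inj.
Qed.

(* [adj y * w] and [w * adj y] are elliptic elements of SL_2; their fixed
   points in the upper half-plane are [(a + i) / c], with [a], [c] their
   entries of indices 11 and 21. *)
Definition Phi (q : vec * vec) : R4 R :=
  (row2 (la q.1 q.2 / lc q.1 q.2) (lc q.1 q.2)^-1,
   row2 (ra q.1 q.2 / rc q.1 q.2) (rc q.1 q.2)^-1).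

(** Every entry of [adj y * w] and of [w * adj y] is a bilinear function [f] of [y] and [w].
    Determinant one gives [f w w = f y y] and orthogonality gives [f w y = - f y w], so [f] itself
    is unchanged by the rotation. *)
Lemma Phi_rot t (q : vec * vec) : TAdS q -> Phi (rot t q) = Phi q.
Proof.
case: q => y w Q; have c2 := cos2Dsin2 t.
have tr_l := la_ld Q.
have [h1 h2 h3] := (TAdS_entries y w).1 Q.
have key (f : vec -> vec -> R) a b :
    (forall x z v, f (a *: x + b *: z) v = a * f x v + b * f z v) -> True by [].
have E f : (f = la \/ f = lc \/ f = ra \/ f = rc) ->
    f (cos t *: y + sin t *: w) (- sin t *: y + cos t *: w) = f y w.
  move=> fE.
  have -> : f (cos t *: y + sin t *: w) (- sin t *: y + cos t *: w) =
     cos t ^+ 2 * f y w - sin t ^+ 2 * f w y + cos t * sin t * (f w w - f y y).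
    case: fE => [->|[->|[->|->]]];
    by rewrite /la /lc /ra /rc /e11 /e12 /e21 /e22 !mxE; ring.
  have -> : f w w = f y y.
    case: fE => [->|[->|[->|->]]]; rewrite /la /lc /ra /rc; try ring.
    - by apply: (lincomb2 (k := 1) (l := -1) h2 h1); ring.
    - by apply: (lincomb2 (k := 1) (l := -1) h2 h1); ring.
  have -> : f w y = - f y w.
    case: fE => [->|[->|[->|->]]]; rewrite /la /lc /ra /rc; try ring.
    - by apply: (lincomb1 (k := 1) h3); ring.
    - by apply: (lincomb1 (k := 1) h3); ring.
  by apply: (lincomb1 (k := f y w) c2); ring.
by rewrite /Phi /= !E; auto.
Qed.

Definition sect_base (k1 k2 : R) (z : R4 R) : vec :=
  let X := z.1 0 0 in let u := Num.sqrt (z.1 0 1) in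
  let X' := z.2 0 0 in let u' := Num.sqrt (z.2 0 1) in
  of_entries ((u' * k1 + X' * k2 / u') / u)
    ((- u' * k2 + X' * k1 / u') * u - (u' * k1 + X' * k2 / u') * X / u)
    (k2 / (u' * u)) (k1 * u / u' - k2 * X / (u' * u)).

(* The element of [TAdS] over [z = (z1, z2)] given by [n2 k n1^-1] and
   [n2 k J n1^-1], where [ni] is the upper triangular matrix of SL_2 mapping
   the point [i] to [zi], [k] is the rotation matrix [[k1, -k2], [k2, k1]] and
   [J = [[0, -1], [1, 0]]]. *)
Definition sect (k : R * R) (z : R4 R) : vec * vec :=
  (sect_base k.1 k.2 z, sect_base (- k.2) k.1 z).

(** The rotation [k] with [sect k (Phi q) = q], solved for from the second row of n2 k n1^-1. *)
Definition angle (q : vec * vec) : R * R :=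
  let u := Num.sqrt (lc q.1 q.2)^-1 in
  let u' := Num.sqrt (rc q.1 q.2)^-1 in
  (u' / u * (e21 q.1 * (la q.1 q.2 / lc q.1 q.2) + e22 q.1), u * u' * e21 q.1).

Lemma angle_unit (q : vec * vec) : TAdS q -> 0 < lc q.1 q.2 ->
  (angle q).1 ^+ 2 + (angle q).2 ^+ 2 = 1.
Proof.
case: q => y w /= Q l0; have r0 := rc_gt0 Q l0; have E := rc_lc Q.
rewrite /angle /=; set c := lc y w in l0 E *; set c' := rc y w in r0 E *.
have u0 : 0 < Num.sqrt c^-1 by rewrite sqrtr_gt0 invr_gt0.
have v0 : 0 < Num.sqrt c'^-1 by rewrite sqrtr_gt0 invr_gt0.
have u2 : Num.sqrt c^-1 ^+ 2 = c^-1 by rewrite sqr_sqrtr// invr_ge0 ltW.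
have v2 : Num.sqrt c'^-1 ^+ 2 = c'^-1 by rewrite sqr_sqrtr// invr_ge0 ltW.
rewrite !exprMn exprVn u2 v2 invrK.
(* With the denominators cleared, the claim is [rc_lc]. *)
apply: (@mulfI _ (c' * c)); first by rewrite mulf_neq0// gt_eqF.
rewrite mulr1 [in RHS]E; field.
by rewrite !gt_eqF.
Qed.

Lemma sect_angle (q : vec * vec) : TAdS q -> 0 < lc q.1 q.2 -> sect (angle q) (Phi q) = q.
Proof.
case: q => y w /= Q l0; have r0 := rc_gt0 Q l0.
have d := l_det Q.
have [W1 W2 W3 W4] := w_entries Q.
have [h1 _ h3] := (TAdS_entries y w).1 Q.
have pE : e11 y * rc y w = e21 w + ra y w * e21 y.
  apply: (lincomb2 (k := - e21 y) (l := e21 w) h3 h1).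
  by rewrite /rc /ra; ring.
have qE : e12 y * rc y w = e22 w + ra y w * e22 y.
  apply: (lincomb2 (k := - e22 y) (l := e22 w) h3 h1).
  by rewrite /rc /ra; ring.
rewrite /sect /sect_base /angle /Phi /=.
have [-> ->] := row2E (la y w / lc y w) (lc y w)^-1.
have [-> ->] := row2E (ra y w / rc y w) (rc y w)^-1.
set a := la y w in W1 W2 W3 W4 d pE qE *; set b := lb y w in W1 W2 W3 W4 d pE qE *.
set c := lc y w in l0 W1 W2 W3 W4 d pE qE *.
set a' := ra y w in pE qE *; set c' := rc y w in r0 pE qE *.
have u0 : 0 < Num.sqrt c^-1 by rewrite sqrtr_gt0 invr_gt0.
have v0 : 0 < Num.sqrt c'^-1 by rewrite sqrtr_gt0 invr_gt0.
have u2 : Num.sqrt c^-1 ^+ 2 = c^-1 by rewrite sqr_sqrtr// invr_ge0 ltW.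
have v2 : Num.sqrt c'^-1 ^+ 2 = c'^-1 by rewrite sqr_sqrtr// invr_ge0 ltW.
set u := Num.sqrt c^-1 in u0 u2 *; set v := Num.sqrt c'^-1 in v0 v2 *.
(* Writing [c] and [c'] through the square roots [u] and [v] leaves rational identities in [u] and
   [v]. *)
have cE : c = u ^- 2 by rewrite u2 invrK.
have c'E : c' = v ^- 2 by rewrite v2 invrK.
have nu : u != 0 by rewrite gt_eqF.
have nv : v != 0 by rewrite gt_eqF.
rewrite W3 in pE; rewrite W4 in qE.
rewrite {}cE {}c'E in d pE qE W1 W2 W3 W4 *.
congr pair; apply: entries_inj; rewrite !entries_of ?(W1, W2, W3, W4).
- by apply: (lincomb1 (k := - v ^+ 2) pE); field; rewrite nu nv.
- apply: (lincomb2 (k := - (u ^+ 2 * v ^+ 2 * e21 y)) (l := - v ^+ 2) d qE).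
  by field; rewrite nu nv.
- by field; rewrite nu nv.
- by field; rewrite nu nv.
- apply: (lincomb3 (k := - v ^+ 2 * a) (l := - v ^+ 2 * u ^- 2)
    (m := - v ^+ 2 * e21 y) pE qE d).
  by field; rewrite nu nv.
- apply: (lincomb3 (k := u ^+ 2 * v ^+ 2 + a ^+ 2 * u ^+ 2 * v ^+ 2)
    (l := a * v ^+ 2) (m := a * u ^+ 2 * v ^+ 2 * e21 y - e11 y * u ^+ 2) pE qE d).
  by field; rewrite nu nv.
- by field; rewrite nu nv.
- apply: (lincomb1 (k := - u ^+ 2 * e21 y) d).
  by field; rewrite nu nv.
Qed.

Lemma sectP k (z : R4 R) : k.1 ^+ 2 + k.2 ^+ 2 = 1 -> H2 z.1 -> H2 z.2 ->
  [/\ TAdS (sect k z), 0 < lc (sect k z).1 (sect k z).2 & Phi (sect k z) = z].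
Proof.
case: k z => k1 k2 [z z'] /= k12; rewrite /H2 /= => z0 z'0.
have u0 : 0 < Num.sqrt (z 0 1) by rewrite sqrtr_gt0.
have v0 : 0 < Num.sqrt (z' 0 1) by rewrite sqrtr_gt0.
have u2 : Num.sqrt (z 0 1) ^+ 2 = z 0 1 by rewrite sqr_sqrtr// ltW.
have v2 : Num.sqrt (z' 0 1) ^+ 2 = z' 0 1 by rewrite sqr_sqrtr// ltW.
rewrite /sect /sect_base /=.
move: u0 v0 u2 v2; set u := Num.sqrt (z 0 1); set v := Num.sqrt (z' 0 1).
move=> u0 v0 u2 v2.
have nu : u != 0 by rewrite gt_eqF.
have nv : v != 0 by rewrite gt_eqF.
set y := of_entries _ _ _ _; set w := of_entries _ _ _ _.
have lcE : lc y w = u ^- 2.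
  rewrite /lc /y /w !entries_of; apply: (lincomb1 (k := u ^- 2) k12).
  by field; rewrite nu nv.
have laE : la y w = z 0 0 * u ^- 2.
  rewrite /la /y /w !entries_of; apply: (lincomb1 (k := z 0 0 * u ^- 2) k12).
  by field; rewrite nu nv.
have rcE : rc y w = v ^- 2.
  rewrite /rc /y /w !entries_of; apply: (lincomb1 (k := v ^- 2) k12).
  by field; rewrite nu nv.
have raE : ra y w = z' 0 0 * v ^- 2.
  rewrite /ra /y /w !entries_of; apply: (lincomb1 (k := z' 0 0 * v ^- 2) k12).
  by field; rewrite nu nv.
split.
- apply/TAdS_entries; rewrite /y /w !entries_of; split.
  + by apply: (lincomb1 (k := 1) k12); field; rewrite nu nv.
  + by apply: (lincomb1 (k := 1) k12); field; rewrite nu nv.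
  + by field; rewrite nu nv.
- by rewrite lcE invr_gt0 exprn_gt0.
- rewrite /Phi /= lcE laE rcE raE !invrK u2 v2 !mulfVK ?gt_eqF//.
  by rewrite !row2K.
Qed.

(** Rotation matrices commute with J, so replacing [k] by [k' = k (al + be J)] in n2 k n1^-1 and n2
    k J n1^-1 mixes these two matrices by the rotation of cosine [al] and sine [be]. *)
Lemma sect_rot (k k' : R * R) (z : R4 R) : k.1 ^+ 2 + k.2 ^+ 2 = 1 ->
  let al := k.1 * k'.1 + k.2 * k'.2 in let be := k.1 * k'.2 - k.2 * k'.1 in
  sect k' z = (al *: (sect k z).1 + be *: (sect k z).2,
               - be *: (sect k z).1 + al *: (sect k z).2).
Proof.
case: k k' => k1 k2 [k1' k2'] /= ku.
set al := k1 * k1' + k2 * k2'; set be := k1 * k2' - k2 * k1'.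
have k1E : k1' = al * k1 - be * k2.
  by apply: (lincomb1 (k := - k1') ku); rewrite /al /be; ring.
have k2E : k2' = al * k2 + be * k1.
  by apply: (lincomb1 (k := - k2') ku); rewrite /al /be; ring.
rewrite /sect /= k1E k2E; clearbody al be.
by congr pair; apply: entries_inj;
  rewrite !entriesE; ring.
Qed.

(** By [sect_rot], [q'] is a rotation of [q]. Pairing [q'.1] with the orthogonal vectors [q.1] and
    [q.2] recovers the cosine and the sine as continuous functions of [q] and [q'], which is what
    makes the angle small for nearby vectors in [near_same_Phi]. *)
Lemma same_Phi (q q' : vec * vec) : TAdS q -> TAdS q' -> 0 < lc q.1 q.2 -> 0 < lc q'.1 q'.2 ->
  Phi q = Phi q' ->
  let C := - ads q.1 q'.1 in let S := - ads q.2 q'.1 in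
  C ^+ 2 + S ^+ 2 = 1 /\ q' = (C *: q.1 + S *: q.2, - S *: q.1 + C *: q.2).
Proof.
move=> Q Q' l0 l0' E C S.
have [al [be q'E]] : exists al be : R,
    q' = (al *: q.1 + be *: q.2, - be *: q.1 + al *: q.2).
  have := @sect_rot (angle q) (angle q') (Phi q) (angle_unit Q l0).
  rewrite (sect_angle Q l0) E (sect_angle Q' l0') => ->.
  by eexists; eexists.
have [q1 q2 q12] := Q.
have CE : C = al by rewrite /C q'E /= adsDr !adsZr q1 q12; ring.
have SE : S = be by rewrite /S q'E /= adsDr !adsZr q2 adsC q12; ring.
split; last by rewrite CE SE.
have [q1' _ _] := Q'; move: q1'; rewrite {1 2}q'E /= !(adsDl, adsDr, adsZl, adsZr).
rewrite q1 q2 (adsC q.2) q12 CE SE => h.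
by apply: (lincomb1 (k := -1) h); ring.
Qed.

(* The ambient cross product: [cross4 x z w] is normal to [x], [z] and [w]. *)
Definition cross4 x z w : vec :=
  of_entries (e11 x * la w z + e12 x * lc w z) (e11 x * lb w z + e12 x * ld w z)
             (e21 x * la w z + e22 x * lc w z) (e21 x * lb w z + e22 x * ld w z)
  + ads x w *: z - ads x z *: w + ads w z *: x.

(** Trace-zero matrices of determinant one form the hyperboloid model of H^2, with minus the
    determinant as quadratic form; the fixed point [(a + i) / c] carries it isometrically to the
    half-plane. The third hypothesis is the differential of the second. *)
Lemma hyp_elliptic a b c a' b' c' : c != 0 -> a ^+ 2 + b * c = -1 ->
  2 * a * a' + b' * c + b * c' = 0 ->
  hyp (row2 (a / c) c^-1) (row2 ((a' * c - a * c') / c ^+ 2) (- c' / c ^+ 2))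
  = a' ^+ 2 + b' * c'.
Proof.
move=> c0 h h'; rewrite /hyp; have [-> ->] := row2E ((a' * c - a * c') / c ^+ 2) (- c' / c ^+ 2).
have [_ ->] := row2E (a / c) c^-1.
apply: (lincomb2 (k := c' ^+ 2 / c ^+ 2) (l := - c' / c) h h').
by field.
Qed.

End Model.

(** * Explicit determinants of size at most four *)

Lemma det_nat2 (R : comNzRingType) (f : nat -> nat -> R) :
  \det (\matrix_(i < 2, j < 2) f i j) =
    f 0%N 0%N * f 1%N 1%N - f 0%N 1%N * f 1%N 0%N.
Proof.
rewrite (expand_det_row _ ord0) !big_ord_recl big_ord0 /cofactor !det_mx11 !mxE /=.
by rewrite /bump /=; ring.
Qed.

(** Entries indexed by natural numbers make each minor again of this form, with columns computed by
    [bump], so the smaller case applies to it. *)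
Lemma det_nat3 (R : comNzRingType) (f : nat -> nat -> R) :
  \det (\matrix_(i < 3, j < 3) f i j) =
    f 0%N 0%N * (f 1%N 1%N * f 2%N 2%N - f 1%N 2%N * f 2%N 1%N)
  - f 0%N 1%N * (f 1%N 0%N * f 2%N 2%N - f 1%N 2%N * f 2%N 0%N)
  + f 0%N 2%N * (f 1%N 0%N * f 2%N 1%N - f 1%N 1%N * f 2%N 0%N).
Proof.
have minor (j0 : 'I_3) : \det (row' ord0 (col' j0 (\matrix_(i < 3, j < 3) f i j))) =
   f 1%N (bump j0 0) * f 2%N (bump j0 1) - f 1%N (bump j0 1) * f 2%N (bump j0 0).
  transitivity (\det (\matrix_(i < 2, j < 2) f i.+1 (bump j0 j))).
    by congr (\det _); apply/matrixP => i j; rewrite !mxE.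
  by rewrite (det_nat2 (fun i j => f i.+1 (bump j0 j))).
rewrite (expand_det_row _ ord0) !big_ord_recl big_ord0 /cofactor !minor !mxE /=.
by rewrite /bump /=; ring.
Qed.

Lemma det_nat4 (R : comNzRingType) (f : nat -> nat -> R) :
  let m i j k := f 1%N i * (f 2%N j * f 3%N k - f 2%N k * f 3%N j)
  - f 1%N j * (f 2%N i * f 3%N k - f 2%N k * f 3%N i)
  + f 1%N k * (f 2%N i * f 3%N j - f 2%N j * f 3%N i) in
  \det (\matrix_(i < 4, j < 4) f i j) =
    f 0%N 0%N * m 1%N 2%N 3%N - f 0%N 1%N * m 0%N 2%N 3%N
  + f 0%N 2%N * m 0%N 1%N 3%N - f 0%N 3%N * m 0%N 1%N 2%N.
Proof.
move=> m.
have minor (j0 : 'I_4) : \det (row' ord0 (col' j0 (\matrix_(i < 4, j < 4) f i j))) =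
   m (bump j0 0) (bump j0 1) (bump j0 2).
  transitivity (\det (\matrix_(i < 3, j < 3) f i.+1 (bump j0 j))).
    by congr (\det _); apply/matrixP => i j; rewrite !mxE.
  by rewrite (det_nat3 (fun i j => f i.+1 (bump j0 j))).
rewrite (expand_det_row _ ord0) !big_ord_recl big_ord0 /cofactor !minor !mxE /=.
by rewrite /bump /= /m; ring.
Qed.

(** * Differential calculus in the model: pull-back metrics and the flow *)

Section ModelDerivatives.
Variable R : realType.
Local Notation vec := 'rV[R]_4.
Implicit Types (x y z w : vec) (a b c : R).

Lemma cross4C x z w : cross4 z x w = - cross4 x z w.
Proof.
by apply: entries_inj; rewrite /cross4 !entriesE !ads_entries /la /lb /lc /ld; field.
Qed.

(* Multilinearity and antisymmetry identify [ads (cross4 x z w) v] with the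
   determinant of [x, z, w, v]. *)
Lemma cross4_det x z w v :
  ads (cross4 x z w) v = \det (\matrix_(i < 4, j < 4) (nth 0 [:: x; z; w; v] i) 0 j).
Proof.
have -> : \matrix_(i < 4, j < 4) (nth 0 [:: x; z; w; v] i) 0 j =
    \matrix_(i < 4, j < 4) (nth 0 [:: x; z; w; v] i) 0 (inord j).
  by apply/matrixP => i j; rewrite !mxE inord_val.
rewrite (det_nat4 (fun i j => (nth 0 [:: x; z; w; v] i) 0 (inord j))) /=.
have -> : inord 0 = i0 by apply: val_inj; rewrite /= inordK.
have -> : inord 1 = i1 by apply: val_inj; rewrite /= inordK.
have -> : inord 2 = i2 by apply: val_inj; rewrite /= inordK.
have -> : inord 3 = i3 by apply: val_inj; rewrite /= inordK.
rewrite /cross4 !(adsDl, adsZl, adsNl) ads_entries !entries_of !adsE.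
by rewrite /la /lb /lc /ld /e11 /e12 /e21 /e22; field.
Qed.

(** Along a curve in AdS_3 the covariant derivative is the projection [dw + ads dw y *: y] of the
    ambient derivative orthogonally to [y]. The sign [e = 1] gives D^l, and [e = -1] gives D^r. *)
Definition Pvec (e : R) y w dy dw : vec := dw + ads dw y *: y + e *: cross4 y w dy.

(** [Pvec 1] is [y] times the derivative of [adj y * w], and [Pvec (-1)] is the derivative of
    [w * adj y] times [y]. As [y] has determinant one, what remains is minus the determinant of a
    derivative whose trace is zero by the last hypothesis. *)
Lemma Pvec_norm y w dy dw : TAdS (y, w) ->
  ads y dy = 0 -> ads dy w + ads y dw = 0 ->
  ads (Pvec 1 y w dy dw) (Pvec 1 y w dy dw) =
    (la dy w + la y dw) ^+ 2 + (lb dy w + lb y dw) * (lc dy w + lc y dw) /\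
  ads (Pvec (-1) y w dy dw) (Pvec (-1) y w dy dw) =
    (ra dy w + ra y dw) ^+ 2 + (rb dy w + rb y dw) * (rc dy w + rc y dw).
Proof.
move=> Q t1 t3.
have [/= _ _ q12] := Q; have [d _ _] := (TAdS_entries y w).1 Q.
have PE : Pvec 1 y w dy dw = dw + of_entries
    (e11 y * la dy w + e12 y * lc dy w) (e11 y * lb dy w + e12 y * ld dy w)
    (e21 y * la dy w + e22 y * lc dy w) (e21 y * lb dy w + e22 y * ld dy w).
  rewrite /Pvec /cross4 t1 q12 !scale0r subr0 addr0 scale1r (adsC dw y).
  have -> : ads y dw = - ads dy w by apply/eqP; rewrite -addr_eq0 addrC t3.
  by rewrite scaleNr addrA addrAC subrK.
have P'E : Pvec (-1) y w dy dw = dw + of_entries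
    (e11 w * la dy y + e12 w * lc dy y) (e11 w * lb dy y + e12 w * ld dy y)
    (e21 w * la dy y + e22 w * lc dy y) (e21 w * lb dy y + e22 w * ld dy y).
  rewrite /Pvec scaleN1r -cross4C /cross4 (adsC w y) q12 (adsC dy y) t1 !scale0r.
  rewrite subr0 addr0 (adsC w dy) (adsC dw y).
  have -> : ads y dw = - ads dy w by apply/eqP; rewrite -addr_eq0 addrC t3.
  by rewrite scaleNr addrA addrAC subrK.
have trl : ld dy w + ld y dw = - (la dy w + la y dw).
  move: t3; rewrite !ads_entries => t3.
  by apply: (lincomb1 (k := -2) t3); rewrite /la /ld; field.
have trr : rd dy w + rd y dw = - (ra dy w + ra y dw).
  move: t3; rewrite !ads_entries => t3.
  by apply: (lincomb1 (k := -2) t3); rewrite /ra /rd; field.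
split.
  rewrite PE ads_entries !entriesE.
  have -> : e11 dw = e11 y * la y dw + e12 y * lc y dw.
    by apply: (lincomb1 (k := - e11 dw) d); rewrite /la /lc; ring.
  have -> : e12 dw = e11 y * lb y dw + e12 y * ld y dw.
    by apply: (lincomb1 (k := - e12 dw) d); rewrite /lb /ld; ring.
  have -> : e21 dw = e21 y * la y dw + e22 y * lc y dw.
    by apply: (lincomb1 (k := - e21 dw) d); rewrite /la /lc; ring.
  have -> : e22 dw = e21 y * lb y dw + e22 y * ld y dw.
    by apply: (lincomb1 (k := - e22 dw) d); rewrite /lb /ld; ring.
  transitivity (- (e11 y * e22 y - e12 y * e21 y) *
    ((la dy w + la y dw) * (ld dy w + ld y dw) - (lb dy w + lb y dw) * (lc dy w + lc y dw))).
    by field.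
  by rewrite d trl; ring.
rewrite P'E ads_entries !entriesE.
have -> : e11 dw = ra y dw * e11 y + rb y dw * e21 y.
  by apply: (lincomb1 (k := - e11 dw) d); rewrite /ra /rb; ring.
have -> : e12 dw = ra y dw * e12 y + rb y dw * e22 y.
  by apply: (lincomb1 (k := - e12 dw) d); rewrite /ra /rb; ring.
have -> : e21 dw = rc y dw * e11 y + rd y dw * e21 y.
  by apply: (lincomb1 (k := - e21 dw) d); rewrite /rc /rd; ring.
have -> : e22 dw = rc y dw * e12 y + rd y dw * e22 y.
  by apply: (lincomb1 (k := - e22 dw) d); rewrite /rc /rd; ring.
transitivity (- (e11 y * e22 y - e12 y * e21 y) *
  ((ra dy w + ra y dw) * (rd dy w + rd y dw) - (rb dy w + rb y dw) * (rc dy w + rc y dw))).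
  by rewrite /ra /rb /rc /rd /la /lb /lc /ld; field.
by rewrite d trr; ring.
Qed.

Lemma smooth_at_ads (V : normedModType R) (f g : V -> vec) (t : V) :
  smooth_at f t -> smooth_at g t -> smooth_at (fun u => ads (f u) (g u)) t.
Proof.
move=> sf sg.
have -> : (fun u => ads (f u) (g u)) = fun u => - (f u 0 i0 * g u 0 i0) - f u 0 i1 * g u 0 i1
    + f u 0 i2 * g u 0 i2 + f u 0 i3 * g u 0 i3 by apply/funext => u; rewrite adsE.
by repeat first [exact: sf | exact: sg | smooth_step].
Qed.

Lemma smooth_at_cross4 (V : normedModType R) (f g h : V -> vec) (t : V) :
  smooth_at f t -> smooth_at g t -> smooth_at h t ->
  smooth_at (fun u => cross4 (f u) (g u) (h u)) t.
Proof.
move=> sf sg sh; rewrite /cross4.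
apply: smooth_atD; last by apply: smooth_atZ => //; exact: smooth_at_ads.
apply: smooth_atB; last by apply: smooth_atZ => //; exact: smooth_at_ads.
apply: smooth_atD; last by apply: smooth_atZ => //; exact: smooth_at_ads.
rewrite /of_entries /la /lb /lc /ld /e11 /e12 /e21 /e22.
by apply: smooth_at_row => i; case: i => -[|[|[|[|]]]]//= _;
  repeat first [exact: sf | exact: sg | exact: sh | smooth_step].
Qed.

Lemma smooth_at_lr (q : vec * vec) :
  [/\ smooth_at (fun q : vec * vec => la q.1 q.2) q,
      smooth_at (fun q : vec * vec => lc q.1 q.2) q,
      smooth_at (fun q : vec * vec => ra q.1 q.2) q &
      smooth_at (fun q : vec * vec => rc q.1 q.2) q].
Proof.
by rewrite /la /lc /ra /rc /e11 /e12 /e21 /e22; split; repeat smooth_step.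
Qed.

Lemma smooth_at_row2 (V : normedModType R) (f g : V -> R) (x : V) :
  smooth_at f x -> smooth_at g x -> smooth_at (fun t => row2 (f t) (g t)) x.
Proof.
by move=> sf sg; apply: smooth_at_row => i; case: eqP.
Qed.

Lemma smooth_at_Phi (q : vec * vec) : lc q.1 q.2 != 0 -> rc q.1 q.2 != 0 ->
  smooth_at (@Phi R) q.
Proof.
move=> l0 r0; have [sla slc sra src] := smooth_at_lr q.
apply: smooth_at_pair; apply: smooth_at_row2; try exact: smooth_atV.
  by apply: smooth_atM => //; exact: smooth_atV.
by apply: smooth_atM => //; exact: smooth_atV.
Qed.

Lemma smooth_at_sect k (z : R4 R) : H2 z.1 -> H2 z.2 -> smooth_at (sect k) z.
Proof.
move=> z0 z'0; rewrite /H2 /= in z0 z'0.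
have su : smooth_at (fun z : R4 R => Num.sqrt (z.1 0 1)) z.
  apply: (@smooth_at_comp _ _ _ _ (fun z : R4 R => z.1 0 1) Num.sqrt).
    by repeat smooth_step.
  exact: smooth_at_sqrt.
have su' : smooth_at (fun z : R4 R => Num.sqrt (z.2 0 1)) z.
  apply: (@smooth_at_comp _ _ _ _ (fun z : R4 R => z.2 0 1) Num.sqrt).
    by repeat smooth_step.
  exact: smooth_at_sqrt.
have u0 : Num.sqrt (z.1 0 1) != 0 by rewrite gt_eqF// sqrtr_gt0.
have v0 : Num.sqrt (z.2 0 1) != 0 by rewrite gt_eqF// sqrtr_gt0.
have suv := @smooth_atV R _ (fun z : R4 R => Num.sqrt (z.1 0 1)) z u0 su.
have sv'v := @smooth_atV R _ (fun z : R4 R => Num.sqrt (z.2 0 1)) z v0 su'.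
have suv' : smooth_at (fun z : R4 R => (Num.sqrt (z.2 0 1) * Num.sqrt (z.1 0 1))^-1) z.
  by apply: smooth_atV; [rewrite mulf_neq0|exact: smooth_atM].
have sb k1 k2 : smooth_at (sect_base k1 k2) z.
  apply: smooth_at_row => i; case: i => -[|[|[|[|]]]]//= _;
  repeat first [exact: su | exact: su' | exact: suv | exact: suv' | exact: sv'v | smooth_step].
exact: smooth_at_pair.
Qed.

Let scaleRM (a b : R) : a *: (b : R) = a * b. Proof. by []. Qed.

Lemma is_derive_entries (U : normedModType R) (c : U -> vec) (t v : U) (d : vec) :
  is_derive t v c d ->
  [/\ is_derive t v (fun s => e11 (c s)) (e11 d), is_derive t v (fun s => e12 (c s)) (e12 d),
      is_derive t v (fun s => e21 (c s)) (e21 d) & is_derive t v (fun s => e22 (c s)) (e22 d)].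
Proof.
move=> cd; have H i := is_derive_coord 0 i cd; rewrite /e11 /e12 /e21 /e22.
split; [apply: is_deriveD|apply: is_deriveB|apply: is_deriveD|apply: is_deriveB];
 exact: H.
Qed.

Lemma is_derive_mulB (U : normedModType R) (f1 f2 g1 g2 : U -> R) (t v : U)
    (a1 a2 b1 b2 : R) :
  is_derive t v f1 a1 -> is_derive t v f2 a2 ->
  is_derive t v g1 b1 -> is_derive t v g2 b2 ->
  is_derive t v (fun s => f1 s * f2 s - g1 s * g2 s)
    (a1 * f2 t + f1 t * a2 - (b1 * g2 t + g1 t * b2)).
Proof.
move=> h1 h2 h3 h4.
apply: (@is_derive_eq _ _ _ (f1 * f2 - g1 * g2) _ _ _ _
  (is_deriveB (is_deriveM h1 h2) (is_deriveM h3 h4))).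
by rewrite !scaleRM; ring.
Qed.

Lemma is_derive_lr (c : R -> vec * vec) (t : R) dy dw : is_derive t 1 c (dy, dw) ->
  let y := (c t).1 in let w := (c t).2 in
  [/\ is_derive t 1 (fun s => la (c s).1 (c s).2) (la dy w + la y dw),
      is_derive t 1 (fun s => lc (c s).1 (c s).2) (lc dy w + lc y dw),
      is_derive t 1 (fun s => ra (c s).1 (c s).2) (ra dy w + ra y dw) &
      is_derive t 1 (fun s => rc (c s).1 (c s).2) (rc dy w + rc y dw)].
Proof.
move=> cd y w.
have [p q r s] := is_derive_entries (is_derive_fst cd).
have [P Q S T] := is_derive_entries (is_derive_snd cd).
split.
- by apply: is_derive_eq (is_derive_mulB s P q S) _; rewrite /la -/y -/w /=; ring.
- by apply: is_derive_eq (is_derive_mulB p S r P) _; rewrite /lc -/y -/w /=; ring.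
- by apply: is_derive_eq (is_derive_mulB P s Q r) _; rewrite /ra -/y -/w /=; ring.
- by apply: is_derive_eq (is_derive_mulB S s T r) _; rewrite /rc -/y -/w /=; ring.
Qed.

Lemma is_derive_ads (U : normedModType R) (c c' : U -> vec) (t v : U) (d d' : vec) :
  is_derive t v c d -> is_derive t v c' d' ->
  is_derive t v (fun s => ads (c s) (c' s)) (ads d (c' t) + ads (c t) d').
Proof.
move=> h h'.
have [p q r s] := is_derive_entries h.
have [P Q S T] := is_derive_entries h'.
have -> : (fun s => ads (c s) (c' s)) = (fun s => - 2^-1 *
   ((e11 (c s) * e22 (c' s) - e12 (c s) * e21 (c' s)) +
    (e22 (c s) * e11 (c' s) - e21 (c s) * e12 (c' s)))).
  by apply/funext => u; rewrite ads_entries; ring.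
have := is_deriveZ (- 2^-1) (is_deriveD (is_derive_mulB p T q S) (is_derive_mulB s P r Q)).
move=> H; apply: (is_derive_eq H).
by rewrite !ads_entries scaleRM; ring.
Qed.

Lemma is_derive_inv (g : R -> R) (t b : R) : g t != 0 ->
  is_derive t 1 g b -> is_derive t 1 (fun s => (g s)^-1) (- b / g t ^+ 2).
Proof.
move=> g0 hg; have gd : derivable g t 1 by case: hg.
split; first exact: derivableV.
by rewrite deriveV//; case: hg => _ ->; rewrite scaleRM; field.
Qed.

Lemma is_derive_div (f g : R -> R) (t a b : R) : g t != 0 ->
  is_derive t 1 f a -> is_derive t 1 g b ->
  is_derive t 1 (fun s => f s / g s) ((a * g t - f t * b) / g t ^+ 2).
Proof.
move=> g0 hf hg.
have hV := is_derive_inv g0 hg.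
apply: is_derive_eq (is_deriveM hf hV) _.
by rewrite !scaleRM; field.
Qed.

Lemma TAdS_tangent (c : R -> vec * vec) (t : R) dy dw : is_derive t 1 c (dy, dw) ->
  (\forall s \near t, TAdS (c s)) ->
  [/\ ads (c t).1 dy = 0, ads (c t).2 dw = 0 & ads dy (c t).2 + ads (c t).1 dw = 0].
Proof.
move=> cd Q.
have key (f f' : R -> vec) (d d' : vec) (k : R) : is_derive t 1 f d ->
    is_derive t 1 f' d' -> (\forall s \near t, ads (f s) (f' s) = k) ->
    ads d (f' t) + ads (f t) d' = 0.
  move=> h h' E; have [_ <-] := is_derive_ads h h'.
  by rewrite (near_eq_derive (g := cst k) _ E) derive_cst.
have d1 := is_derive_fst cd; have d2 := is_derive_snd cd.
have half (a : R) : a + a = 0 -> a = 0 by move=> h; lra.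
split.
- apply: half; rewrite -{1}(adsC dy); apply: (key _ _ _ _ (-1) d1 d1).
  by apply: filterS Q => s [].
- apply: half; rewrite -{1}(adsC dw); apply: (key _ _ _ _ (-1) d2 d2).
  by apply: filterS Q => s [].
- apply: (key _ _ _ _ 0 d1 d2).
  by apply: filterS Q => s [].
Qed.

(** [hyp_elliptic] gives the squared speed of each fixed point as minus the determinant of the
    velocity of the corresponding elliptic element, and [Pvec_norm] identifies this with the norm of
    [Pvec]. *)
Lemma hyp_Phi (c : R -> vec * vec) (t : R) dy dw : is_derive t 1 c (dy, dw) ->
  (\forall s \near t, TAdS (c s)) -> 0 < lc (c t).1 (c t).2 ->
  let y := (c t).1 in let w := (c t).2 in
  let d := 'D_1 (fun s => Phi (c s)) t in
  hyp (Phi (c t)).1 d.1 = ads (Pvec 1 y w dy dw) (Pvec 1 y w dy dw) /\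
  hyp (Phi (c t)).2 d.2 = ads (Pvec (-1) y w dy dw) (Pvec (-1) y w dy dw).
Proof.
move=> cd Qn l0 y w d.
have Q : TAdS (y, w) by have := nbhs_singleton Qn; rewrite -surjective_pairing.
have [t1 t2 t3] := TAdS_tangent cd Qn; rewrite -/y -/w in t1 t2 t3.
have r0 := rc_gt0 Q l0.
have nl : lc y w != 0 by rewrite gt_eqF.
have nr : rc y w != 0 by rewrite gt_eqF.
have dP : is_derive t 1 (fun s => Phi (c s)) d.
  split => //; apply: diff_derivable; apply: (@differentiable_comp _ _ _ _ c (@Phi R)).
    by apply/derivable1_diffP; case: cd.
  by apply: smooth_at_differentiable; exact: smooth_at_Phi.
have [dla dlc dra drc] := is_derive_lr cd.
have [n1 n2] := Pvec_norm Q t1 t3; rewrite n1 n2 {n1 n2}.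
have [_ _ q12] := Q; rewrite /= in q12.
split.
- have E0 : d.1 0 0 = ((la dy w + la y dw) * lc y w - la y w * (lc dy w + lc y dw))
      / lc y w ^+ 2.
    have [_ <-] := is_derive_coord 0 0 (is_derive_fst dP).
    have [_ <-] := is_derive_div (g := fun s => lc (c s).1 (c s).2) nl dla dlc.
    by congr ('D_1 _ t); apply/funext => s; rewrite mxE.
  have E1 : d.1 0 1 = - (lc dy w + lc y dw) / lc y w ^+ 2.
    have [_ <-] := is_derive_coord 0 1 (is_derive_fst dP).
    have [_ <-] := is_derive_inv (g := fun s => lc (c s).1 (c s).2) nl dlc.
    by congr ('D_1 _ t); apply/funext => s; rewrite mxE.
  rewrite -[d.1]row2K E0 E1; apply: hyp_elliptic => //; first exact: l_det.
  (* The derivative of [a^2 + b c] is a combination of [ads y w] and of the derivatives of the three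
     constraints defining [TAdS], all of which vanish. *)
  transitivity ((la dy w + la y dw) * (-2 * ads y w)
     - 2 * la y w * (ads dy w + ads y dw)
     - ((- 2 * ads y dy) * (- ads w w) + (- ads y y) * (- 2 * ads w dw))).
    by rewrite /la /lb /lc !ads_entries; field.
  by rewrite q12 t1 t2 t3; ring.
- have E0 : d.2 0 0 = ((ra dy w + ra y dw) * rc y w - ra y w * (rc dy w + rc y dw))
      / rc y w ^+ 2.
    have [_ <-] := is_derive_coord 0 0 (is_derive_snd dP).
    have [_ <-] := is_derive_div (g := fun s => rc (c s).1 (c s).2) nr dra drc.
    by congr ('D_1 _ t); apply/funext => s; rewrite mxE.
  have E1 : d.2 0 1 = - (rc dy w + rc y dw) / rc y w ^+ 2.
    have [_ <-] := is_derive_coord 0 1 (is_derive_snd dP).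
    have [_ <-] := is_derive_inv (g := fun s => rc (c s).1 (c s).2) nr drc.
    by congr ('D_1 _ t); apply/funext => s; rewrite mxE.
  rewrite -[d.2]row2K E0 E1; apply: hyp_elliptic => //; first exact: r_det.
  transitivity ((ra dy w + ra y dw) * (-2 * ads y w)
     - 2 * ra y w * (ads dy w + ads y dw)
     - ((- 2 * ads y dy) * (- ads w w) + (- ads y y) * (- 2 * ads w dw))).
    by rewrite /ra /rb /rc !ads_entries; field.
  by rewrite q12 t1 t2 t3; ring.
Qed.

Lemma is_derive_rot (t : R) (q : vec * vec) :
  is_derive t 1 (fun s => rot s q) ((rot t q).2, - (rot t q).1).
Proof.
have c1 := is_derive_scale (is_derive_cos t) (is_derive_cst q.1 t 1).
have s2 := is_derive_scale (is_derive_sin t) (is_derive_cst q.2 t 1).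
have s1 := is_derive_scale (is_deriveN (is_derive_sin t)) (is_derive_cst q.1 t 1).
have c2 := is_derive_scale (is_derive_cos t) (is_derive_cst q.2 t 1).
have h1 := is_deriveD c1 s2; have h2 := is_deriveD s1 c2.
apply: is_derive_eq (is_derive_pair h1 h2) _.
by congr pair; apply/rowP => k; rewrite !mxE /=; ring.
Qed.

(** Uniqueness for the linear equation y' = w, w' = -y: turning a solution back by the angle [s - t]
    makes its derivative zero. *)
Lemma rot_flow (c : R -> vec * vec) (t e : R) : 0 < e ->
  (forall s, `|s - t| < e -> is_derive s 1 c ((c s).2, - (c s).1)) ->
  forall s, `|s - t| < e -> c s = rot (s - t) (c t).
Proof.
move=> e0 dc s se.
suff E : rot (- (s - t)) (c s) = c t by rewrite -E rotD subrr rot0.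
have dsub (r : R) : is_derive r 1 (fun r : R => - (r - t)) (-1).
  by apply: is_derive_eq; rewrite subr0.
have dcos (r : R) : is_derive r 1 (fun r : R => cos (- (r - t))) (sin (- (r - t))).
  have := @is_derive1_comp R cos (fun r => - (r - t)) r _ _ (is_derive_cos _) (dsub r).
  by rewrite mulrN1 opprK.
have dsin (r : R) : is_derive r 1 (fun r : R => sin (- (r - t))) (- cos (- (r - t))).
  have := @is_derive1_comp R sin (fun r => - (r - t)) r _ _ (is_derive_sin _) (dsub r).
  by rewrite mulrN1.
have H r : `|r - t| < e -> is_derive r 1 (fun r => rot (- (r - t)) (c r)) 0.
  move=> re; have d1 := is_derive_fst (dc r re); have d2 := is_derive_snd (dc r re).
  have h1 := is_deriveD (is_derive_scale (dcos r) d1) (is_derive_scale (dsin r) d2).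
  have h2 := is_deriveD (is_derive_scale (is_deriveN (dsin r)) d1) (is_derive_scale (dcos r) d2).
  apply: is_derive_eq (is_derive_pair h1 h2) _.
  by congr pair; apply/rowP => k; rewrite !mxE /= ?fctE; ring.
have t0 : `|t - t| < e by rewrite subrr normr0.
have E0 : rot (- (t - t)) (c t) = c t by rewrite subrr oppr0 rot0.
rewrite -[RHS]E0; congr pair; apply/rowP => k.
- apply: (@near_eq_const R (fun r => (rot (- (r - t)) (c r)).1 0 k : R) t e e0) => // r re.
  apply: is_derive_eq (is_derive_coord 0 k (is_derive_fst (H r re))) _.
  by rewrite mxE.
- apply: (@near_eq_const R (fun r => (rot (- (r - t)) (c r)).2 0 k : R) t e e0) => // r re.
  apply: is_derive_eq (is_derive_coord 0 k (is_derive_snd (H r re))) _.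
  by rewrite mxE.
Qed.

Lemma smooth_at_rot (z : R * (vec * vec)) : smooth_at (fun z : R * (vec * vec) => rot z.1 z.2) z.
Proof.
have sc : smooth_at (fun z : R * (vec * vec) => cos z.1) z.
  by apply: (@smooth_at_comp _ _ _ _ fst cos); [repeat smooth_step|case: (smooth_at_cos_sin z.1)].
have ss : smooth_at (fun z : R * (vec * vec) => sin z.1) z.
  by apply: (@smooth_at_comp _ _ _ _ fst sin); [repeat smooth_step|case: (smooth_at_cos_sin z.1)].
have s1 : smooth_at (fun z : R * (vec * vec) => z.2.1) z by repeat smooth_step.
have s2 : smooth_at (fun z : R * (vec * vec) => z.2.2) z by repeat smooth_step.
apply: smooth_at_pair; apply: smooth_atD; apply: smooth_atZ => //.
exact: smooth_atN.
Qed.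

End ModelDerivatives.

(** * Isometric maps into AdS_3: cross product and Levi-Civita connection *)

Section Embedding.
Variables (R : realType) (M : lorentz3 R).
Local Notation vec := 'rV[R]_4.
Local Notation E3 := 'rV[R]_3.
Local Notation e a := (delta_mx 0 a : E3).

Lemma form_sumr n (g : 'M[R]_n) (v w : 'rV[R]_n) :
  form g v w = \sum_a \sum_b v 0 a * g a b * w 0 b.
Proof.
rewrite /form !mxE exchange_big; apply: eq_bigr => b _.
by rewrite !mxE mulr_suml.
Qed.

Lemma diff_rV (W : normedModType R) n (f : 'rV[R]_n -> W) x v : differentiable f x ->
  'd f x v = \sum_a v 0 a *: 'D_(delta_mx 0 a) f x.
Proof.
move=> df; apply: (@diff_basis R _ _ 'I_n (fun a => delta_mx 0 a) (fun a v => v 0 a)) => //.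
by move=> u; exact: row_sum_delta.
Qed.

(** By [cross4_det], the determinant of [G x] followed by the partial derivatives of [G]. Its sign
    tells whether [G] preserves the orientation, [G x] serving as normal to AdS_3. *)
Definition vol (G : E3 -> vec) x : R :=
  ads (cross4 (G x) ('D_(e 0) G x) ('D_(e 1) G x)) ('D_(e 2) G x).

Definition isometric_germ (i : idx M) (G : E3 -> vec) (x : E3) : Prop :=
  \forall y \near x, [/\ smooth_at G y, ads (G y) (G y) = -1 &
    forall v w, ads ('d G y v) ('d G y w) = form (met i y) v w].

Definition rows3 (v y c : E3) : 'M[R]_3 :=
  \matrix_(r < 3, s < 3) (nth 0 [:: v; y; c] r) 0 s.

Lemma levi_civita_nat (a b c : 'I_3) : levi_civita_symbol R a b c =
  \det (\matrix_(r < 3, s < 3) ((nth 0%N [:: val a; val b; val c] r == s)%:R : R)).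
Proof.
congr (\det _); apply/matrixP => r s; rewrite !mxE; congr (_%:R).
by case: r => -[|[|[|]]].
Qed.

(** Each term of the determinant is met twice, once for each order of [a] and [b]; the factor [2^-1]
    in [hodge] compensates for this. *)
Lemma levi_civita_sum (v y c : E3) :
  \sum_k (\sum_a \sum_b levi_civita_symbol R a b k * (v 0 a * y 0 b - y 0 a * v 0 b)) * c 0 k
  = 2 * \det (rows3 v y c).
Proof.
have -> : rows3 v y c = \matrix_(r < 3, s < 3) (nth 0 [:: v; y; c] r) 0 (inord s).
  by apply/matrixP => r s; rewrite !mxE inord_val.
rewrite (det_nat3 (fun r s => (nth 0 [:: v; y; c] r) 0 (inord s))) /=.
have -> : inord 0 = (ord0 : 'I_3) by apply: val_inj; rewrite /= inordK.
have -> : inord 1 = (lift ord0 (ord0 : 'I_2) : 'I_3) by apply: val_inj; rewrite /= inordK.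
have -> : inord 2 = (lift ord0 (lift ord0 (ord0 : 'I_1)) : 'I_3).
  by apply: val_inj; rewrite /= inordK.
rewrite !big_ord_recl !big_ord0 !levi_civita_nat.
rewrite !(det_nat3 (fun r s => ((nth 0%N [:: _; _; _] r == s)%:R : R))) /=.
by ring.
Qed.

Lemma raise_lower (A B : 'M[R]_3) (d : 'I_3 -> R) m : B^T = B -> B *m A = 1%:M ->
  \sum_k (2^-1 * \sum_l B k l * d l) * A k m = 2^-1 * d m.
Proof.
move=> sB BA.
transitivity (2^-1 * \sum_l d l * \sum_k B l k * A k m).
  rewrite mulr_sumr; under [RHS]eq_bigr do rewrite mulr_sumr mulr_sumr.
  rewrite [RHS]exchange_big; apply: eq_bigr => k _.
  rewrite -mulrA mulr_suml mulr_sumr; apply: eq_bigr => l _.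
  by rewrite -[in B k l]sB mxE; ring.
congr (_ * _).
under eq_bigr => l _.
  have -> : \sum_k B l k * A k m = (l == m)%:R.
    by have := congr1 (fun A : 'M[R]_3 => A l m) BA; rewrite !mxE.
  over.
by rewrite (bigD1 m)//= eqxx mulr1 big1 ?addr0// => l /negPf->; rewrite mulr0.
Qed.

Lemma koszul (p q r t u w : vec) :
  ads p q + ads r t + (ads p q + ads u w) - (ads t r + ads u w) = 2 * ads p q.
Proof. by rewrite (adsC t r); ring. Qed.

Section Germ.
Variables (i : idx M) (G : E3 -> vec) (x : E3).
Hypothesis iG : isometric_germ i G x.
Hypothesis sym : (met i x)^T = met i x.
Local Notation g := (met i x).
Local Notation F a := ('D_(e a) G x).

Let sG : smooth_at G x. Proof. by case: (nbhs_singleton iG). Qed.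
Let dG := smooth_at_differentiable sG.

Lemma ads_diff u : ads ('d G x u) (G x) = 0.
Proof.
have h : is_derive (0 : R) 1 (fun s : R => G (x + s *: u)) ('d G x u).
  have := @is_derive_line R _ _ G x u 0; rewrite scale0r addr0 (deriveE _ dG).
  exact.
have E : \forall s \near (0 : R), ads (G (x + s *: u)) (G (x + s *: u)) = -1.
  have c : {for (0 : R), continuous (fun s : R => x + s *: u)}.
    apply: cvgD; first exact: cvg_cst.
    by apply: cvgZr_tmp; exact: cvg_id.
  have iG' : \forall y \near x + 0 *: u, ads (G y) (G y) = -1.
    by rewrite scale0r addr0; apply: filterS iG => y [].
  exact: (c _ iG').
have [_] := is_derive_ads h h; rewrite (near_eq_derive (g := cst (-1 : R)) _ E) derive_cst.
rewrite scale0r addr0 [X in _ + X]adsC => H.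

lra.
Qed.

Let J : 'M[R]_(3, 4) := jacobian G x.
(** The rows are [G x] and the partial derivatives of [G]. Their Gram matrix in R^{2,2} is block
    diagonal, with blocks -1 and the metric, so the square of [\det D] is minus the determinant of
    the metric. *)
Let D : 'M[R]_(1 + 3) := col_mx (G x) J.

Let dJ v : 'd G x v = v *m J.
Proof. by rewrite /J /jacobian mul_rV_lin1. Qed.

Let gram : D *m ads_mx R *m D^T = block_mx (- 1%:M) 0 0 g.
Proof.
have adsM (v w : vec) : v *m ads_mx R *m w^T = (ads v w)%:M.
  by rewrite [LHS]mx11_scalar.
have isoM : J *m ads_mx R *m J^T = g.
  apply/matrixP => a b; have [_ _ /(_ (e a) (e b))] := nbhs_singleton iG.
  rewrite /ads /form !dJ trmx_mul !mulmxA => E.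
  have pick (A : 'M[R]_3) : A a b = (e a *m A *m (e b)^T) 0 0.
    by rewrite trmx_delta -rowE -colE !mxE.
  by rewrite !pick !mulmxA.
have JG : J *m ads_mx R *m (G x)^T = 0.
  apply/matrixP => a b; rewrite ord1 [RHS]mxE.
  by have := ads_diff (e a); rewrite /ads /form dJ -!mulmxA -rowE mxE => ->.
have GJ : G x *m ads_mx R *m J^T = 0.
  apply: (can_inj (@trmxK _ _ _)); rewrite !trmx_mul trmxK trmx0.
  by rewrite tr_diag_mx mulmxA JG.
rewrite /D mul_col_mx tr_col_mx mul_col_row; congr block_mx => //.
rewrite adsM; have [_ -> _] := nbhs_singleton iG.
by rewrite raddfN.
Qed.

Let detD2 : \det D ^+ 2 = - \det g.
Proof.
have := congr1 determinant gram; rewrite !det_mulmx det_tr det_ublock.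
have -> : \det (ads_mx R) = 1.
  by rewrite det_diag !big_ord_recl big_ord0 !mxE /=; ring.
by rewrite mulr1 -expr2 => ->; rewrite -scaleN1r detZ expr1 det1 mulr1 mulN1r.
Qed.

Let cross4_J v y c :
  ads (cross4 (G x) (v *m J) (y *m J)) (c *m J) = \det (rows3 v y c) * \det D.
Proof.
rewrite cross4_det.
transitivity (\det (block_mx 1%:M 0 0 (rows3 v y c) *m D)); last first.
  by rewrite det_mulmx det_ublock det1 mul1r.
congr (\det _); rewrite /D mul_block_col mul1mx !mul0mx addr0 add0r.
apply/matrixP => a b; rewrite [LHS]mxE.
rewrite [RHS]mxE; case: splitP => k ak; rewrite ak.
  by rewrite ord1.
rewrite /= mxE; under eq_bigr do rewrite mxE.
by case: k {ak} => -[|[|[|]]]//= _; rewrite mxE.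
Qed.

Lemma volE : vol G x = \det D.
Proof.
rewrite /vol !(deriveE _ dG) !dJ cross4_J -[RHS]mul1r -(det1 R 3); congr (\det _ * _).
apply/matrixP => a b; rewrite !mxE; case: a => -[|[|[|]]]//= k;
  by rewrite mxE eqxx /= eq_sym; congr ((_ == _)%:R); apply: val_inj.
Qed.

Lemma vol_sqr : vol G x ^+ 2 = - \det g.
Proof. by rewrite volE detD2. Qed.

Hypothesis vol_gt0 : 0 < vol G x.

Lemma sqrt_det : Num.sqrt `|\det g| = vol G x.
Proof.
have v0 := vol_gt0; rewrite volE in v0 *.
have -> : \det g = - (\det D ^+ 2) by rewrite detD2 opprK.
by rewrite normrN ger0_norm ?sqr_ge0// sqrtr_sqr gtr0_norm.
Qed.

Lemma cross4_diff v y c :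
  ads (cross4 (G x) ('d G x v) ('d G x y)) ('d G x c) = \det (rows3 v y c) * vol G x.
Proof. by rewrite !dJ cross4_J volE. Qed.

Lemma met_unit : g \in unitmx.
Proof.
rewrite unitmxE unitfE; apply/eqP => h; move: detD2; rewrite h oppr0 -volE => /eqP.
by rewrite expf_eq0 /= gt_eqF.
Qed.

(** The rows of [D] form a basis because [vol G x] is nonzero, and the ambient form is
    nondegenerate. *)
Lemma eq_of_ads (z z' : vec) : ads z (G x) = ads z' (G x) ->
  (forall v, ads z ('d G x v) = ads z' ('d G x v)) -> z = z'.
Proof.
move=> h h'; apply/eqP; rewrite -subr_eq0; apply/eqP; set u := z - z'.
have uG : ads (G x) u = 0 by rewrite adsC /u adsDl adsNl h subrr.
have uJ v : ads ('d G x v) u = 0 by rewrite adsC /u adsDl adsNl h' subrr.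
have DU : D \in unitmx.
  by rewrite unitmxE unitfE -volE gt_eqF.
have : D *m (ads_mx R *m u^T) = 0.
  rewrite /D mul_col_mx -[RHS](@col_mx0 _ 1 3 1); congr col_mx.
    by apply/matrixP => a b; rewrite !ord1 mulmxA [RHS]mxE; exact: uG.
  apply/matrixP => a b; rewrite ord1 [RHS]mxE mulmxA -(uJ (e a)) /ads /form dJ.
  by rewrite -!mulmxA -rowE [RHS]mxE.
move/(congr1 (mulmx (invmx D))); rewrite mulKmx// mulmx0 => E.
apply: ads_nondeg => w; rewrite adsC /ads /form.
by rewrite -mulmxA E mulmx0 mxE.
Qed.

(** Raising the indices of the wedge undoes [flat], by symmetry of the metric, and lowering the
    index of the result undoes [sharp]; what remains is the volume form on [v], [y], [c]. *)
Lemma form_cross v y c : form g (cross i x v y) c = \det (rows3 v y c) * vol G x.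
Proof.
have wE : invmx g *m wedge (flat i x v) (flat i x y) *m invmx g = v^T *m y - y^T *m v.
  rewrite /wedge /flat !trmx_mul sym mulmxBr mulmxBl !mulmxA.
  by rewrite mulVmx ?met_unit// !mul1mx -!mulmxA mulmxV ?met_unit// !mulmx1.
rewrite /form /cross /sharp mulmxKV ?met_unit// /hodge wE sqrt_det mxE.
apply: (@mulfI _ 2); first by rewrite pnatr_eq0.
rewrite mulrA -levi_civita_sum mulr_suml mulr_sumr; apply: eq_bigr => k _.
rewrite !mxE mulrA mulVKf ?pnatr_eq0// mulrAC; congr (_ * _).
rewrite mulr_suml; apply: eq_bigr => a _; rewrite mulr_suml; apply: eq_bigr => b _.
by rewrite !mxE !big_ord1 !mxE -mulrA [RHS]mulrC.

Qed.

Lemma ads_met v w : ads ('d G x v) ('d G x w) = form g v w.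
Proof. by case: (nbhs_singleton iG). Qed.

(** Both sides are normal to [G x] and have the same product with every tangent vector, namely a
    volume. *)
Lemma diff_cross v y :
  'd G x (cross i x v y) = cross4 (G x) ('d G x v) ('d G x y).
Proof.
apply: eq_of_ads; last by move=> c; rewrite ads_met form_cross cross4_diff.
rewrite ads_diff cross4_det; apply/esym.
by apply: (@determinant_alternate _ _ _ ord0 ord_max) => // b; rewrite !mxE.
Qed.

Let F2 a b := 'D_(e a) (fun y => 'D_(e b) G y) x.

Lemma derive2C a b : F2 a b = F2 b a.
Proof.
apply/rowP => k; rewrite /F2.
have E c d : 'D_(e c) (fun y => 'D_(e d) G y) x 0 k =
    'D_(e c) ('D_(e d) (fun y => G y 0 k : R)) x.
  have sd : differentiable (fun y => 'D_(e d) G y) x.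
    exact/smooth_at_differentiable/smooth_at_derive.
  have [_ h] := is_derive_coord 0 k (derivableP (@diff_derivable _ _ _ _ _ (e c) sd)).
  rewrite -h; apply: near_eq_derive.
  have := smooth_at_near_differentiable sG; apply: filterS => y dy.
  have [_ h'] := is_derive_coord 0 k (derivableP (@diff_derivable _ _ _ _ _ (e d) dy)).
  exact: esym h'.
transitivity ('D_(e a) ('D_(e b) (fun y => G y 0 k : R)) x); first exact: E.
transitivity ('D_(e b) ('D_(e a) (fun y => G y 0 k : R)) x); last exact/esym/E.
by apply: derive_comm; exact: smooth_at_coord.
Qed.

Lemma dmetE a b c : dmet i x a b c = ads (F2 a b) (F c) + ads (F b) (F2 a c).
Proof.
have D1 d : is_derive x (e a) (fun y => 'D_(e d) G y) (F2 a d).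
  apply: derivableP; apply: diff_derivable.
  exact/smooth_at_differentiable/smooth_at_derive.
have [_ <-] := is_derive_ads (D1 b) (D1 c).
apply: near_eq_derive; apply: filterS iG => y [sy _ h].
have dy := smooth_at_differentiable sy.
rewrite !(deriveE _ dy) h /form trmx_delta -rowE -colE.
by rewrite !mxE.
Qed.

(** Koszul formula: when the metric is differentiated through the embedding, the products of second
    with first derivatives cancel except for two copies of [ads (F2 a b) (F m)]. *)
Lemma christoffel_met a b m :
  \sum_k christoffel i x k a b * g k m = ads (F2 a b) (F m).
Proof.
pose d l := dmet i x a b l + dmet i x b a l - dmet i x l a b.
have dE l : d l = 2 * ads (F2 a b) (F l).
  rewrite /d !dmetE (derive2C b a) (derive2C l a) (derive2C l b).
  exact: koszul.
have sgV : (invmx g)^T = invmx g by rewrite trmx_inv sym.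
have := raise_lower d m sgV (mulVmx met_unit).
by rewrite (dE m) mulKf ?pnatr_eq0// => <-.
Qed.

(* The derivative at time [t] of [s |-> 'd G (x s) (v s)], when [(x, v)] has
   derivative [(dx, dv)]. *)
Definition dvel (v dx dv : E3) : vec :=
  'd G x dv + \sum_a \sum_b (dx 0 a * v 0 b) *: F2 a b.

(** Gauss formula: the Levi-Civita derivative is the tangential part of the ambient one.
    Tangentially the two agree by [christoffel_met], and since [ads (G x) (G x) = -1] the added
    multiple of [G x] removes the normal component. *)
Lemma diff_nablaV v dx dv :
  'd G x (nablaV i x v dx dv) =
  dvel v dx dv + ads (dvel v dx dv) (G x) *: G x.
Proof.
have [_ GG _] := nbhs_singleton iG.
apply: eq_of_ads.
  by rewrite ads_diff adsDl adsZl GG; ring.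
move=> c; rewrite adsDl adsZl (adsC (G x)) ads_diff mulr0 addr0.
rewrite ads_met /nablaV /dvel adsDl ads_met.
have formDl (u u' w : E3) : form g (u + u') w = form g u w + form g u' w.
  by rewrite /form !mulmxDl mxE.
rewrite formDl; congr (_ + _).
have ads_suml (I : finType) (f : I -> vec) w : ads (\sum_k f k) w = \sum_k ads (f k) w.
  apply: (big_morph (fun z => ads z w)) => [z z'|]; first exact: adsDl.
  by rewrite -[0]/(0 : vec) -(scale0r (0 : vec)) adsZl mul0r.
rewrite ads_suml; under [RHS]eq_bigr do rewrite ads_suml.
have cE : 'd G x c = \sum_m c 0 m *: F m by exact: diff_rV.
have ads_sumr (I : finType) (f : I -> vec) w : ads w (\sum_k f k) = \sum_k ads w (f k).
  by rewrite adsC ads_suml; apply: eq_bigr => k _; rewrite adsC.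
have E a b : ads ((dx 0 a * v 0 b) *: F2 a b) ('d G x c) =
    \sum_k \sum_m (christoffel i x k a b * dx 0 a * v 0 b) * g k m * c 0 m.
  rewrite adsZl cE ads_sumr exchange_big /= mulr_sumr; apply: eq_bigr => m _.
  rewrite adsZr -christoffel_met mulr_sumr mulr_sumr; apply: eq_bigr => k _.
  by ring.
under [RHS]eq_bigr do under eq_bigr do rewrite E.
rewrite form_sumr.
under [RHS]eq_bigr do rewrite exchange_big /=.
rewrite [RHS]exchange_big /=; apply: eq_bigr => k _.
under [RHS]eq_bigr do rewrite exchange_big /=.
rewrite [RHS]exchange_big /=; apply: eq_bigr => m _.
rewrite mxE !mulr_suml; apply: eq_bigr => a _; rewrite !mulr_suml.
by apply: eq_bigr.
Qed.

Lemma diff_Pl v dx dv : 'd G x (Pl i x v dx dv) =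
  Pvec 1 (G x) ('d G x v) ('d G x dx) (dvel v dx dv).
Proof. by rewrite /Pl linearD diff_nablaV diff_cross /Pvec scale1r. Qed.

Lemma diff_Pr v dx dv : 'd G x (Pr i x v dx dv) =
  Pvec (-1) (G x) ('d G x v) ('d G x dx) (dvel v dx dv).
Proof. by rewrite /Pr linearB diff_nablaV diff_cross /Pvec scaleN1r. Qed.

End Germ.

Definition tmap m n (G : 'rV[R]_m -> 'rV[R]_n) (q : 'rV[R]_m * 'rV[R]_m) :
    'rV[R]_n * 'rV[R]_n := (G q.1, 'd G (q.1) q.2).

Lemma smooth_at_tmap m n (G : 'rV[R]_m -> 'rV[R]_n) (q : 'rV[R]_m * 'rV[R]_m) :
  smooth_at G q.1 -> smooth_at (tmap G) q.
Proof.
move=> sG; apply: smooth_at_pair.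
  apply: (@smooth_at_comp R ('rV[R]_m * 'rV[R]_m)%type _ _ fst G) => //.
  exact: smooth_at_fst (smooth_at_id q).
(* Smoothness is known for directional derivatives in fixed directions, so the differential is
   expanded in partial derivatives. *)
apply: (@smooth_at_ext _ _ _
  (fun q : 'rV[R]_m * 'rV[R]_m => \sum_a q.2 0 a *: 'D_(delta_mx 0 a) G q.1)).
  have c : {for q, continuous (fst : 'rV[R]_m * 'rV[R]_m -> 'rV[R]_m)} by exact: cvg_fst.
  have H : \forall z \near q, differentiable G z.1.
    exact: c _ (smooth_at_near_differentiable sG).
  by apply: filterS H => z dz; rewrite (diff_rV _ dz).
apply: smooth_at_sum => a _; apply: smooth_atZ.
  exact: smooth_at_coord (smooth_at_snd (smooth_at_id q)).
apply: (@smooth_at_comp R ('rV[R]_m * 'rV[R]_m)%type _ _ fst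
  (fun y => 'D_(delta_mx 0 a) G y)).
  exact: smooth_at_fst (smooth_at_id q).
exact: smooth_at_derive.
Qed.

Lemma is_derive_tmap (G : E3 -> vec) (X : R -> E3 * E3) (t : R) dx dv :
  smooth_at G (X t).1 -> is_derive t 1 X (dx, dv) ->
  is_derive t 1 (fun s => tmap G (X s))
    ('d G ((X t).1) dx, dvel G (X t).1 (X t).2 dx dv).
Proof.
move=> sG dX; have dG := smooth_at_differentiable sG.
have d1 := is_derive_fst dX; have d2 := is_derive_snd dX.
have comp (W : normedModType R) (f : E3 -> W) : differentiable f (X t).1 ->
    is_derive t 1 (fun s => f (X s).1) ('d f ((X t).1) dx).
  move=> df; have dfst : differentiable (fun s => (X s).1) t.
    by apply/derivable1_diffP; case: d1.
  have dc : differentiable (f \o (fun s => (X s).1)) t by exact: differentiable_comp.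
  split; first exact: diff_derivable.
  rewrite (deriveE _ dc) (diff_comp dfst df) /=; congr ('d f _ _).
  by rewrite -(deriveE _ dfst); case: d1.
apply: is_derive_pair; first exact: comp.
have dS : is_derive t 1 (\sum_(a < 3) (fun s => (X s).2 0 a *: 'D_(e a) G (X s).1))
    (\sum_(a < 3) (dv 0 a *: 'D_(e a) G (X t).1 + (X t).2 0 a *: 'd ('D_(e a) G) ((X t).1) dx)).
  apply: is_derive_sum => a; apply: is_derive_scale; first exact: is_derive_coord d2.
  by apply: comp; exact/smooth_at_differentiable/smooth_at_derive.
have cX : {for t, continuous (fun s => (X s).1)}.
  by apply/differentiable_continuous/derivable1_diffP; case: d1.
have H : \forall s \near t, differentiable G (X s).1.
  exact: cX _ (smooth_at_near_differentiable sG).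
apply: (near_eq_is_derive (f := \sum_(a < 3) (fun s => (X s).2 0 a *: 'D_(e a) G (X s).1))).
  by apply: filterS H => s ds; rewrite fct_sumE (diff_rV _ ds).
apply: is_derive_eq dS _; rewrite big_split /= /dvel; congr (_ + _).
  by rewrite [RHS](diff_rV _ dG).
have E a : (X t).2 0 a *: 'd ('D_(e a) G) ((X t).1) dx =
    \sum_b (dx 0 b * (X t).2 0 a) *: 'D_(e b) ('D_(e a) G) (X t).1.
  have dFa : differentiable ('D_(e a) G) (X t).1.
    exact/smooth_at_differentiable/smooth_at_derive.
  rewrite (diff_rV dx dFa) scaler_sumr; apply: eq_bigr => b _.
  by rewrite scalerA mulrC.
by rewrite [RHS]exchange_big; apply: eq_bigr => a _; exact: E.
Qed.

End Embedding.

(** * Germs on the unit tangent bundle *)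

Section UnitTangent.
Variables (R : realType) (M : lorentz3 R).
Local Notation E3 := 'rV[R]_3.
Local Notation TT := (E3 * E3)%type.
Local Notation T1 := (T1t M).
Implicit Types (i j k : idx M) (p : M) (x v : E3) (q : TT) (xi eta : T1).

Lemma nbhs_open (T : topologicalType) (z : T) (A : set T) : nbhs z A ->
  exists B, [/\ open B, B z & B `<=` A].
Proof. by rewrite nbhsE => -[B [oB Bz] BA]; exists B. Qed.

Lemma near_eq_diff (V W : normedModType R) (f g : V -> W) z u :
  (\near z, f z = g z) -> differentiable f z -> differentiable g z ->
  'd f z u = 'd g z u.
Proof. by move=> fg df dg; rewrite -(deriveE _ df) -(deriveE _ dg); exact: near_eq_derive. Qed.

Lemma diff_comp_at (U V W : normedModType R) (f : U -> V) (g : V -> W) z y u :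
  differentiable f z -> f z = y -> differentiable g y ->
  'd (g \o f) z u = 'd g y ('d f z u).
Proof. by move=> df E dg; subst y; rewrite (diff_comp df dg). Qed.

Definition tau i j : E3 -> E3 := phi j \o psi i.

Definition overlap i j : set E3 := phi i @` (dom i `&` dom j).

Lemma overlapP i j p : dom i p -> dom j p -> overlap i j (phi i p).
Proof. by move=> ip jp; exists p. Qed.

Lemma overlap_dom i j p : dom i p -> overlap i j (phi i p) -> dom j p.
Proof. by move=> ip [p' [ip' jp'] E]; rewrite -(phiK ip) -E phiK. Qed.

Lemma overlap_psi i j x : overlap i j x -> dom i (psi i x) /\ dom j (psi i x) /\ phi i (psi i x) = x.
Proof. by case=> p [ip jp] <-; rewrite phiK. Qed.

Lemma open_overlap i j : open (overlap i j).
Proof.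
rewrite openE => x ox; have [ip [jp E]] := overlap_psi ox.
have cx : (phi i @` dom i) x by exists (psi i x).
have h1 : \forall y \near x, (phi i @` dom i) y.
  by apply: open_nbhs_nbhs; split => //; exact: cod_open.
have h2 : \forall y \near x, dom j (psi i y).
  have := psi_continuous cx; apply; apply: open_nbhs_nbhs; split => //.
  exact: dom_open.
apply: filterS2 h1 h2 => y [p ip' <-]; rewrite phiK// => jp'.
by exists p.
Qed.

Lemma smooth_at_tau i j x : overlap i j x -> smooth_at (tau i j) x.
Proof.
have st : smooth (overlap i j) (tau i j) := @trans_smooth R M i j.
by move: st => /(smoothP _ (@open_overlap i j)); apply.
Qed.

Lemma tau_phi i j p : dom i p -> tau i j (phi i p) = phi j p.
Proof. by move=> ip; rewrite /tau /= phiK. Qed.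

Lemma diff_tau i j p : dom i p -> dom j p -> differentiable (tau i j) (phi i p).
Proof. by move=> ip jp; apply/smooth_at_differentiable/smooth_at_tau/overlapP. Qed.

Lemma near_overlap i j p : dom i p -> dom j p -> \forall x \near phi i p, overlap i j x.
Proof.
by move=> ip jp; apply: open_nbhs_nbhs; split; [exact: open_overlap|exact: overlapP].
Qed.

Lemma diff_tau_comp i j k p v : dom i p -> dom j p -> dom k p ->
  'd (tau i k) (phi i p) v = 'd (tau j k) (phi j p) ('d (tau i j) (phi i p) v).
Proof.
move=> ip jp kp; have dij := diff_tau ip jp.
have Ept : tau i j (phi i p) = phi j p by rewrite /tau /= phiK.
have djk := diff_tau jp kp.
have dc : differentiable (tau j k \o tau i j) (phi i p).
  by apply: differentiable_comp => //; rewrite Ept.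
apply: etrans (diff_comp_at v dij Ept djk).
apply: near_eq_diff => //; last exact: diff_tau.
apply: filterS (near_overlap ip jp) => x ox; have [ip' [jp' _]] := overlap_psi ox.
by rewrite /tau /= phiK.
Qed.

Lemma diff_tau_id i p v : dom i p -> 'd (tau i i) (phi i p) v = v.
Proof.
move=> ip; have [did E] := @is_diff_id R E3 (phi i p).
apply: etrans (congr1 (fun h => h v) E); apply: near_eq_diff => //.
  apply: filterS (near_overlap ip ip) => x ox.
  by have [_ [_ Ex]] := overlap_psi ox; exact: Ex.
exact: diff_tau.
Qed.

Lemma coord_tau i j xi : dom i (base xi) -> dom j (base xi) ->
  coord j xi = tmap (tau i j) (coord i xi).
Proof.
move=> ix jx; rewrite /tmap /coord /= tau_phi//; congr pair.
exact: comp_trans.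
Qed.

Lemma coord_inj i xi eta : dom i (base xi) -> dom i (base eta) ->
  coord i xi = coord i eta -> xi = eta.
Proof.
move=> ix ie [E1 E2].
have E : base xi = base eta by rewrite -(phiK ix) E1 phiK.
have C : comp xi = comp eta.
  apply/funext => j; have [jx|jx] := pselect (dom j (base xi)).
    by rewrite (comp_trans ix jx) (comp_trans (j := j) ie) -?E// E2.
  by rewrite (comp_out jx) comp_out// -E.
case: xi eta {ix ie E1 E2} E C => b c h1 h2 h3 h4 [b' c' h1' h2' h3' h4'] /= E C.
by subst; congr MkT1t; exact: Prop_irrelevance.
Qed.

(** Components in one chart spread to the others by the chain rule for transition maps; [met_trans]
    keeps the vector unit and, with [tfield_trans], future-directed. *)
Lemma make_T1 i x v : (phi i @` dom i) x -> form (met i x) v v = -1 ->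
  form (met i x) v (tfield i x) < 0 ->
  exists2 xi : T1, dom i (base xi) & coord i xi = (x, v).
Proof.
move=> [p ip <-] vv vf.
pose c j := if pselect (dom j p) then 'd (tau i j) (phi i p) v else 0.
have cE j : dom j p -> c j = 'd (tau i j) (phi i p) v by rewrite /c; case: pselect.
have h1 j : ~ dom j p -> c j = 0 by rewrite /c; case: pselect.
have h2 j k : dom j p -> dom k p -> c k = 'd (phi k \o psi j) (phi j p) (c j).
  by move=> jp kp; rewrite !cE//; exact: diff_tau_comp.
have h3 j : dom j p -> form (met j (phi j p)) (c j) (c j) = -1.
  by move=> jp; rewrite cE// -vv; exact: met_trans.
have h4 j : dom j p -> form (met j (phi j p)) (c j) (tfield j (phi j p)) < 0.
  by move=> jp; rewrite cE// (tfield_trans ip jp) met_trans.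
exists (MkT1t h1 h2 h3 h4) => //.
by rewrite /coord /= cE// diff_tau_id.
Qed.

(** The neighbourhood filter of T^{1,t}M, on which [T1_open] is a bare predicate. A single chart is
    enough by [nbT_chart]. *)
Definition nbT xi (P : set T1) := exists i (B : set TT),
  [/\ dom i (base xi), open B, B (coord i xi) &
      forall eta, dom i (base eta) -> B (coord i eta) -> P eta].

Lemma nbT_chart xi P j : nbT xi P -> dom j (base xi) -> exists B : set TT,
  [/\ open B, B (coord j xi) &
      forall eta, dom j (base eta) -> B (coord j eta) -> dom j (base eta) /\ P eta].
Proof.
move=> [i [B [ix oO Ox OP]]] jx.
have st : smooth_at (tmap (tau j i)) (coord j xi).
  by apply: smooth_at_tmap; exact/smooth_at_tau/overlapP.
have ct := smooth_at_continuous st.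
have h1 : \forall z \near coord j xi, B (tmap (tau j i) z).
  by apply: (ct); apply: open_nbhs_nbhs; split => //; rewrite -coord_tau.
have h2 : \forall z \near coord j xi, overlap j i z.1.
  have c : {for coord j xi, continuous (fst : TT -> E3)} by exact: cvg_fst.
  by apply: c; exact: near_overlap.
have [B2 [oO2 O2x O2P]] := nbhs_open (filterI h1 h2).
exists B2; split => // eta je O2e; split => //.
have [Oe oe] := O2P _ O2e.
have ie : dom i (base eta) by exact: overlap_dom oe.
by apply: OP => //; rewrite (coord_tau je ie).
Qed.

Lemma nbT_filter xi : Filter (nbT xi).
Proof.
split.
- have [i ix] := dom_cover (base xi).
  by exists i, setT; split => //; exact: openT.
- move=> P Q nP nQ; have [i ix] := dom_cover (base xi).
  have [B [oO Ox OP]] := nbT_chart nP ix; have [B2 [oO2 O2x O2P]] := nbT_chart nQ ix.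
  exists i, (B `&` B2); split => //; first exact: openI.
  by move=> eta ie [Oe O2e]; split; [exact: (OP _ ie Oe).2|exact: (O2P _ ie O2e).2].
- move=> P Q PQ [i [B [ix oO Ox OP]]]; exists i, B; split => // eta ie Oe.
  by apply: PQ; exact: OP.
Qed.
#[local] Existing Instance nbT_filter.

Lemma nbT_self xi P : nbT xi P -> P xi.
Proof. by move=> [i [B [ix oO Ox OP]]]; exact: OP. Qed.

Lemma nbT_nbT xi P : nbT xi P -> nbT xi (fun eta => nbT eta P).
Proof.
move=> [i [B [ix oO Ox OP]]]; exists i, B; split => // eta ie Oe.
by exists i, B; split.
Qed.

Lemma T1_openP (S : set T1) : T1_open S <-> forall xi, S xi -> nbT xi S.
Proof.
split=> [oS xi Sx|H xi i Sx ix].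
  have [i ix] := dom_cover (base xi); have [B [oO Ox OP]] := oS _ _ Sx ix.
  by exists i, B.
have [B [oO Ox OP]] := nbT_chart (H _ Sx) ix.
by exists B; split => // eta ie /(OP _ ie)[].
Qed.

Lemma T1_open_nbT P : T1_open (fun eta => nbT eta P).
Proof. by apply/T1_openP => xi; exact: nbT_nbT. Qed.

Lemma nbT_coord i xi (A : set TT) : dom i (base xi) -> nbhs (coord i xi) A ->
  nbT xi (fun eta => dom i (base eta) /\ A (coord i eta)).
Proof.
move=> ix /nbhs_open[B [oO Ox OA]].
by exists i, B; split => // eta ie Oe; split => //; exact: OA.
Qed.

Lemma nbT_coordP i xi P : dom i (base xi) -> nbT xi P ->
  \forall z \near coord i xi, forall eta, dom i (base eta) -> coord i eta = z -> P eta.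
Proof.
move=> ix nP; have [B [oO Ox OP]] := nbT_chart nP ix.
apply: filterS (open_nbhs_nbhs (conj oO Ox)) => z Oz eta ie E.
by apply: (OP eta ie _).2; rewrite E.
Qed.

(** Smoothness of [F] is required at all nearby points, since in [smooth_at] the neighbourhood may
    shrink with the order, whereas [T1_smooth] asks for one open set. *)
Definition smooth_T1 (W : normedModType R) (g : T1 -> W) xi := exists i (F : TT -> W),
  [/\ dom i (base xi), \forall z \near coord i xi, smooth_at F z &
      nbT xi (fun eta => dom i (base eta) -> g eta = F (coord i eta))].

Lemma smooth_T1_chart (W : normedModType R) (g : T1 -> W) xi j : findim W ->
  smooth_T1 g xi -> dom j (base xi) -> exists F : TT -> W,
    (\forall z \near coord j xi, smooth_at F z) /\
    nbT xi (fun eta => dom j (base eta) -> g eta = F (coord j eta)).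
Proof.
move=> fW [i [F [ix sF gF]]] jx; exists (fun z => F (tmap (tau j i) z)); split.
  have oz : \forall z \near coord j xi, overlap j i z.1.
    have c : {for coord j xi, continuous (fst : TT -> E3)} by exact: cvg_fst.
    by apply: c; exact: near_overlap.
  have st : smooth_at (tmap (tau j i)) (coord j xi).
    by apply: smooth_at_tmap; exact/smooth_at_tau/overlapP.
  have sz : \forall z \near coord j xi, smooth_at F (tmap (tau j i) z).
    by apply: (smooth_at_continuous st); rewrite -coord_tau.
  apply: filterS2 oz sz => z oz Fz.
  by apply: smooth_at_comp => //; exact/smooth_at_tmap/smooth_at_tau.
have id_ : nbT xi (fun eta => dom i (base eta)).
  have [B [oO Ox OP]] := nbT_chart (@filterT _ _ (nbT_filter xi)) ix.
  by exists i, B.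
apply: filterS2 id_ gF => eta ie E je.
by rewrite E// (coord_tau je ie).
Qed.

Lemma T1_smoothP (W : normedModType R) (S : set T1) (g : T1 -> W) : findim W ->
  T1_open S -> T1_smooth S g <-> forall xi, S xi -> smooth_T1 g xi.
Proof.
move=> fW oS; split=> [sg xi Sx|sg xi i Sx ix].
  have [i ix] := dom_cover (base xi).
  have [B [F [oO Ox sF gF]]] := sg xi i Sx ix.
  exists i, F; split => //.
    by apply: filterS (open_nbhs_nbhs (conj oO Ox)) => z; exact: (smoothP _ oO).1.
  have nS := (T1_openP S).1 oS _ Sx.
  have nO : nbT xi (fun eta => dom i (base eta) -> B (coord i eta)).
    by apply: filterS (nbT_coord ix (open_nbhs_nbhs (conj oO Ox))) => eta [].
  by apply: filterS2 nS nO => eta Se Oe ie; apply: gF => //; exact: Oe.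
have [F [sF gF]] := smooth_T1_chart fW (sg _ Sx) ix.
have [B [oO Ox OP]] := nbT_chart gF ix.
move: sF => /nbhs_open[B2 [oO2 O2x sF]].
exists (B `&` B2), F; split => //; first exact: openI.
  by apply/(smoothP _ (openI oO oO2)) => z [_ /sF].
by move=> eta _ ie [Oe _]; exact: (OP _ ie Oe).2.
Qed.

Lemma smooth_T1_continuous (W : normedModType R) (g : T1 -> W) xi :
  smooth_T1 g xi -> forall A, nbhs (g xi) A -> nbT xi (fun eta => A (g eta)).
Proof.
move=> [i [F [ix sF gF]]] A nA.
have E : g xi = F (coord i xi) by apply: (nbT_self gF).
have cF := smooth_at_continuous (nbhs_singleton sF).
have nF : nbhs (coord i xi) (fun z => A (F z)) by apply: cF; rewrite -E.
apply: filterS2 gF (nbT_coord ix nF) => eta ge [ie Ae].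
by rewrite ge.
Qed.

Lemma smooth_T1_comp (V W : normedModType R) (g : T1 -> V) (h : V -> W) xi :
  findim V -> findim W -> smooth_T1 g xi ->
  (\forall z \near g xi, smooth_at h z) -> smooth_T1 (fun eta => h (g eta)) xi.
Proof.
move=> fV fW [i [F [ix sF gF]]] sh.
have E : g xi = F (coord i xi) by apply: (nbT_self gF).
exists i, (fun z => h (F z)); split => //.
  have cF := smooth_at_continuous (nbhs_singleton sF).
  have hF : \forall z \near coord i xi, smooth_at h (F z) by apply: cF; rewrite -E.
  by apply: filterS2 sF hF => z sz hz; exact: smooth_at_comp.
by apply: filterS gF => eta ge ie; rewrite ge.
Qed.

Lemma smooth_T1_ext (W : normedModType R) (g g' : T1 -> W) xi :
  nbT xi (fun eta => g eta = g' eta) -> smooth_T1 g xi -> smooth_T1 g' xi.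
Proof.
move=> E [i [F [ix sF gF]]]; exists i, F; split => //.
by apply: filterS2 E gF => eta E' ge ie; rewrite -E' ge.
Qed.

Lemma nbT_dom i xi : dom i (base xi) -> nbT xi (fun eta => dom i (base eta)).
Proof.
by move=> ix; exists i, setT; split => //; exact: openT.
Qed.

Lemma curve_germ i (V : R -> T1) t : dom i (base (V t)) ->
  (\forall s \near t, dom i (base (V s)) /\ smooth_at (fun s => coord i (V s)) s) ->
  smooth_curve V t.
Proof.
move=> it H j jt.
have [iN sN] : (\forall s \near t, dom i (base (V s))) /\
    (\forall s \near t, smooth_at (fun s => coord i (V s)) s).
  by split; apply: filterS H => s [].
have cV := smooth_at_continuous (nbhs_singleton sN).
have oN : \forall s \near t, overlap i j (coord i (V s)).1.
  have c : {for coord i (V t), continuous (fst : TT -> E3)} by exact: cvg_fst.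
  exact: cV _ (c _ (near_overlap it jt)).
have jN : \forall s \near t, dom j (base (V s)).
  by apply: filterS2 iN oN => s; exact: overlap_dom.
have EN : \forall s \near t, tmap (tau i j) (coord i (V s)) = coord j (V s).
  by apply: filterS2 iN jN => s is_ js; rewrite -coord_tau.
have SN : \forall s \near t, smooth_at (fun s => coord j (V s)) s.
  apply: filterS3 (near_join EN) sN oN => s Es ss os.
  apply: smooth_at_ext Es _.
  by apply: smooth_at_comp => //; exact/smooth_at_tmap/smooth_at_tau.
have [J [oJ Jt JP]] := nbhs_open (filterI jN SN).
exists J; split => //; first by move=> s /JP[].
by apply/smoothP => // s /JP[].
Qed.

Lemma smooth_curve_coord i (V : R -> T1) t : smooth_curve V t -> dom i (base (V t)) ->
  \forall s \near t, dom i (base (V s)) /\ smooth_at (fun s => coord i (V s)) s.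
Proof.
move=> sV it; have [J [oJ Jt Jd sJ]] := sV i it.
have sJ' := (smoothP _ oJ).1 sJ.
apply: filterS (open_nbhs_nbhs (conj oJ Jt)) => s Js.
by split; [exact: Jd|exact: sJ'].
Qed.

Lemma smooth_curve_near (V : R -> T1) t P : smooth_curve V t -> nbT (V t) P ->
  \forall s \near t, P (V s).
Proof.
move=> sV nP; have [i it] := dom_cover (base (V t)).
have H := smooth_curve_coord sV it.
have cV := smooth_at_continuous (nbhs_singleton H).2.
have HP : \forall s \near t, forall eta, dom i (base eta) ->
    coord i eta = coord i (V s) -> P eta.
  exact: cV _ (nbT_coordP it nP).
by apply: filterS2 H HP => s [is_ _]; apply.
Qed.

Lemma smooth_curve_comp (W : normedModType R) (g : T1 -> W) (V : R -> T1) t : findim W ->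
  smooth_curve V t -> smooth_T1 g (V t) -> smooth_at (fun s => g (V s)) t.
Proof.
move=> fW sV [i [F [ix sF gF]]].
have H := smooth_curve_coord sV ix.
apply: (@smooth_at_ext _ _ _ (fun s => F (coord i (V s)))).
  by apply: filterS2 H (smooth_curve_near sV gF) => s [is_ _] E; rewrite E.
by apply: smooth_at_comp => //; [case: (nbhs_singleton H)|exact: nbhs_singleton sF].
Qed.

End UnitTangent.
#[global] Existing Instance nbT_filter.

(** * Developing maps *)

Section Flip.
Variables (R : realType) (M : lorentz3 R).
Local Notation vec := 'rV[R]_4.
Local Notation E3 := 'rV[R]_3.

Definition flip (S : pred 'I_4) (y : vec) : vec :=
  \row_k (if S k then - y 0 k else y 0 k).

(* [reflection] corrects the orientation of a local model, [time_flip] the sign of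
   [lc], that is the time-orientation. *)
Definition reflection : vec -> vec := flip (pred1 i3).
Definition time_flip : vec -> vec := flip (pred2 i1 i2).

Lemma flipK S : involutive (flip S).
Proof. by move=> y; apply/rowP => k; rewrite !mxE; case: (S k); rewrite ?opprK. Qed.

Lemma ads_flip S y w : ads (flip S y) (flip S w) = ads y w.
Proof. by rewrite !adsE !mxE; case: (S _); case: (S _); case: (S _); case: (S _); ring. Qed.

Lemma smooth_at_flip S y : smooth_at (flip S) y.
Proof.
apply: smooth_at_row => k; have sy := smooth_at_coord 0 k (smooth_at_id y).
by case: (S k); [exact: smooth_atN sy|exact: sy].
Qed.

Lemma flip_linear S : exists2 L : {linear vec -> vec}, continuous L & forall y, L y = flip S y.
Proof.
have lin : linear (flip S).
  move=> a u v; apply/rowP => k; rewrite !mxE; case: (S k) => //.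
  by ring.
pose m := GRing.isLinear.Build _ _ _ _ _ lin.
pose L : {linear vec -> vec} := HB.pack (flip S) m.
by exists L => // y; exact: smooth_at_continuous (smooth_at_flip S y).
Qed.

Lemma diff_flip S (G : E3 -> vec) x v : differentiable G x ->
  differentiable (flip S \o G) x /\ 'd (flip S \o G) x v = flip S ('d G x v).
Proof.
move=> dG; have ds : differentiable (flip S) (G x).
  exact/smooth_at_differentiable/smooth_at_flip.
have dc : differentiable (flip S \o G) x by exact: differentiable_comp.
split => //; have [L cL EL] := flip_linear S.
have [_ h] := is_derive_lin cL (derivableP (@diff_derivable _ _ _ _ _ v dG)).
transitivity ('D_v (flip S \o G) x); first exact/esym/deriveE.
have -> : flip S \o G = fun y => L (G y) by apply/funext => y; rewrite /= EL.
by apply: (etrans h); rewrite EL; congr (flip S _); exact: deriveE.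
Qed.

Lemma ads_diff_flip S (G : E3 -> vec) x v w : differentiable G x ->
  ads ('d (flip S \o G) x v) ('d (flip S \o G) x w) = ads ('d G x v) ('d G x w).
Proof.
move=> dG; apply: etrans (ads_flip S _ _).
exact: (congr2 (@ads R) (diff_flip S v dG).2 (diff_flip S w dG).2).
Qed.

Lemma vol_diff (G : E3 -> vec) x : differentiable G x ->
  vol G x = ads (cross4 (G x) ('d G x (delta_mx 0 0)) ('d G x (delta_mx 0 1)))
    ('d G x (delta_mx 0 2)).
Proof. by move=> dG; rewrite /vol !(deriveE _ dG). Qed.

Lemma cross4_reflection (p q r s : vec) :
  ads (cross4 (reflection p) (reflection q) (reflection r)) (reflection s)
  = - ads (cross4 p q r) s.
Proof.
by rewrite /cross4 !(adsDl, adsZl, adsNl) !ads_flip !(ads_entries (of_entries _ _ _ _))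
  !entries_of /la /lb /lc /ld /e11 /e12 /e21 /e22 !adsE !mxE /=; field.
Qed.

Lemma cross4_time_flip (p q r s : vec) :
  ads (cross4 (time_flip p) (time_flip q) (time_flip r)) (time_flip s)
  = ads (cross4 p q r) s.
Proof.
by rewrite /cross4 !(adsDl, adsZl, adsNl) !ads_flip !(ads_entries (of_entries _ _ _ _))
  !entries_of /la /lb /lc /ld /e11 /e12 /e21 /e22 !mxE /=; field.
Qed.

Lemma vol_flip S (G : E3 -> vec) x : differentiable G x ->
  vol (flip S \o G) x = ads (cross4 (flip S (G x)) (flip S ('d G x (delta_mx 0 0)))
    (flip S ('d G x (delta_mx 0 1)))) (flip S ('d G x (delta_mx 0 2))).
Proof.
move=> dG; have [df _] := diff_flip S 0 dG; apply: etrans (vol_diff df) _.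
have E v := (diff_flip S v dG).2.
exact: (congr2 (@ads R) (congr2 (cross4 _) (E _) (E _)) (E _)).
Qed.

Lemma vol_reflection (G : E3 -> vec) x : differentiable G x ->
  vol (reflection \o G) x = - vol G x.
Proof. by move=> dG; rewrite (vol_flip _ dG) cross4_reflection vol_diff. Qed.

Lemma vol_time_flip (G : E3 -> vec) x : differentiable G x ->
  vol (time_flip \o G) x = vol G x.
Proof. by move=> dG; rewrite (vol_flip _ dG) cross4_time_flip vol_diff. Qed.

(** [time_flip] is conjugation by the permutation matrix, so it turns [lc] into [lb]; and
    [lb * lc = -1 - la^2] is negative. *)
Lemma lc_time_flip (y w : vec) : TAdS (y, w) -> lc y w < 0 ->
  0 < lc (time_flip y) (time_flip w).
Proof.
move=> Q c0; have d := l_det Q.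
have -> : lc (time_flip y) (time_flip w) = lb y w.
  by rewrite /lc /lb /e11 /e12 /e21 /e22 !mxE /=; ring.
rewrite -(nmulr_llt0 _ c0); have := sqr_ge0 (la y w); lra.
Qed.

Lemma lc_neq0 (y w : vec) : TAdS (y, w) -> lc y w != 0.
Proof.
move=> Q; apply/eqP => h; have := l_det Q; rewrite h mulr0 addr0 => h'.
by have := sqr_ge0 (la y w); rewrite h'; lra.
Qed.

End Flip.

Section Development.
Variables (R : realType) (M : lorentz3 R).
Local Notation vec := 'rV[R]_4.
Local Notation E3 := 'rV[R]_3.
Local Notation TT := (E3 * E3)%type.
Local Notation T1 := (T1t M).
Implicit Types (i j k : idx M) (p : M) (x v : E3) (xi eta : T1).

Record local_model i (A : set E3) (B : set vec) (F : E3 -> vec) (H : vec -> E3) : Prop :=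
  LocalModel {
  model_openA : open A;
  model_cod : A `<=` phi i @` dom i;
  model_openB : open B;
  model_smoothF : forall x, A x -> smooth_at F x;
  model_smoothH : forall y, B y -> smooth_at H y;
  model_image : F @` A = @AdS3 R `&` B;
  model_K : forall x, A x -> H (F x) = x;
  model_iso : forall x v w, A x -> ads ('d F x v) ('d F x w) = form (met i x) v w }.

Lemma exists_model p : locally_AdS M -> exists i A B F H,
  [/\ dom i p, A (phi i p) & local_model i A B F H].
Proof.
move=> /(_ p)[i [A [B [F [H]]]]] [[ip oA Ap Ac oB] [sF sH FA HF iso]].
exists i, A, B, F, H; split => //; split => //.
- exact/smoothP.
- exact/smoothP.
Qed.

Lemma model_flip S i A B F H : local_model i A B F H ->
  local_model i A (flip S @^-1` B) (flip S \o F) (H \o flip S).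
Proof.
case=> oA Ac oB sF sH FA HF iso; split.
- exact: oA.
- exact: Ac.
- apply: open_comp oB => y _; exact: smooth_at_continuous (smooth_at_flip S y).
- move=> x Ax; apply: (@smooth_at_comp _ _ _ _ F (flip S)); first exact: sF.
  exact: smooth_at_flip.
- move=> y By; apply: (@smooth_at_comp _ _ _ _ (flip S) H); first exact: smooth_at_flip.
  exact: sH.
- apply/seteqP; split=> y /=.
    move=> [x Ax <-]; have : (F @` A) (F x) by exists x.
    rewrite FA => -[h1 h2]; split; last by rewrite /= flipK.
    by rewrite /AdS3 /=; apply: etrans h1; exact: ads_flip.
  move=> [h1 h2]; have : (@AdS3 R `&` B) (flip S y).
    by split => //; apply: etrans h1; exact: ads_flip.
  by rewrite -FA => -[x Ax E]; exists x => //; rewrite /= E flipK.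
- by move=> x Ax /=; rewrite flipK; exact: HF.
- move=> x v w Ax; have dF := smooth_at_differentiable (sF _ Ax).
  exact: etrans (ads_diff_flip S v w dF) (iso x v w Ax).
Qed.

Lemma model_germ i A B F H x : local_model i A B F H -> A x -> isometric_germ i F x.
Proof.
case=> oA Ac oB sF sH FA HF iso Ax.
apply: filterS (open_nbhs_nbhs (conj oA Ax)) => y Ay; split; first exact: sF.
  have : (F @` A) (F y) by exists y.
  by rewrite FA => -[].
by move=> v w; exact: iso.
Qed.

Lemma met_symP i p : dom i p -> (met i (phi i p))^T = met i (phi i p).
Proof. by move=> ip; apply: met_sym; exists p. Qed.

(** By [vol_sqr], [vol] could vanish only where the metric is degenerate, contrary to
    [met_lorentz]. *)
Lemma isometric_vol_neq0 i F p : dom i p -> isometric_germ i F (phi i p) ->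
  vol F (phi i p) != 0.
Proof.
move=> ip iG; have [|P Pu E] := @met_lorentz R M i (phi i p); first by exists p.
have /eqP h := congr1 determinant E.
apply/eqP => v0; have := vol_sqr iG; rewrite v0 expr0n /= => /esym/eqP.
rewrite oppr_eq0 => /eqP d0.
move: h; rewrite !det_mulmx d0 mulr0 mul0r det_diag !big_ord_recl big_ord0 !mxE /=.
by rewrite !mulr1 eq_sym oppr_eq0 oner_eq0.
Qed.

(* [d] embeds [N] isometrically, with orientations, as an open part of AdS_3, and
   [H] is the inverse of [d] read in the chart [i0]. *)
Record is_dev (N : set M) (d : M -> vec) i0 (B : set vec) (H : vec -> E3) : Prop := IsDev {
  dev_open : open N;
  dev_dom : N `<=` dom i0;
  dev_openB : open B;
  dev_smooth_inv : forall y, B y -> smooth_at H y;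
  dev_inv : forall p, N p -> B (d p) /\ H (d p) = phi i0 p;
  dev_surj : forall y, ads y y = -1 -> B y -> exists2 p, N p & d p = y;
  dev_germ : forall p j, N p -> dom j p ->
    isometric_germ j (d \o psi j) (phi j p) /\ 0 < vol (d \o psi j) (phi j p) }.

Lemma open_chart_preimage i (A : set E3) : open A -> open (dom i `&` phi i @^-1` A).
Proof.
move=> oA; rewrite openE => p [ip Ap].
apply: filterI; first by apply: open_nbhs_nbhs; split => //; exact: dom_open.
by apply: (phi_continuous ip); exact: open_nbhs_nbhs.
Qed.

Lemma nbhs_preimage (S T : topologicalType) (f : S -> T) s (A : set T) :
  {for s, continuous f} -> nbhs (f s) A -> nbhs s (f @^-1` A).
Proof. by move=> cf nA; exact: cf _ nA. Qed.

Lemma vol_continuous (F : E3 -> vec) x : smooth_at F x -> {for x, continuous (vol F)}.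
Proof.
move=> sF; apply: smooth_at_continuous; apply: smooth_at_ads; last exact: smooth_at_derive.
by apply: smooth_at_cross4 => //; exact: smooth_at_derive.
Qed.

Lemma diff_comp_tau (F : E3 -> vec) i j p v : differentiable F (phi i p) ->
  dom i p -> dom j p ->
  'd (F \o tau j i) (phi j p) v = 'd F (phi i p) ('d (tau j i) (phi j p) v).
Proof.
move=> dF ip jp; apply: diff_comp_at => //; first exact: diff_tau.
by rewrite /tau /= phiK.
Qed.

Lemma smooth_at_comp_tau (F : E3 -> vec) i j p : smooth_at F (phi i p) ->
  dom i p -> dom j p -> smooth_at (F \o tau j i) (phi j p).
Proof.
move=> sF ip jp; apply: (@smooth_at_comp _ _ _ _ (tau j i) F).
  exact/smooth_at_tau/overlapP.
by rewrite /tau /= phiK.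
Qed.

Lemma isometric_comp_tau F i j p : dom i p -> dom j p ->
  isometric_germ i F (phi i p) -> isometric_germ j (F \o tau j i) (phi j p).
Proof.
move=> ip jp iF.
have ct := smooth_at_continuous (smooth_at_tau (overlapP jp ip)).
pose P x := [/\ smooth_at F x, ads (F x) (F x) = -1 &
    forall v w, ads ('d F x v) ('d F x w) = form (met i x) v w].
have Tq q : dom j q -> tau j i (phi j q) = phi i q by move=> jq; rewrite /tau /= phiK.
have iF' : nbhs (tau j i (phi j p)) P by rewrite Tq.
have h1 : \forall y \near phi j p, P (tau j i y) := ct _ iF'.
apply: filterS2 (near_overlap jp ip) h1 => y [q [jq iq] <-] {y}; rewrite Tq// => -[sF FF hF].
split.
- exact: smooth_at_comp_tau.
- by rewrite /= Tq.
move=> v w; have dF := smooth_at_differentiable sF.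
have E u := diff_comp_tau u dF iq jq.
apply: etrans (congr2 (@ads R) (E v) (E w)) _; apply: (etrans (hF _ _)).
exact: met_trans.
Qed.

Lemma vol_comp_tau F i j p : dom i p -> dom j p ->
  isometric_germ i F (phi i p) ->
  vol (F \o tau j i) (phi j p) = \det (jacobian (tau j i) (phi j p)) * vol F (phi i p).
Proof.
move=> ip jp iF; have [sF _ _] := nbhs_singleton iF.
have dF := smooth_at_differentiable sF.
have dc := smooth_at_differentiable (smooth_at_comp_tau sF ip jp).
apply: etrans (vol_diff dc) _; have E u := diff_comp_tau u dF ip jp.
have E0 : (F \o tau j i) (phi j p) = F (phi i p) by rewrite /tau /= phiK.
apply: etrans (congr2 (@ads R) (congr2 (fun a => a) (congr2 (@cross4 R) E0 (E _)) (E _)) (E _)) _.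
rewrite (cross4_diff iF); congr (\det _ * _).
apply/matrixP => a b; rewrite !mxE; case: a => -[|[|[|]]]//= k; rewrite /lin1_mx !mxE;
  by congr ('d _ _ (delta_mx _ _) _ _); apply: val_inj.
Qed.

(** Preserving the orientation is an open condition, so the model is restricted to where [vol F] is
    positive. The sign persists in the other charts because transition maps have positive
    Jacobian. *)
Lemma model_dev i A B F H p : local_model i A B F H -> dom i p -> A (phi i p) ->
  0 < vol F (phi i p) ->
  exists N B1, is_dev N (F \o phi i) i B1 H /\ N p.
Proof.
move=> mod ip Ap v0; have [oA Ac oB sF sH FA HF iso] := mod.
pose A1 := [set x | A x /\ 0 < vol F x].
have oA1 : open A1.
  rewrite openE => x [Ax vx]; apply: filterI; first exact: open_nbhs_nbhs.
  have nv : nbhs (vol F x) [set r | 0 < r] by exact: lt_nbhsr.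
  have cv := vol_continuous (sF _ Ax).
  exact: nbhs_preimage cv nv.
have oB1 : open (B `&` H @^-1` A1).
  rewrite openE => y [By Hy]; apply: filterI; first exact: open_nbhs_nbhs.
  have nA : nbhs (H y) A1 by exact: open_nbhs_nbhs.
  have cH := smooth_at_continuous (sH _ By).
  exact: nbhs_preimage cH nA.
exists (dom i `&` phi i @^-1` A1), (B `&` H @^-1` A1).
split; last exact: (conj ip (conj Ap v0)).
split.
- exact: open_chart_preimage.
- by move=> q [].
- exact: oB1.
- by move=> y [By _]; exact: sH.
- move=> q [iq [Aq vq]].
  have : (F @` A) (F (phi i q)) by exists (phi i q).
  rewrite FA => -[_ Bq]; split; last exact: HF.
  by split => //=; rewrite HF.
- move=> y yy [By Hy]; have : (@AdS3 R `&` B) y by split.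
  rewrite -FA => -[x Ax E]; have [q iq Eq] := Ac _ Ax.
  have vx : 0 < vol F x by move: Hy => [_]; rewrite -E HF.
  have Nq : A1 (phi i q) by rewrite Eq; exact: (conj Ax vx).
  exists q; first exact: (conj iq Nq).
  by apply: etrans E; rewrite -Eq.
- move=> q j [iq [Aq vq]] jq; have iF := model_germ mod Aq; split.
    exact: isometric_comp_tau.
  have -> : vol ((F \o phi i) \o psi j) (phi j q) =
    \det (jacobian (tau j i) (phi j q)) * vol F (phi i q) by exact: vol_comp_tau.
  by apply: mulr_gt0 => //; exact: trans_oriented.
Qed.

End Development.

(** * Developing unit tangent vectors *)

Section Developing.
Variables (R : realType) (M : lorentz3 R).
Local Notation vec := 'rV[R]_4.
Local Notation E3 := 'rV[R]_3.
Local Notation TT := (E3 * E3)%type.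
Local Notation T1 := (T1t M).
Implicit Types (i j k : idx M) (p : M) (x v : E3) (xi eta : T1).

Lemma TAdS_germ i F xi : dom i (base xi) -> isometric_germ i F (phi i (base xi)) ->
  TAdS (tmap F (coord i xi)).
Proof.
move=> ix iF; have [sF FF hF] := nbhs_singleton iF.
split; first exact: FF.
  by apply: (etrans (hF _ _)); exact: comp_unit.
by rewrite adsC; exact: (ads_diff iF).
Qed.

Lemma tmap_flip S (F : E3 -> vec) (q : TT) : differentiable F q.1 ->
  tmap (flip S \o F) q = (flip S (tmap F q).1, flip S (tmap F q).2).
Proof. by move=> dF; congr pair; exact: (diff_flip S _ dF).2. Qed.

Lemma tmap_tau_id i (F : E3 -> vec) xi : dom i (base xi) -> differentiable F (phi i (base xi)) ->
  tmap (F \o tau i i) (coord i xi) = tmap F (coord i xi).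
Proof.
move=> ix dF.
have E1 : (F \o tau i i) (phi i (base xi)) = F (phi i (base xi)) by rewrite /tau /= phiK.
have E2 := diff_comp_tau (comp xi i) dF ix ix.
have E3 := congr1 ('d F (phi i (base xi))) (diff_tau_id (comp xi i) ix).
exact: (congr2 pair E1 (etrans E2 E3)).
Qed.

(** The sign of [vol] is corrected first, by [reflection]; [time_flip] can then correct the sign of
    [lc] because it preserves [vol]. *)
Lemma exists_dev xi : locally_AdS M -> exists N d i B H,
  [/\ is_dev N d i B H, N (base xi) &
      0 < lc (tmap (d \o psi i) (coord i xi)).1 (tmap (d \o psi i) (coord i xi)).2].
Proof.
move=> hM; have [i [A [B [F [H [ix Ax mod]]]]]] := exists_model (base xi) hM.
have {B F H mod} [B [F [H [mod v0]]]] : exists B F H,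
    local_model i A B F H /\ 0 < vol F (phi i (base xi)).
  have iF := model_germ mod Ax.
  have nv := isometric_vol_neq0 ix iF.
  have [v0|v0|v0] := ltgtP 0 (vol F (phi i (base xi))).
  - exists B, F, H; exact: conj mod v0.
  - exists (reflection (R := R) @^-1` B), (reflection (R := R) \o F), (H \o reflection (R := R)).
    split; first exact: (model_flip (pred1 i3) mod).
    have dF := smooth_at_differentiable (model_smoothF mod Ax).
    by rewrite (vol_reflection dF) oppr_gt0.
  - by move: nv; rewrite -v0 eqxx.
have {B F H mod v0} [B [F [H [mod v0 l0]]]] : exists B F H,
    [/\ local_model i A B F H, 0 < vol F (phi i (base xi)) &
        0 < lc (tmap F (coord i xi)).1 (tmap F (coord i xi)).2].
  have iF := model_germ mod Ax.
  have Q := TAdS_germ ix iF.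
  have nl := lc_neq0 Q.
  case/orP: (lt_total nl) => l0; last by exists B, F, H; exact: And3 mod v0 l0.
  have dF := smooth_at_differentiable (model_smoothF mod Ax).
  exists (time_flip (R := R) @^-1` B), (time_flip (R := R) \o F), (H \o time_flip (R := R)).
  split; first exact: (model_flip (pred2 i1 i2) mod).
    by rewrite (vol_time_flip dF).
  rewrite (@tmap_flip (pred2 i1 i2) F (coord i xi) dF); exact: lc_time_flip Q l0.
have [N [B1 [dev Nx]]] := model_dev mod ix Ax v0.
have dF := smooth_at_differentiable (model_smoothF mod Ax).
have E : tmap ((F \o phi i) \o psi i) (coord i xi) = tmap F (coord i xi).
  exact: tmap_tau_id ix dF.
exists N, (F \o phi i), i, B1, H; split; [exact: dev|exact: Nx|].
by rewrite E.
Qed.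

Lemma is_derive_comp_R (V W : normedModType R) (f : R -> V) (g : V -> W) (t : R) u :
  is_derive t 1 f u -> differentiable g (f t) ->
  is_derive t 1 (fun s => g (f s)) ('d g (f t) u).
Proof.
move=> [fd fu] dg.
have df : differentiable f t by exact/derivable1_diffP.
have dc : differentiable (g \o f) t by exact: differentiable_comp.
split; first exact: diff_derivable.
apply: etrans (deriveE _ dc) _; rewrite -fu (deriveE _ df).
exact: (congr1 (fun h => h 1) (diff_comp df dg)).
Qed.

Section Dev.
Variables (N : set M) (d : M -> vec) (i : idx M) (B : set vec) (H : vec -> E3).
Hypothesis D : is_dev N d i B H.
Local Notation G := (d \o psi i).

Definition devT xi : vec * vec := tmap G (coord i xi).

Let germ p : N p -> isometric_germ i G (phi i p).
Proof. by move=> Np; exact: (dev_germ D Np (dev_dom D Np)).1. Qed.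

Let smoothG p : N p -> smooth_at G (phi i p).
Proof. by move=> Np; have [] := nbhs_singleton (germ Np). Qed.

Lemma devT_TAdS xi : N (base xi) -> TAdS (devT xi).
Proof. by move=> Nx; exact: TAdS_germ (dev_dom D Nx) (germ Nx). Qed.

Lemma smooth_devT xi : N (base xi) -> smooth_T1 devT xi.
Proof.
move=> Nx; exists i, (tmap G); split; first exact: dev_dom D _ Nx.
  have c : {for coord i xi, continuous (fst : TT -> E3)} by exact: cvg_fst.
  have nG : nbhs (coord i xi).1 (smooth_at G).
    by apply: filterS (germ Nx) => y [].
  apply: filterS (nbhs_preimage c nG) => z; exact: smooth_at_tmap.
by apply: filterS (nbT_dom (dev_dom D Nx)).
Qed.

Lemma devT_chart xi j : N (base xi) -> dom j (base xi) ->
  tmap (d \o psi j) (coord j xi) = devT xi.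
Proof.
move=> Nx jx; have ix := dev_dom D Nx.
have dG := smooth_at_differentiable (smoothG Nx).
have djG : differentiable (d \o psi j) (phi j (base xi)).
  have [iG _] := dev_germ D Nx jx; have [sG _ _] := nbhs_singleton iG.
  exact: smooth_at_differentiable.
have dc : differentiable (G \o tau j i) (phi j (base xi)).
  exact/smooth_at_differentiable/(smooth_at_comp_tau (smoothG Nx)).
have E0 : (d \o psi j) (phi j (base xi)) = G (phi i (base xi)) by rewrite /= !phiK.
have E1 : 'd (d \o psi j) (phi j (base xi)) (comp xi j) =
    'd (G \o tau j i) (phi j (base xi)) (comp xi j).
  apply: near_eq_diff => //; apply: filterS (near_overlap jx ix) => y [q [jq iq] <-].
  by rewrite /tau /= !phiK.
have E2 := diff_comp_tau (comp xi j) dG ix jx.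
have E3 := congr1 ('d G (phi i (base xi))) (esym (comp_trans jx ix)).
exact: (congr2 pair E0 (etrans (etrans E1 E2) E3)).
Qed.

Lemma tmap_inv xi : N (base xi) -> tmap H (devT xi) = coord i xi.
Proof.
move=> Nx; have ix := dev_dom D Nx; have [Bx Hx] := dev_inv D Nx.
have dG := smooth_at_differentiable (smoothG Nx).
have E0 : G (phi i (base xi)) = d (base xi) by rewrite /= phiK.
have dH : differentiable H (G (phi i (base xi))).
  by rewrite E0; exact/smooth_at_differentiable/(dev_smooth_inv D).
have E1 : H (G (phi i (base xi))) = phi i (base xi) by rewrite E0 Hx.
have E2 : 'd (H \o G) (phi i (base xi)) (comp xi i) = comp xi i.
  have [_ E] := @is_diff_id R E3 (phi i (base xi)).
  apply: etrans (congr1 (fun h => h (comp xi i)) E).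
  have dHG : differentiable (H \o G) (phi i (base xi)) by exact: differentiable_comp.
  apply: near_eq_diff => //.
  have cp := psi_continuous (ex_intro2 _ _ _ ix (erefl (phi i (base xi)))).
  have nN : nbhs (psi i (phi i (base xi))) N.
    by rewrite phiK//; apply: open_nbhs_nbhs; split => //; exact: dev_open D.
  apply: filterS2 (near_overlap ix ix) (nbhs_preimage cp nN) => y [q [iq _] <-].
  by rewrite /= phiK// => Nq; have [_ ->] := dev_inv D Nq.
have E3' := congr1 (fun h => h (comp xi i)) (diff_comp dG dH).
exact: (congr2 pair E1 (etrans (esym E3') E2)).
Qed.

Lemma devT_inj xi eta : N (base xi) -> N (base eta) -> devT xi = devT eta -> xi = eta.
Proof.
move=> Nx Ne E; apply: (@coord_inj _ _ i); [exact: dev_dom D _ Nx|exact: dev_dom D _ Ne|].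
by rewrite -(tmap_inv Nx) -(tmap_inv Ne) E.
Qed.

(** [G o H] is the identity on AdS_3 only, not on an open set of R^4, so the identity is
    differentiated along a curve of AdS_3 with velocity [q.2]: the first component of [rot t q]. *)
Lemma diff_inv (q : vec * vec) : TAdS q -> B q.1 -> exists p,
  [/\ N p, d p = q.1, H q.1 = phi i p & 'd G (phi i p) ('d H (q.1) q.2) = q.2].
Proof.
move=> Q Bq; have [q1 _ _] := Q; have [p Np dp] := dev_surj D q1 Bq.
have Hp : H q.1 = phi i p by rewrite -dp; exact: (dev_inv D Np).2.
exists p; split => //.
pose y (t : R) := (rot t q).1.
have dy : is_derive (0 : R) 1 y q.2.
  have h1 := is_derive_scale (is_derive_cos (0 : R)) (is_derive_cst q.1 (0 : R) 1).
  have h2 := is_derive_scale (is_derive_sin (0 : R)) (is_derive_cst q.2 (0 : R) 1).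
  have := is_deriveD h1 h2.
  by rewrite sin0 cos0 oppr0 !scale0r !scaler0 scale1r !addr0 add0r.
have y0 : y 0 = q.1 by rewrite /y rot0.
have dH : differentiable H (y 0).
  by rewrite y0; exact/smooth_at_differentiable/(dev_smooth_inv D).
have dHy := is_derive_comp_R dy dH.
have dG : differentiable G (H (y 0)) by rewrite y0 Hp; exact/smooth_at_differentiable/smoothG.
have dGHy := is_derive_comp_R dHy dG.
rewrite y0 Hp in dGHy.
have [_ <-] := dGHy; have [_ <-] := dy; apply: near_eq_derive.
have cy : {for (0 : R), continuous y} by apply/differentiable_continuous/derivable1_diffP; case: dy.
have nB : nbhs (y 0) B.
  by rewrite y0; apply: open_nbhs_nbhs; split => //; exact: dev_openB D.
apply: filterS (nbhs_preimage cy nB) => t Bt.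
have [q1t _ _] := TAdS_rot t Q; have [pt Npt dpt] := dev_surj D q1t Bt.
have [_ Ht] := dev_inv D Npt.
have Hyt : H (y t) = phi i pt by rewrite -Ht dpt.
by rewrite Hyt /= phiK ?dpt//; exact: dev_dom D _ Npt.
Qed.

End Dev.
End Developing.

(** * Developing the invariant forms and the geodesics *)

Section DevDynamics.
Variables (R : realType) (M : lorentz3 R).
Local Notation vec := 'rV[R]_4.
Local Notation E3 := 'rV[R]_3.
Local Notation TT := (E3 * E3)%type.
Local Notation T1 := (T1t M).
Variables (N : set M) (d : M -> vec) (i : idx M) (B : set vec) (H : vec -> E3).
Hypothesis D : is_dev N d i B H.
Implicit Types (j k : idx M) (p : M) (x v : E3) (xi eta : T1).
Local Notation dev := (@devT R M d i).

Lemma continuous_sum3 (T : topologicalType) n (f : 'I_n -> T -> R) (t : T) :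
  (forall a, {for t, continuous (f a)}) -> {for t, continuous (fun u => \sum_a f a u)}.
Proof.
move=> cf; elim: n f cf => [|n IH] f cf.
  have -> : (fun u => \sum_(a < 0) f a u) = fun=> 0 by apply/funext => u; rewrite big_ord0.
  exact: cst_continuous.
have -> : (fun u => \sum_(a < n.+1) f a u) =
    fun u => f ord0 u + \sum_(a < n) f (lift ord0 a) u.
  by apply/funext => u; rewrite big_ord_recl.
by apply: cvgD; [exact: cf|apply: IH => a; exact: cf].
Qed.

Lemma near_future xi : dom i (base xi) -> \forall z \near coord i xi,
  form (met i z.1) z.2 (tfield i z.1) < 0.
Proof.
move=> ix; have cx : (phi i @` dom i) (coord i xi).1 by exists (base xi).
have cfst : {for coord i xi, continuous (fst : TT -> E3)} by exact: cvg_fst.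
have csnd : {for coord i xi, continuous (snd : TT -> E3)} by exact: cvg_snd.
have cm : {for (coord i xi).1, continuous (met i)}.
  have sm : smooth (phi i @` dom i) (met i) := @met_smooth R M i.
  exact: (sm 0%N).
have ct := tfield_continuous cx.
have cc : {for coord i xi, continuous (fun z : TT => form (met i z.1) z.2 (tfield i z.1))}.
  have -> : (fun z : TT => form (met i z.1) z.2 (tfield i z.1)) =
      fun z => \sum_a \sum_b z.2 0 a * met i z.1 a b * tfield i z.1 0 b.
    by apply/funext => z; rewrite form_sumr.
  have coordc m n a b (f : TT -> 'M[R]_(m, n)) : {for coord i xi, continuous f} ->
      {for coord i xi, continuous (fun z => f z a b)}.
    move=> cf; apply: (@continuous_comp _ _ _ f (fun A : 'M[R]_(m, n) => A a b)) => //.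
    exact: coord_continuous.
  apply: continuous_sum3 => a; apply: continuous_sum3 => b.
  apply: cvgM; first apply: cvgM.
  - exact: (coordc _ _ 0 a snd).
  - apply: (coordc _ _ a b (fun z => met i z.1)); exact: (continuous_comp cfst cm).
  - apply: (coordc _ _ 0 b (fun z => tfield i z.1)); exact: (continuous_comp cfst ct).
have n0 : nbhs (form (met i (coord i xi).1) (coord i xi).2 (tfield i (coord i xi).1))
    [set r | r < 0] by apply: lt_nbhsl; exact: comp_future.
exact: nbhs_preimage cc n0.
Qed.

(** The preimage of [q] is [tmap H q]: it develops to [q] by [diff_inv], is unit by the isometry,
    and is future-directed near [xi] because that is an open condition. *)
Lemma dev_near_surj xi P : N (base xi) -> nbT xi P -> \forall q \near dev xi,
  TAdS q -> exists eta, [/\ N (base eta), dev eta = q & P eta].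
Proof.
move=> Nx nP; have ix := dev_dom D Nx; have [Bx Hx] := dev_inv D Nx.
have Bq0 : B (dev xi).1 by rewrite /devT /= phiK.
have cfst : {for dev xi, continuous (fst : vec * vec -> vec)} by exact: cvg_fst.
have nB : nbhs (dev xi).1 B by apply: open_nbhs_nbhs; split => //; exact: dev_openB D.
have sK : smooth_at (tmap H) (dev xi) by apply: smooth_at_tmap; exact: dev_smooth_inv D _ Bq0.
have cK := smooth_at_continuous sK.
have h1 := nbT_coordP ix nP; have h2 := near_future ix.
rewrite -(tmap_inv D Nx) in h1 h2.
have n1 := nbhs_preimage cfst nB.
have n2 := nbhs_preimage cK h1.
have n3 := nbhs_preimage cK h2.
apply: filterS3 n1 n2 n3 => q Bq Pq fq Q.
have [p [Np dp Hp Gq]] := diff_inv D Q Bq.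
have [_ _ q12] := Q; have [_ q2 _] := Q.
have ip := dev_dom D Np.
have [eta ie Ee] : exists2 eta : T1, dom i (base eta) & coord i eta = tmap H q.
  apply: make_T1; [by exists p => //; rewrite Hp| |exact: fq].
  have [iG _] := dev_germ D Np ip; have [_ _ hG] := nbhs_singleton iG.
  by rewrite Hp -hG; apply: etrans q2; exact: (congr2 (@ads R) Gq Gq).
have bp : base eta = p.
  by rewrite -(phiK ie) -(phiK ip) -Hp; congr (psi i _); exact: (congr1 fst Ee).
exists eta; split.
- by rewrite bp.
- have E0 : (d \o psi i) (H q.1) = q.1 by rewrite Hp /= phiK.
  have E1 : 'd (d \o psi i) (H q.1) ('d H (q.1) q.2) = q.2 by rewrite Hp.
  rewrite /devT Ee; transitivity (q.1, q.2); last by rewrite -surjective_pairing.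
  exact: (congr2 pair E0 E1).
- exact: Pq eta ie Ee.
Qed.

Lemma M_dev (X : R -> T1) (t : R) j : smooth_curve X t -> N (base (X t)) ->
  dom j (base (X t)) -> exists dy dw, let q := dev (X t) in
  [/\ is_derive t 1 (fun s => dev (X s)) (dy, dw),
      Ml j (coord j (X t)) (velocity j X t) = ads (Pvec 1 q.1 q.2 dy dw) (Pvec 1 q.1 q.2 dy dw) &
      Mr j (coord j (X t)) (velocity j X t) =
        ads (Pvec (-1) q.1 q.2 dy dw) (Pvec (-1) q.1 q.2 dy dw)].
Proof.
move=> sX Nt jt.
have Hn := smooth_curve_coord sX jt.
have [_ sc] := nbhs_singleton Hn.
have [iG v0] := dev_germ D Nt jt.
have [sG _ hG] := nbhs_singleton iG.
have dX : is_derive t 1 (fun s => coord j (X s)) ((velocity j X t).1, (velocity j X t).2).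
  rewrite -surjective_pairing /velocity derive1E.
  by apply/derivableP/diff_derivable/smooth_at_differentiable.
have dd := is_derive_tmap (X := fun s => coord j (X s)) sG dX.
set dy := 'd _ _ _ in dd; set dw := dvel _ _ _ _ _ in dd.
have nN : nbT (X t) (fun eta => N (base eta)).
  have cp := psi_continuous (ex_intro2 _ _ _ jt (erefl (phi j (base (X t))))).
  have nN0 : nbhs (psi j (phi j (base (X t)))) N.
    by rewrite phiK//; apply: open_nbhs_nbhs; split => //; exact: dev_open D.
  have cfst : {for coord j (X t), continuous (fst : TT -> E3)} by exact: cvg_fst.
  have n1 := nbhs_preimage cfst (nbhs_preimage cp nN0).
  by apply: filterS (nbT_coord jt n1) => eta [je]; rewrite /= phiK.
have E : \forall s \near t, tmap (d \o psi j) (coord j (X s)) = dev (X s).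
  apply: filterS2 Hn (smooth_curve_near sX nN) => s [js _] Ns.
  by have := devT_chart D Ns js.
have Et := devT_chart D Nt jt.
have sym := met_symP jt.
have key e (P : E3) : 'd (d \o psi j) (phi j (base (X t))) P =
    Pvec e (d (psi j (phi j (base (X t))))) ('d (d \o psi j) (phi j (base (X t))) (comp (X t) j)) dy dw ->
    form (met j (phi j (base (X t)))) P P =
    ads (Pvec e (dev (X t)).1 (dev (X t)).2 dy dw) (Pvec e (dev (X t)).1 (dev (X t)).2 dy dw).
  by move=> E1; rewrite -Et; apply: etrans (esym (hG P P)) _; exact: (congr2 (@ads R) E1 E1).
exists dy, dw; split.
- exact: near_eq_is_derive E dd.
- by apply: key; exact: (diff_Pl iG sym v0).
- by apply: key; exact: (diff_Pr iG sym v0).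
Qed.

Lemma nbT_N xi : N (base xi) -> nbT xi (fun eta => N (base eta)).
Proof.
move=> Nx; have ix := dev_dom D Nx.
have cp := psi_continuous (ex_intro2 _ _ _ ix (erefl (phi i (base xi)))).
have nN0 : nbhs (psi i (phi i (base xi))) N.
  by rewrite phiK//; apply: open_nbhs_nbhs; split => //; exact: dev_open D.
have cfst : {for coord i xi, continuous (fst : TT -> E3)} by exact: cvg_fst.
have n1 := nbhs_preimage cfst (nbhs_preimage cp nN0).
by apply: filterS (nbT_coord ix n1) => eta [je]; rewrite /= phiK.
Qed.

Lemma M_hyp (X : R -> T1) (t : R) j : smooth_curve X t -> N (base (X t)) ->
  0 < lc (dev (X t)).1 (dev (X t)).2 -> dom j (base (X t)) ->
  let u := 'D_1 (fun s => Phi (dev (X s))) t in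
  Ml j (coord j (X t)) (velocity j X t) = hyp (Phi (dev (X t))).1 u.1 /\
  Mr j (coord j (X t)) (velocity j X t) = hyp (Phi (dev (X t))).2 u.2.
Proof.
move=> sX Nt l0 jt u; have [dy [dw [dd EL ER]]] := M_dev sX Nt jt.
have Qn : \forall s \near t, TAdS (dev (X s)).
  apply: filterS (smooth_curve_near sX (nbT_N Nt)) => s Ns; by have := devT_TAdS D Ns.
have [h1 h2] := @hyp_Phi R (fun s => dev (X s)) t dy dw dd Qn l0.
by split; [exact: etrans EL (esym h1)|exact: etrans ER (esym h2)].
Qed.

Lemma geodesic_nbT (I : set R) (c : R -> T1) t P : geodesic I c -> I t -> nbT (c t) P ->
  \forall s \near t, P (c s).
Proof.
move=> gc It nP; have [j jt] := dom_cover (base (c t)).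
have [nj dj _ _] := gc t j It jt.
have cc : {for t, continuous (fun s => coord j (c s))}.
  exact/differentiable_continuous/derivable1_diffP.
have nPz := nbhs_preimage cc (nbT_coordP jt nP).
by apply: filterS2 nj nPz => s js; apply.
Qed.

(** By the Gauss formula a geodesic develops to a curve whose second derivative is normal to AdS_3.
    This is y' = w, w' = -y, and [rot_flow] integrates it. *)
Lemma geodesic_rot (I : set R) (c : R -> T1) t : open I -> geodesic I c -> I t ->
  N (base (c t)) -> exists2 e : R, 0 < e & forall s, `|s - t| < e ->
    [/\ I s, N (base (c s)) & dev (c s) = rot (s - t) (dev (c t))].
Proof.
move=> oI gc It Nt.
have h1 := geodesic_nbT gc It (nbT_N Nt).
have h2 : \forall s \near t, I s by exact: open_nbhs_nbhs.
have h3 : \forall s \near t, I s /\ N (base (c s)) by exact: filterI h2 h1.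
have [e /= e0 He] := (nbhs_ballP _ _).1 h3.
have Hs s : `|s - t| < e -> I s /\ N (base (c s)).
  by move=> se; apply: He; rewrite -ball_normE /= distrC.
exists e => // s se; have [Is Ns] := Hs s se; split => //.
apply: (@rot_flow R (fun s => dev (c s)) t e e0 _ s se) => r re {s se Is Ns}; have [Ir Nr] := Hs r re.
have ir := dev_dom D Nr.
have [ni di v1 v2] := gc r i Ir ir.
have [iG v0] := dev_germ D Nr ir; have [sG _ _] := nbhs_singleton iG.
have dX : is_derive r 1 (fun s => coord i (c s)) ((velocity i c r).1, (velocity i c r).2).
  by rewrite -surjective_pairing /velocity derive1E; exact/derivableP.
have dd := is_derive_tmap (X := fun s => coord i (c s)) sG dX.
have Qn : \forall s \near r, TAdS (dev (c s)).
  apply: filterS (geodesic_nbT gc Ir (nbT_N Nr)) => s Ns; by have := devT_TAdS D Ns.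
have [_ _ t3] := TAdS_tangent dd Qn.
have nab := diff_nablaV iG (met_symP ir) v0 (comp (c r) i) (velocity i c r).1 (velocity i c r).2.
have [_ w2 _] := devT_TAdS D Nr.
rewrite v2 linear0 in nab.
set dw := dvel _ _ _ _ _ in dd t3 nab.
have wE : 'd (d \o psi i) ((coord i (c r)).1) (velocity i c r).1 = (dev (c r)).2.
  by rewrite v1.
rewrite wE in dd t3.
(* Differentiating [ads y w = 0] with y' = w and [ads w w = -1] fixes the normal component of the
   second derivative. *)
have yw : ads dw (dev (c r)).1 = 1.
  by rewrite adsC; apply/eqP; rewrite -subr_eq0; apply/eqP; rewrite -t3 w2; ring.
have dwE : dw = - (dev (c r)).1.
  by apply/eqP; rewrite -addr_eq0; apply/eqP; rewrite [RHS]nab; congr (_ + _);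
    rewrite -[LHS]scale1r -yw.
by rewrite -dwE.
Qed.

Lemma diff_eq0 p j x : N p -> dom j p -> 'd (d \o psi j) (phi j p) x = 0 -> x = 0.
Proof.
move=> Np jp E; have [iG v0] := dev_germ D Np jp.
have [_ _ hG] := nbhs_singleton iG.
have xg : x *m met j (phi j p) = 0.
  apply/rowP => a; have := hG x (delta_mx 0 a); rewrite E.
  rewrite -(scale0r (0 : vec)) adsZl mul0r /form trmx_delta -colE !mxE => <-.
  by [].
by rewrite -[x]mulmx1 -(mulmxV (met_unit iG v0)) mulmxA xg mul0mx.
Qed.

(** [diff_eq0] pulls the equations of a rotation back from the model: y' = w identifies the
    velocity, and w' = -y has no tangential part, which is the geodesic equation. *)
Lemma rot_geodesic (I : set R) (c : R -> T1) (q : vec * vec) : open I ->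
  (forall s, I s -> N (base (c s)) /\ dev (c s) = rot s q) -> geodesic I c.
Proof.
move=> oI H1 t j It jt; have [Nt Et] := H1 t It.
have it := dev_dom D Nt.
have nI : \forall s \near t, I s by exact: open_nbhs_nbhs.
have sc : smooth_curve c t.
  apply: (curve_germ it); apply: filterS (near_join nI) => s nIs.
  have [Ns Es] := H1 s (nbhs_singleton nIs); split; first exact: dev_dom D _ Ns.
  apply: (@smooth_at_ext _ _ _ (fun s => tmap H (rot s q))).
    by apply: filterS nIs => r Ir; have [Nr Er] := H1 r Ir; rewrite -Er (tmap_inv D Nr).
  apply: (@smooth_at_comp _ _ _ _ (fun s => rot s q) (tmap H)).
    apply: (@smooth_at_comp _ _ _ _ (fun s => (s, q)) (fun z : R * (vec * vec) => rot z.1 z.2)).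
      by apply: smooth_at_pair; [exact: smooth_at_id|exact: smooth_at_cst].
    exact: smooth_at_rot.
  rewrite -Es; apply: smooth_at_tmap; apply: (dev_smooth_inv D).
  by have [Bs _] := dev_inv D Ns; rewrite /devT /= phiK//; exact: dev_dom D _ Ns.
have Hn := smooth_curve_coord sc jt.
have [iG v0] := dev_germ D Nt jt; have [sG _ _] := nbhs_singleton iG.
have [_ scj] := nbhs_singleton Hn.
have dj : derivable (fun s => coord j (c s)) t 1.
  exact/diff_derivable/smooth_at_differentiable.
have dX : is_derive t 1 (fun s => coord j (c s)) ((velocity j c t).1, (velocity j c t).2).
  by rewrite -surjective_pairing /velocity derive1E; exact/derivableP.
have dd := is_derive_tmap (X := fun s => coord j (c s)) sG dX.
have dr : is_derive t 1 (fun s => tmap (d \o psi j) (coord j (c s)))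
    ((rot t q).2, - (rot t q).1).
  apply: near_eq_is_derive (is_derive_rot t q).
  apply: filterS2 nI Hn => s Is [js _]; have [Ns Es] := H1 s Is.
  by rewrite -Es; have := devT_chart D Ns js.
have [E1 E2] : ('d (d \o psi j) ((coord j (c t)).1) (velocity j c t).1,
    dvel (d \o psi j) (coord j (c t)).1 (coord j (c t)).2 (velocity j c t).1 (velocity j c t).2)
    = ((rot t q).2, - (rot t q).1).
  by case: dd => _ <-; case: dr.
have Ec := devT_chart D Nt jt; rewrite Et in Ec.
have Ec1 : d (psi j (phi j (base (c t)))) = (rot t q).1 := congr1 fst Ec.
have Ec2 : 'd (d \o psi j) (phi j (base (c t))) (comp (c t) j) = (rot t q).2 := congr1 snd Ec.
have Qt : TAdS (rot t q) by have := devT_TAdS D Nt; rewrite Et.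
have [y2 _ _] := Qt.
split.
- by apply: filterS Hn => s [].
- exact: dj.
- apply/eqP; rewrite -subr_eq0; apply/eqP; apply: (diff_eq0 Nt jt).
  by rewrite linearB /= Ec2; apply/eqP; rewrite subr_eq0; apply/eqP.
- apply: (diff_eq0 Nt jt).
  apply: etrans (diff_nablaV iG (met_symP jt) v0 _ _ _) _.
  rewrite /= in E2; rewrite E2 /= Ec1 adsNl y2 opprK scale1r.
  exact: addNr.
Qed.

(** Local flow for a time [e] uniform in [eta]: vectors rotated by a small angle stay near [dev xi],
    where [dev_near_surj] lifts them into [U]. *)
Lemma flow_box xi (U : set T1) : N (base xi) -> T1_open U -> U xi ->
  exists2 e : R, 0 < e & forall eta, N (base eta) -> `|dev xi - dev eta| < e ->
    forall t : R, `|t| < e -> exists eta',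
      [/\ N (base eta'), dev eta' = rot t (dev eta) & flow_equiv U eta eta'].
Proof.
move=> Nx oU Ux.
have nU := (T1_openP U).1 oU _ Ux.
have h := dev_near_surj Nx nU.
have cr : {for ((0 : R), dev xi), continuous (fun z : R * (vec * vec) => rot z.1 z.2)}.
  exact: smooth_at_continuous (smooth_at_rot _).
have nr : nbhs (rot 0 (dev xi)) [set q | TAdS q ->
    exists eta, [/\ N (base eta), dev eta = q & U eta]] by rewrite rot0.
have [e /= e0 He] := (nbhs_ballP _ _).1 (nbhs_preimage cr nr).
exists e => // eta Ne ne.
have Qe := devT_TAdS D Ne.
have good s : `|s| < e -> exists eta', [/\ N (base eta'), dev eta' = rot s (dev eta) & U eta'].
  move=> se; apply: (He (s, dev eta)); last exact: TAdS_rot.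
  by split => /=; rewrite -ball_normE /= ?sub0r ?normrN.
have ex (s : R) : exists zeta : T1, `|s| < e ->
    [/\ N (base zeta), dev zeta = rot s (dev eta) & U zeta].
  have [/good[zeta zP]|se] := pselect (`|s| < e); first by exists zeta.
  by exists eta => /se.
have [c cP] := choice ex.
move=> t te; exists (c t); have [Nt Et Ut] := cP t te; split => //.
have z0 : `|(0 : R)| < e by rewrite normr0.
exists [set s : R | `|s| < e], c, 0, t; split; split => //.
- have -> : [set s : R | `|s| < e] = ball (0 : R) e.
    by apply/seteqP; split=> s; rewrite -ball_normE /= sub0r normrN.
  exact: ball_open.
- move=> a b ae be s /andP[as_ sb]; move: ae be; rewrite /= !ltr_norml.
  move=> /andP[ae _] /andP[_ be]; apply/andP; split.
    exact: lt_le_trans ae as_.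
  exact: le_lt_trans sb be.
- apply: (@rot_geodesic _ c (dev eta)).
    have -> : [set s : R | `|s| < e] = ball (0 : R) e.
      by apply/seteqP; split=> s; rewrite -ball_normE /= sub0r normrN.
    exact: ball_open.
  by move=> s /cP[].
- by move=> _ [s /cP[_ _ Us] <-].
- have [N0 E0 _] := cP 0 z0.
  by apply: (devT_inj D N0 Ne); rewrite E0 rot0.
Qed.

End DevDynamics.

(** * Transport along the geodesic flow *)

(** Connectedness of an interval, for a property that is locally constant on it. The equivalence in
    the hypothesis combines the open and the closed condition. *)
Lemma interval_propagation (R : realType) (I : set R) (P : R -> Prop) (a b : R) :
  is_interval I -> (forall t, I t -> \forall s \near t, I s -> (P s <-> P t)) ->
  I a -> I b -> P a -> P b.
Proof.
move=> iI loc.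
suff main (Q : R -> Prop) (a' b' : R) : (forall t, I t -> \forall s \near t, I s -> (Q s <-> Q t)) ->
    a' <= b' -> I a' -> I b' -> Q a' -> Q b'.
  move=> Ia Ib Pa; have [ab|/ltW ba] := leP a b; first exact: (main P a b).
  (* When [b] lies before [a], the negation of [P] is propagated from [b] to [a]. *)
  apply: contrapT => nPb; apply: (main (fun s => ~ P s) b a) Pa => //.
  by move=> t It; apply: filterS (loc t It) => s H Is; have [h1 h2] := H Is;
    split=> h h'; apply: h; [exact: h2|exact: h1].
move=> {P a b} {}loc ab Ia Ib Qa; rename a' into a, b' into b.
have Iab s : a <= s <= b -> I s by move=> sab; apply: (iI a b).
(* [Q] holds at [sup S] and then on the part of the segment below [sup S + e]; hence [sup S + e]
   exceeds [b], for otherwise [S] would contain [sup S + e / 2]. *)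
pose S := [set s | a <= s <= b /\ forall r, a <= r <= s -> Q r].
have Sa : S a.
  split; first by rewrite lexx.
  by move=> r; rewrite -eq_le => /eqP <-.
have hS : has_sup S by split; [exists a|exists b => s [/andP[]]].
have aS : a <= sup S by apply: ub_le_sup => //; case: hS.
have Sb : sup S <= b by apply: ge_sup; [exists a|move=> s [/andP[]]].
have Isup : I (sup S) by apply: Iab; rewrite aS.
have [e /= e0 He] := (nbhs_ballP _ _).1 (loc _ Isup).
have He' s : `|sup S - s| < e -> I s -> (Q s <-> Q (sup S)).
  by move=> se; apply: He; rewrite -ball_normE.
have [s0 [s0ab Qs0] s0e] := sup_adherent e0 hS.
have s0S : s0 <= sup S by apply: ub_le_sup; [case: hS|split].
have Qsup : Q (sup S).
  apply: (He' s0 _ _).1; first by rewrite ger0_norm ?subr_ge0//; lra.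
    exact: Iab.
  by apply: Qs0; move: s0ab => /andP[-> _]; rewrite lexx.
have Qr r : a <= r <= b -> r < sup S + e -> Q r.
  move=> /andP[ar rb] re; have [rs|rs] := leP r s0; first by apply: Qs0; rewrite ar.
  apply: (He' r _ _).2 Qsup; last by apply: Iab; rewrite ar.
  by rewrite ltr_norml; apply/andP; split; lra.
have [be|be] := ltP b (sup S + e); first by apply: Qr => //; rewrite ab lexx.
have : S (sup S + e / 2).
  split; first by apply/andP; split; lra.
  move=> r /andP[ar re]; apply: Qr; last by lra.
  by apply/andP; split; lra.
move=> /(ub_le_sup (ex_intro _ b (fun s (Ss : S s) => (andP Ss.1).2))).
by move=> h; exfalso; lra.
Qed.

Section Flow.
Variables (R : realType) (M : lorentz3 R) (hM : locally_AdS M).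
Local Notation T1 := (T1t M).
Implicit Types (i j k : idx M) (xi eta zeta : T1) (U : set T1).

Lemma nbT_base xi (A : set M) : nbhs (base xi) A -> nbT xi (fun eta => A (base eta)).
Proof.
move=> nA; have [i ix] := dom_cover (base xi).
have cp := psi_continuous (ex_intro2 _ _ _ ix (erefl (phi i (base xi)))).
have nA' : nbhs (psi i (phi i (base xi))) A by rewrite phiK.
have cfst : {for coord i xi, continuous (fst : 'rV[R]_3 * 'rV[R]_3 -> 'rV[R]_3)}.
  exact: cvg_fst.
have n1 := nbhs_preimage cfst (nbhs_preimage cp nA').
by apply: filterS (nbT_coord ix n1) => eta [je]; rewrite /= phiK.
Qed.

Lemma T1_separated xi eta : xi <> eta -> exists P Q,
  [/\ nbT xi P, nbT eta Q & forall zeta, P zeta -> Q zeta -> False].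
Proof.
move=> ne; have [Eb|nb] := pselect (base xi = base eta); last first.
  have := @pt_hausdorff R M; rewrite open_hausdorff.
  move=> /(_ (base xi) (base eta)) [|[A B] /= [/set_mem Ax /set_mem Be] [oA oB /eqP AB]].
    by apply/eqP.
  exists (fun z => A (base z)), (fun z => B (base z)); split.
  - by apply: nbT_base; exact: open_nbhs_nbhs.
  - by apply: nbT_base; exact: open_nbhs_nbhs.
  - move=> z Az Bz; have : (A `&` B) (base z) by split.
    by rewrite AB.
have [i ix] := dom_cover (base xi).
have ie : dom i (base eta) by rewrite -Eb.
have nc : coord i xi != coord i eta by apply/eqP => /(coord_inj ix ie).
have := @norm_hausdorff R ('rV[R]_3 * 'rV[R]_3)%type; rewrite open_hausdorff.
move=> /(_ _ _ nc) [[A B] /= [/set_mem Ax /set_mem Be] [oA oB /eqP AB]].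
exists (fun z => dom i (base z) /\ A (coord i z)), (fun z => dom i (base z) /\ B (coord i z)).
split.
- by apply: nbT_coord => //; exact: open_nbhs_nbhs.
- by apply: nbT_coord => //; exact: open_nbhs_nbhs.
- move=> z [_ Az] [_ Bz]; have : (A `&` B) (coord i z) by split.
  by rewrite AB.
Qed.

(** The times of coincidence form an open set, because both curves develop to the same rotation, and
    a closed one, because T^{1,t}M is Hausdorff; the common domain is an interval. *)
Lemma geodesic_unique (I J : set R) (c c' : R -> T1) a b :
  open I -> open J -> is_interval I -> is_interval J -> geodesic I c -> geodesic J c' ->
  I a -> J a -> c a = c' a -> I b -> J b -> c b = c' b.
Proof.
move=> oI oJ iI iJ gc gc' Ia Ja E Ib Jb.
apply: (@interval_propagation R (I `&` J) (fun s => c s = c' s) a b) => //.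
  move=> x y [Ix Jx] [Iy Jy] z xyz; split; [exact: (iI x y)|exact: (iJ x y)].
move=> t [It Jt]; have [Et|nE] := pselect (c t = c' t).
  have [N [d [i [B [H [D Nt _]]]]]] := exists_dev (c t) hM.
  have Nt' : N (base (c' t)) by rewrite -Et.
  have [e e0 He] := geodesic_rot D oI gc It Nt.
  have [e' e'0 He'] := geodesic_rot D oJ gc' Jt Nt'.
  have n1 : \forall s \near t, `|s - t| < e.
    by apply/nbhs_ballP; exists e => // s; rewrite -ball_normE /= distrC.
  have n2 : \forall s \near t, `|s - t| < e'.
    by apply/nbhs_ballP; exists e' => // s; rewrite -ball_normE /= distrC.
  apply: filterS2 n1 n2 => s /He[_ Ns Es] /He'[_ Ns' Es'] _.
  split=> // _; apply: (devT_inj D Ns Ns'); by rewrite Es Es' Et.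
have [P [Q [nP nQ PQ]]] := T1_separated nE.
have h1 := geodesic_nbT gc It nP; have h2 := geodesic_nbT gc' Jt nQ.
apply: filterS2 h1 h2 => s Ps Qs _; split=> // Es; exfalso.
by apply: (PQ (c s)) => //; rewrite Es.
Qed.

Lemma geodesic_shift (I : set R) (c : R -> T1) (r : R) :
  geodesic I c -> geodesic [set s | I (s + r)] (fun s => c (s + r)).
Proof.
move=> gc t i It it; have [h1 h2 h3 h4] := gc (t + r) i It it.
have df : differentiable (fun s => coord i (c s)) (t + r) by exact/derivable1_diffP.
have [ds Es] := @derive_shift_arg R R _ (fun s => coord i (c s)) r t 1 df.
have Ev : velocity i (fun s => c (s + r)) t = velocity i c (t + r).
  by rewrite /velocity (derive1E (fun s => coord i (c (s + r)))) (derive1E (fun s => coord i (c s))).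
have cs : {for t, continuous (fun s : R => s + r)}.
  by apply: (@cvgD R R _ (nbhs t) _ id (fun=> r)); [exact: cvg_id|exact: cvg_cst].
rewrite Ev.
split; [exact: (nbhs_preimage cs h1)|exact/derivable1_diffP|exact: h3|exact: h4].
Qed.

Lemma geodesic_local (I : set R) (c : R -> T1) :
  (forall t, I t -> exists J c', [/\ open J, J t, geodesic J c' & forall s, J s -> c s = c' s]) ->
  geodesic I c.
Proof.
move=> H t i It; have [J [c' [oJ Jt gc' E]]] := H t It; rewrite (E t Jt) => it.
have [h1 h2 h3 h4] := gc' t i Jt it.
have nJ : \forall s \near t, J s by exact: open_nbhs_nbhs.
have nE : \forall s \near t, coord i (c' s) = coord i (c s).
  by apply: filterS nJ => s /E ->.
have Ev : velocity i c t = velocity i c' t.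
  rewrite /velocity (derive1E (fun s => coord i (c s))) (derive1E (fun s => coord i (c' s))).
  exact/esym/near_eq_derive.
rewrite Ev; split; [|exact: near_eq_derivable nE h2|exact: h3|exact: h4].
by apply: filterS2 nJ h1 => s /E ->.
Qed.

Lemma flow_equiv_sub U xi eta : flow_equiv U xi eta -> U xi /\ U eta.
Proof.
move=> [I [c [a [b [[oI iI Ia Ib] [gc cU <- <-]]]]]].
by split; apply: cU; [exists a|exists b].
Qed.

Lemma flow_equiv_refl U xi : T1_open U -> U xi -> flow_equiv U xi xi.
Proof.
move=> oU Ux; have [N [d [i [B [H [D Nx _]]]]]] := exists_dev xi hM.
have [e e0 He] := flow_box D Nx oU Ux.
have [||eta [Ne Ee fe]] := He xi Nx _ 0 _; rewrite ?subrr ?normr0//.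
by rewrite -{2}(devT_inj D Ne Nx _)// Ee rot0.
Qed.

Lemma flow_equiv_sym U xi eta : flow_equiv U xi eta -> flow_equiv U eta xi.
Proof.
by move=> [I [c [a [b [[oI iI Ia Ib] [gc cU Ea Eb]]]]]]; exists I, c, b, a.
Qed.

(** The second curve is shifted in time so as to meet the first at time [b]. By [geodesic_unique]
    they agree on the whole overlap, so their union [g] is a geodesic. *)
Lemma flow_equiv_trans U xi eta zeta :
  flow_equiv U xi eta -> flow_equiv U eta zeta -> flow_equiv U xi zeta.
Proof.
move=> [I [c [a [b [[oI iI Ia Ib] [gc cU Ea Eb]]]]]].
move=> [J' [c'' [a' [b' [[oJ' iJ' Ja' Jb'] [gc'' cU'' Ea' Eb']]]]]].
pose r := a' - b; pose J := [set s | J' (s + r)]; pose c' s := c'' (s + r).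
have gc' : geodesic J c' by exact: geodesic_shift.
have oJ : open J.
  apply: (@open_comp _ _ (fun s : R => s + r)) oJ' => s _.
  by apply: (@cvgD R R _ (nbhs s) _ id (fun=> r)); [exact: cvg_id|exact: cvg_cst].
have iJ : is_interval J.
  by move=> x y Jx Jy z /andP[xz zy]; apply: (iJ' (x + r) (y + r)) => //; rewrite !lerD2r xz.
have Jb : J b by rewrite /J /= /r addrC subrK.
have cb : c b = c' b by rewrite Eb -Ea' /c' /r addrC subrK.
have Jd : J (b' - r) by rewrite /J /= subrK.
pose g s := if pselect (I s) then c s else c' s.
have gI s : I s -> g s = c s by rewrite /g; case: pselect.
have gJ s : J s -> g s = c' s.
  rewrite /g; case: pselect => // Is Js.
  exact: (geodesic_unique oI oJ iI iJ gc gc' Ib Jb cb Is Js).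
exists (I `|` J), g, a, (b' - r); split.
  split; [exact: openU| |by left|by right].
  move=> x y Ix Iy z /andP[xz zy].
  have [zb|/ltW bz] := leP z b.
    case: Ix => [Ix|Jx]; [left; apply: (iI x b)|right; apply: (iJ x b)] => //;
    by rewrite xz.
  by case: Iy => [Iy|Jy]; [left; apply: (iI b y)|right; apply: (iJ b y)] => //; rewrite bz.
split.
- apply: geodesic_local => t [It|Jt]; first by exists I, c.
  by exists J, c'.
- move=> _ [s [Is|Js] <-]; first by rewrite gI//; apply: cU; exists s.
  by rewrite gJ//; apply: cU''; exists (s + r).
- by rewrite gI.
- by rewrite gJ// /c' subrK.
Qed.

Lemma leafP U xi eta : T1_open U -> U xi -> U eta ->
  leaf U xi = leaf U eta <-> flow_equiv U xi eta.
Proof.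
move=> oU Ux Ue; split=> [E|f].
  have : leaf U eta eta by exact: flow_equiv_refl.
  by rewrite -E.
apply/seteqP; split=> z /=; apply: flow_equiv_trans => //.
exact: flow_equiv_sym.
Qed.

End Flow.

Lemma lc_rot (R : realType) t (q : 'rV[R]_4 * 'rV[R]_4) : TAdS q ->
  lc (rot t q).1 (rot t q).2 = lc q.1 q.2.
Proof.
move=> Q; have /(congr1 (fun z : R4 R => z.1 0 1)) := Phi_rot t Q.
by rewrite /= /row2 !mxE /= => /invr_inj.
Qed.

(** * Locally smooth self-maps of the unit tangent bundle *)

Section Maps.
Variables (R : realType) (M : lorentz3 R).
Local Notation E3 := 'rV[R]_3.
Local Notation TT := (E3 * E3)%type.
Local Notation T1 := (T1t M).
Variables (Y : T1 -> T1) (a : T1) (i : idx M).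
Hypotheses (domY : nbT a (fun eta => dom i (base (Y eta))))
           (smoothY : smooth_T1 (fun eta => coord i (Y eta)) a).

Lemma nbT_map P : nbT (Y a) P -> nbT a (fun eta => P (Y eta)).
Proof.
move=> nP; have n1 := nbT_coordP (nbT_self domY) nP.
have n2 := smooth_T1_continuous smoothY n1.
by apply: (@filterS2 _ _ (nbT_filter a)) domY n2 => eta de; exact.
Qed.

Lemma smooth_T1_map (W : normedModType R) (g : T1 -> W) : findim W ->
  smooth_T1 g (Y a) -> smooth_T1 (fun eta => g (Y eta)) a.
Proof.
move=> fW sg; have [F [sF nF]] := smooth_T1_chart fW sg (nbT_self domY).
apply: (smooth_T1_ext _ (smooth_T1_comp _ fW smoothY sF)).
by apply: (@filterS2 _ _ (nbT_filter a)) domY (nbT_map nF) => eta de /(_ de).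
Qed.

Lemma smooth_curve_map (X : R -> T1) t : X t = a -> smooth_curve X t ->
  smooth_curve (fun s => Y (X s)) t.
Proof.
move=> Xt sX; have [j ja] := dom_cover (base a).
have [F [sF nF]] := smooth_T1_chart _ smoothY ja.
have jX : dom j (base (X t)) by rewrite Xt.
have nX := smooth_curve_coord sX jX.
have [_ cX] := nbhs_singleton nX.
have sF' : \forall z \near coord j (X t), smooth_at F z by rewrite Xt.
have n1 := nbhs_preimage (smooth_at_continuous cX) sF'.
have nF' : nbT (X t) (fun eta => dom j (base eta) -> coord i (Y eta) = F (coord j eta)).
  by rewrite Xt.
have n2 : \forall s \near t, \forall s' \near s,
    dom j (base (X s')) -> coord i (Y (X s')) = F (coord j (X s')).
  exact: near_join (smooth_curve_near sX nF').
have n2' : \forall s \near t, \forall s' \near s, dom j (base (X s')).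
  by apply: near_join; apply: filterS nX => s [].
have domY' : nbT (X t) (fun eta => dom i (base (Y eta))) by rewrite Xt.
have n3 := smooth_curve_near sX domY'.
apply: (@curve_germ _ _ i); first exact: nbT_self domY'.
have n4 : \forall s \near t, [/\ smooth_at F (coord j (X s)),
    \forall s' \near s, dom j (base (X s')) -> coord i (Y (X s')) = F (coord j (X s')) &
    \forall s' \near s, dom j (base (X s'))].
  by apply: filterS3 n1 n2 n2' => s; exact: And3.
apply: filterS3 nX n4 n3 => s [js sXs] [sFs Es ds] iY; split; first exact: iY.
apply: (smooth_at_ext _ (smooth_at_comp _ _ sXs sFs)).
by apply: filterS2 Es ds => s' h /h ->.
Qed.

End Maps.

(** * Sliding neighbourhoods along the flow *)

Section Transport.
Variables (R : realType) (M : lorentz3 R).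
Local Notation vec := 'rV[R]_4.
Local Notation E3 := 'rV[R]_3.
Local Notation TT := (E3 * E3)%type.
Local Notation T1 := (T1t M).
Implicit Types (i j k : idx M) (xi eta zeta : T1) (U : set T1).

(* A leaf need not stay in the domain of one developing map; [Y] slides a
   neighbourhood of [a] along the flow onto one of [b]. *)
Definition transports U a b (Y : T1 -> T1) :=
  [/\ Y a = b, nbT a (fun eta => flow_equiv U eta (Y eta)),
      forall P, nbT b P -> nbT a (fun eta => P (Y eta)),
      forall g : T1 -> R4 R, smooth_T1 g b -> smooth_T1 (fun eta => g (Y eta)) a &
      forall X t, X t = a -> smooth_curve X t ->
        smooth_curve (fun s => Y (X s)) t /\
        forall i j, dom i (base a) -> dom j (base b) ->
          Ml i (coord i a) (velocity i X t) =
            Ml j (coord j b) (velocity j (fun s => Y (X s)) t) /\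
          Mr i (coord i a) (velocity i X t) =
            Mr j (coord j b) (velocity j (fun s => Y (X s)) t)].

Definition transport U a b := exists Y, transports U a b Y.

Lemma transport_trans (hM : locally_AdS M) U a b c :
  transport U a b -> transport U b c -> transport U a c.
Proof.
move=> [Y [Ya fY nY sY cY]] [Z [Zb fZ nZ sZ cZ]].
exists (fun eta => Z (Y eta)); split.
- by rewrite Ya.
- apply: (@filterS2 _ _ (nbT_filter a)) fY (nY _ fZ) => eta f1 f2.
  exact (flow_equiv_trans hM f1 f2).
- by move=> P /nZ /nY.
- by move=> g /sZ /sY.
- move=> X t Xt sX; have [sYX EY] := cY X t Xt sX.
  have YXt : Y (X t) = b by rewrite Xt.
  have [sZX EZ] := cZ (fun s => Y (X s)) t YXt sYX; split; first exact: sZX.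
  move=> i k ia kc; have [j jb] := dom_cover (base b).
  have [E1 E2] := EY i j ia jb; have [E1' E2'] := EZ j k jb kc.
  exact (conj (etrans E1 E1') (etrans E2 E2')).
Qed.

Section Step.
Variables (N : set M) (d : M -> vec) (i : idx M) (B : set vec) (H : vec -> E3).
Hypothesis D : is_dev N d i B H.
Local Notation dev := (@devT R M d i).

Lemma nbT_dev a (A : set (vec * vec)) : N (base a) -> nbhs (dev a) A ->
  nbT a (fun eta => N (base eta) /\ A (dev eta)).
Proof.
move=> Na nA; apply: (@filterI _ _ (nbT_filter a)); first exact: nbT_N D _ Na.
exact: smooth_T1_continuous (smooth_devT D Na) _ nA.
Qed.

Lemma smooth_tmap_comp (h : vec * vec -> vec * vec) a :
  (\forall z \near dev a, smooth_at h z) -> N (base a) -> B (h (dev a)).1 ->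
  smooth_T1 (fun eta => tmap H (h (dev eta))) a.
Proof.
move=> sh Na Bh.
apply: (smooth_T1_comp (h := fun z => tmap H (h z)) _ _ (smooth_devT D Na)).
have ch := smooth_at_continuous (smooth_at_fst (nbhs_singleton sh)).
have nB : nbhs (h (dev a)).1 B by apply: open_nbhs_nbhs; split=> //; exact: dev_openB D.
have n1 := nbhs_preimage ch nB.
apply: filterS2 sh n1 => z sz Bz.
apply: smooth_at_comp => //; apply: smooth_at_tmap; exact: dev_smooth_inv D _ Bz.
Qed.

Lemma dev_base b : N (base b) -> B (dev b).1.
Proof.
move=> Nb; have [Bb _] := dev_inv D Nb.
by rewrite /devT /tmap /= phiK//; exact: dev_dom D _ Nb.
Qed.

(** In developed coordinates [Y] is the rotation by the fixed angle [r]. It preserves [Ml] and [Mr]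
    because, by [M_hyp], both are expressed through [Phi], which [rot] leaves invariant. *)
Lemma transport_step U e xi a b r :
  (forall eta, N (base eta) -> `|dev xi - dev eta| < e -> forall t : R, `|t| < e ->
     exists eta', [/\ N (base eta'), dev eta' = rot t (dev eta) & flow_equiv U eta eta']) ->
  N (base a) -> `|dev xi - dev a| < e -> `|r| < e -> N (base b) -> dev b = rot r (dev a) ->
  0 < lc (dev a).1 (dev a).2 -> transport U a b.
Proof.
move=> box Na ae re Nb Eb la0.
have ex eta : exists eta', N (base eta) /\ `|dev xi - dev eta| < e ->
    [/\ N (base eta'), dev eta' = rot r (dev eta) & flow_equiv U eta eta'].
  have [[Ne ee]|n] := pselect (N (base eta) /\ `|dev xi - dev eta| < e); last by exists eta.
  by have [eta' H'] := box eta Ne ee r re; exists eta'.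
have [Y YP] := boolp.choice ex.
have near_a : nbT a (fun eta => N (base eta) /\ `|dev xi - dev eta| < e).
  have nb : nbhs (dev a) (ball (dev xi) e).
    by apply: open_nbhs_nbhs; split; [exact: ball_open|rewrite -ball_normE].
  by rewrite -ball_normE in nb; exact: nbT_dev Na nb.
have Ya : Y a = b.
  by have [h1 h2 h3] := YP a (conj Na ae); apply: (devT_inj D h1 Nb); rewrite h2 Eb.
have domY : nbT a (fun eta => dom i (base (Y eta))).
  by apply: (@filterS _ _ (nbT_filter a)) near_a => eta /YP[h _ _]; exact: dev_dom D _ h.
have smoothY : smooth_T1 (fun eta => coord i (Y eta)) a.
  apply: (smooth_T1_ext _ (@smooth_tmap_comp (rot r) a _ Na _)).
  - apply: (@filterS _ _ (nbT_filter a)) near_a => eta /YP[h1 h2 _]; rewrite -h2.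
    exact: tmap_inv D _ h1.
  - apply: (@filterE _ (nbhs (dev a)) _ _ _) => z.
    apply: (@smooth_at_comp _ _ _ _ (fun z => (r, z)) (fun z : R * (vec * vec) => rot z.1 z.2)).
      exact: smooth_at_pair (smooth_at_cst _ _) (smooth_at_id _).
    exact: smooth_at_rot.
  - by rewrite -Eb; exact: dev_base.
exists Y; split.
- exact: Ya.
- by apply: (@filterS _ _ (nbT_filter a)) near_a => eta /YP[].
- by move=> P nP; apply: (nbT_map domY smoothY); rewrite Ya.
- by move=> g sg; apply: (smooth_T1_map domY smoothY); rewrite Ya.
- move=> X t Xt sX; have sYX := smooth_curve_map domY smoothY Xt sX.
  split; first exact: sYX.
  move=> j k ja kb.
  have NX : N (base (X t)) by rewrite Xt.
  have lX : 0 < lc (dev (X t)).1 (dev (X t)).2 by rewrite Xt.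
  have jX : dom j (base (X t)) by rewrite Xt.
  have YX : Y (X t) = b by rewrite Xt.
  have NY : N (base (Y (X t))) by rewrite YX.
  have lY : 0 < lc (dev (Y (X t))).1 (dev (Y (X t))).2.
    by rewrite YX Eb lc_rot//; exact: devT_TAdS D _ Na.
  have kY : dom k (base (Y (X t))) by rewrite YX.
  have [E1 E2] := M_hyp D sX NX lX jX.
  have [E3 E4] := M_hyp D sYX NY lY kY.
  have EP : \forall s \near t, Phi (dev (Y (X s))) = Phi (dev (X s)).
    have near_X : nbT (X t) (fun eta => N (base eta) /\ `|dev xi - dev eta| < e) by rewrite Xt.
    apply: filterS (smooth_curve_near sX near_X) => s [Ns es].
    have [_ -> _] := YP _ (conj Ns es); apply: Phi_rot; exact: devT_TAdS D _ Ns.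
  have Du : 'D_1 (fun s => Phi (dev (Y (X s)))) t = 'D_1 (fun s => Phi (dev (X s))) t.
    exact: near_eq_derive EP.
  have E0 := nbhs_singleton EP.
  rewrite -[in coord j a]Xt -[in coord k b]YX.
  have E5 := etrans E3 (congr2 (fun z u : R4 R => hyp z.1 u.1) E0 Du).
  have E6 := etrans E4 (congr2 (fun z u : R4 R => hyp z.2 u.2) E0 Du).
  exact: (conj (etrans E1 (esym E5)) (etrans E2 (esym E6))).
Qed.

End Step.

Lemma flow_transport (hM : locally_AdS M) U a b : T1_open U -> flow_equiv U a b ->
  transport U a b.
Proof.
move=> oU [I [c [t0 [t1 [[oI iI It0 It1] [gc cU <- <-]]]]]].
(* Both directions are recorded because [interval_propagation] asks for an equivalence. *)
have loc t : I t -> \forall s \near t, transport U (c t) (c s) /\ transport U (c s) (c t).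
  move=> It; have [N [d [i [B [H [D Nt lt]]]]]] := exists_dev (c t) hM.
  have Ut : U (c t) by apply: cU; exists t.
  have [e e0 box] := flow_box D Nt oU Ut.
  have [e' e'0 He'] := geodesic_rot D oI gc It Nt.
  have n1 : \forall s \near t, `|s - t| < e.
    by apply/nbhs_ballP; exists e => // s; rewrite -ball_normE /= distrC.
  have n2 : \forall s \near t, `|s - t| < e'.
    by apply/nbhs_ballP; exists e' => // s; rewrite -ball_normE /= distrC.
  have nb : nbhs (@devT R M d i (c t)) (ball (@devT R M d i (c t)) e).
    exact: nbhsx_ballx.
  have n3 := geodesic_nbT gc It (nbT_dev D Nt nb).
  apply: filterS3 n1 n2 n3 => s se /He'[_ Ns Es] [_ ].
  rewrite -ball_normE /= => ball_s; split.
    apply: (transport_step D box (r := s - t)) => //.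
    by rewrite subrr normr0.
  apply: (transport_step D box (r := t - s)) => //.
  - by rewrite distrC.
  - by rewrite Es rotD subrKA subrr rot0.
  - by rewrite Es lc_rot//; exact: devT_TAdS D _ Nt.
apply: (@interval_propagation R I (fun s => transport U (c t0) (c s)) t0 t1) => //.
  move=> t It; apply: filterS (loc t It) => s [h1 h2] _; split=> h.
    exact: transport_trans hM _ _ _ _ h h2.
  exact: transport_trans hM _ _ _ _ h h1.
by have [] := nbhs_singleton (loc t0 It0).
Qed.

End Transport.

(** * Charts of the space of geodesics *)

(** The angle is the arcsine of [S], continuous at 0; the condition [0 < C] selects the right sign
    of the cosine. *)
Lemma small_angle (R : realType) (e : R) : 0 < e -> exists2 r : R, 0 < r &
  forall C S : R, C ^+ 2 + S ^+ 2 = 1 -> 0 < C -> `|S| < r ->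
    exists t : R, [/\ `|t| < e, cos t = C & sin t = S].
Proof.
move=> e0; have pi0 := @pi_gt0 R.
have a0 : asin (0 : R) = 0.
  by rewrite -[in LHS](@sin0 R) sinK// in_itv /=; apply/andP; split; lra.
have ca : {for (0 : R), continuous (@asin R)}.
  by apply: continuous_asin; apply/andP; split; lra.
have n0 : nbhs (asin (0 : R)) (ball (0 : R) e) by rewrite a0; exact: nbhsx_ballx.
have [r /= r0 Hr] := (nbhs_ballP _ _).1 (nbhs_preimage ca n0).
exists r => // C S CS C0 Sr; exists (asin S).
have S1 : -1 <= S <= 1 by apply/andP; split; nra.
split.
- have : ball (0 : R) r S by rewrite -ball_normE /= sub0r normrN.
  by move=> /Hr; rewrite -ball_normE /= sub0r normrN.
- by rewrite cos_asin// (_ : 1 - S ^+ 2 = C ^+ 2) ?sqrtr_sqr ?gtr0_norm//; lra.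
- by rewrite asinK// in_itv.
Qed.

(** For [q] and [q'] both near [q0], the cosine and the sine given by [same_Phi] are near 1 and 0,
    so the rotation from [q] to [q'] can be taken by a small angle. *)
Lemma near_same_Phi (R : realType) (q0 : 'rV[R]_4 * 'rV[R]_4) (e : R) : TAdS q0 -> 0 < e ->
  exists2 r : R, 0 < r & forall q q', ball q0 r q -> ball q0 r q' -> TAdS q -> TAdS q' ->
    0 < lc q.1 q.2 -> 0 < lc q'.1 q'.2 -> Phi q = Phi q' ->
    exists2 t : R, `|t| < e & q' = rot t q.
Proof.
move=> [Q1 Q2 Q3] /small_angle[r r0 Hr].
(* Minus the cosine and minus the sine of [same_Phi]; the value at [(q0, q0)] is [(-1, 0)]. *)
pose K (z : ('rV[R]_4 * 'rV[R]_4) * ('rV[R]_4 * 'rV[R]_4)) : R * R :=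
  (ads z.1.1 z.2.1, ads z.1.2 z.2.1).
have cK : {for (q0, q0), continuous K}.
  apply: smooth_at_continuous; apply: smooth_at_pair; apply: smooth_at_ads; repeat smooth_step.
have nA : nbhs (K (q0, q0)) [set z : R * R | z.1 < 0 /\ `|z.2| < r].
  rewrite /K /= Q1 (adsC q0.2) Q3.
  exists ([set x : R | x < 0], [set x : R | `|x| < r]) => //=; split.
    by apply: open_nbhs_nbhs; split; [exact: open_lt|rewrite /=; lra].
  by have := nbhsx_ballx (0 : R) _ r0; rewrite -ball_normE /=; apply: filterS => x /=; rewrite sub0r normrN.
have [s /= s0 Hs] := (nbhs_ballP _ _).1 (nbhs_preimage cK nA).
exists s => // q q' b b' Q Q' l l' E.
have [h1 h2] := Hs (q, q') (conj b b').
have [CS Eq'] := same_Phi Q Q' l l' E.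
have [||t [te Ct St]] := Hr _ _ CS; rewrite ?oppr_gt0 ?normrN//.
by exists t => //; rewrite Eq' /rot Ct St.
Qed.

Lemma H2_Phi (R : realType) (q : 'rV[R]_4 * 'rV[R]_4) : TAdS q -> 0 < lc q.1 q.2 ->
  H2 (Phi q).1 /\ H2 (Phi q).2.
Proof.
case: q => y w Q l; have r := rc_gt0 Q l.
by rewrite /H2 /Phi /row2 /= !mxE /= !invr_gt0.
Qed.

Lemma near_H2 (R : realType) (z : R4 R) : H2 z.1 -> H2 z.2 ->
  \forall w \near z, H2 w.1 /\ H2 w.2.
Proof.
move=> z1 z2.
have c1 : {for z, continuous (fun w : R4 R => w.1 0 1)}.
  by apply: smooth_at_continuous; repeat smooth_step.
have c2 : {for z, continuous (fun w : R4 R => w.2 0 1)}.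
  by apply: smooth_at_continuous; repeat smooth_step.
have pos (x : R) : 0 < x -> nbhs x [set y | 0 < y].
  by move=> x0; apply: open_nbhs_nbhs; split; [exact: open_gt|].
have n1 := nbhs_preimage c1 (pos _ z1); have n2 := nbhs_preimage c2 (pos _ z2).
by apply: filterS2 n1 n2.
Qed.

Lemma near_sect (R : realType) (q : 'rV[R]_4 * 'rV[R]_4) (A : set ('rV[R]_4 * 'rV[R]_4)) :
  TAdS q -> 0 < lc q.1 q.2 -> nbhs q A ->
  \forall z \near Phi q, [/\ H2 z.1, H2 z.2 & A (sect (angle q) z)].
Proof.
move=> Q l nA; have [z1 z2] := H2_Phi Q l.
have cs := smooth_at_continuous (smooth_at_sect (angle q) z1 z2).
have nA' : nbhs (sect (angle q) (Phi q)) A by rewrite sect_angle.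
by apply: filterS2 (near_H2 z1 z2) (nbhs_preimage cs nA') => z [].
Qed.

Lemma near_smooth_Phi (R : realType) (q : 'rV[R]_4 * 'rV[R]_4) : TAdS q -> 0 < lc q.1 q.2 ->
  \forall z \near q, smooth_at (@Phi R) z.
Proof.
case: q => y w Q l; have r := rc_gt0 Q l.
have [_ slc _ src] := smooth_at_lr (y, w).
have pos (x : R) : 0 < x -> nbhs x [set y | 0 < y].
  by move=> x0; apply: open_nbhs_nbhs; split; [exact: open_gt|].
have n1 := nbhs_preimage (smooth_at_continuous slc) (pos _ l).
have n2 := nbhs_preimage (smooth_at_continuous src) (pos _ r).
by apply: filterS2 n1 n2 => z /= lz rz; apply: smooth_at_Phi; rewrite gt_eqF.
Qed.

(** * Charts of the quotient read through Phi *)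

Section Quotient.
Variables (R : realType) (M : lorentz3 R) (hM : locally_AdS M).
Local Notation vec := 'rV[R]_4.
Local Notation E3 := 'rV[R]_3.
Local Notation TT := (E3 * E3)%type.
Local Notation T1 := (T1t M).
Implicit Types (xi eta zeta a b : T1).
Variables (N : set M) (d : M -> vec) (i : idx M) (B : set vec) (H : vec -> E3).
Hypothesis D : is_dev N d i B H.
Local Notation dev := (@devT R M d i).

(** The last clause lets [Phi] composed with [dev] descend to leaves and be injective there. Flow
    equivalence is taken in all of [U], so geodesics that leave [W] and come back are accounted
    for. *)
Definition adapted U (W : set T1) := [/\ T1_open W,
  forall eta, W eta -> [/\ U eta, N (base eta) & 0 < lc (dev eta).1 (dev eta).2] &
  forall eta eta', W eta -> W eta' -> flow_equiv U eta eta' <-> Phi (dev eta) = Phi (dev eta')].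

Lemma nbT_lc xi : N (base xi) -> 0 < lc (dev xi).1 (dev xi).2 ->
  nbT xi (fun eta => N (base eta) /\ 0 < lc (dev eta).1 (dev eta).2).
Proof.
move=> Nx lx.
have cl : {for dev xi, continuous (fun q : vec * vec => lc q.1 q.2)}.
  by apply: smooth_at_continuous; have [] := smooth_at_lr (dev xi).
have n0 : nbhs (lc (dev xi).1 (dev xi).2) [set x | 0 < x].
  by apply: open_nbhs_nbhs; split; [exact: open_gt|].
exact: (nbT_dev D Nx (nbhs_preimage cl n0)).
Qed.

(** Nearby vectors with the same [Phi] differ by a small rotation, which [flow_box] realises by a
    flow line inside [U]. This half of [adapted] holds near [xi] for every open [U]. *)
Lemma near_flow_equiv U xi : T1_open U -> U xi -> N (base xi) ->
  0 < lc (dev xi).1 (dev xi).2 -> exists2 P : set T1, nbT xi P &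
  (forall eta, P eta -> [/\ U eta, N (base eta) & 0 < lc (dev eta).1 (dev eta).2]) /\
  (forall eta eta', P eta -> P eta' -> Phi (dev eta) = Phi (dev eta') -> flow_equiv U eta eta').
Proof.
move=> oU Ux Nx lx; have [e e0 box] := flow_box D Nx oU Ux.
have [r r0 Hr] := near_same_Phi (devT_TAdS D Nx) e0.
have n1 := nbT_lc Nx lx.
have n2 := nbT_dev D Nx (nbhsx_ballx (dev xi) r r0).
have n3 := nbT_dev D Nx (nbhsx_ballx (dev xi) e e0).
have n4 := (T1_openP U).1 oU xi Ux.
exists (fun eta => [/\ U eta, N (base eta) /\ 0 < lc (dev eta).1 (dev eta).2,
  ball (dev xi) r (dev eta) & ball (dev xi) e (dev eta)]).
  apply: (@filterS3 _ _ (nbT_filter xi) _ _ _ _ _ (@filterI _ _ (nbT_filter xi) _ _ n4 n1) n2 n3).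
  by move=> eta [h1 h3] [_ h4] [_ h5]; exact: And4.
split; first by move=> eta [h1 [h3 h4] h5 h6].
move=> eta eta' [h1 [h3 h4] h5 h6] [k1 [k3 k4] k5 k6] E.
have [t te Et] := Hr _ _ h5 k5 (devT_TAdS D h3) (devT_TAdS D k3) h4 k4 E.
have he : `|dev xi - dev eta| < e by move: h6; rewrite -ball_normE.
have [zeta [Nz Ez fz]] := box eta h3 he t te.
by rewrite -(devT_inj D Nz k3 (etrans Ez (esym Et))).
Qed.

Lemma exists_adapted U W0 xi : T1_open U -> U xi -> N (base xi) ->
  0 < lc (dev xi).1 (dev xi).2 -> nbT xi W0 ->
  (forall eta eta', W0 eta -> W0 eta' -> flow_equiv U eta eta' -> Phi (dev eta) = Phi (dev eta')) ->
  exists2 W, adapted U W & W xi.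
Proof.
move=> oU Ux Nx lx nW0 inj; have [P nP [PU PE]] := near_flow_equiv oU Ux Nx lx.
(* The interior of the intersection of [P] and [W0], so that [W] is open. *)
exists (fun eta => nbT eta (fun eta => P eta /\ W0 eta)).
  split; first exact: T1_open_nbT.
    by move=> eta /nbT_self[/PU].
  move=> eta eta' /nbT_self[h1 h2] /nbT_self[k1 k2]; split; [exact: inj|exact: PE].
exact: (@filterI _ _ (nbT_filter xi) _ _ nP nW0).
Qed.

(** The straight line through [Phi (dev b)] with velocity [w] is lifted by [sect], the angle of [b]
    being held fixed, and then by the inverse of [dev]. *)
Lemma exists_curve b P (w : R4 R) : N (base b) -> 0 < lc (dev b).1 (dev b).2 -> nbT b P ->
  exists X : R -> T1, [/\ X 0 = b, smooth_curve X 0 &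
    \forall s \near (0 : R), [/\ N (base (X s)), P (X s) & Phi (dev (X s)) = Phi (dev b) + s *: w]].
Proof.
move=> Nb lb nP; have Qb := devT_TAdS D Nb; have k1 := angle_unit Qb lb.
pose z (s : R) : R4 R := Phi (dev b) + s *: w.
pose q s := sect (angle (dev b)) (z s).
have z0 : z 0 = Phi (dev b) by rewrite /z scale0r addr0.
have sz s : smooth_at z s.
  by apply: smooth_atD; [exact: smooth_at_cst|exact: smooth_at_scale].
have n1 := near_sect Qb lb (dev_near_surj D Nb nP).
rewrite -z0 in n1.
have n2 := nbhs_preimage (smooth_at_continuous (sz 0)) n1.
have ex s : exists eta, (exists eta', [/\ N (base eta'), dev eta' = q s & P eta']) ->
    [/\ N (base eta), dev eta = q s & P eta].
  have [[eta' H']|n] := pselect (exists eta', [/\ N (base eta'), dev eta' = q s & P eta']).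
    by exists eta'.
  by exists b.
have [X XP] := boolp.choice ex.
have n3 : \forall s \near (0 : R), [/\ H2 (z s).1, H2 (z s).2 &
    [/\ N (base (X s)), dev (X s) = q s & P (X s)]].
  apply: filterS n2 => s [z1 z2 Hs]; split; [exact: z1|exact: z2|].
  by apply: XP; apply: Hs; have [] := sectP k1 z1 z2.
have [_ _ [N0 E0 _]] := nbhs_singleton n3.
have X0 : X 0 = b by apply: (devT_inj D N0 Nb); rewrite E0 /q z0 sect_angle.
exists X; split; first exact: X0.
  apply: (@curve_germ _ _ i); first by rewrite X0; exact: dev_dom D _ Nb.
  apply: filterS (near_join n3) => s ns.
  have [z1 z2 [Ns Es _]] := nbhs_singleton ns.
  split; first exact: dev_dom D _ Ns.
  apply: (@smooth_at_ext _ _ _ (fun s => tmap H (q s))).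
    by apply: filterS ns => s' [_ _ [Ns' <- _]]; exact: tmap_inv D _ Ns'.
  apply: (@smooth_at_comp _ _ _ _ q (tmap H)).
    apply: (@smooth_at_comp _ _ _ _ z (sect (angle (dev b)))) => //.
    exact: smooth_at_sect.
  apply: smooth_at_tmap; apply: (dev_smooth_inv D); rewrite -Es; exact: (dev_base D).
apply: filterS n3 => s [z1 z2 [Ns Es Ps]]; split; [exact: Ns|exact: Ps|].
by rewrite Es; have [] := sectP k1 z1 z2.
Qed.

Section Chart.
Variables (U W : set T1).
Hypotheses (oU : T1_open U) (gW : adapted U W).

Definition chart_dom : set (set T1) := leaf U @` W.

(** The values are prescribed through representatives in [W]; at leaves that do not meet [W] the map
    is arbitrary. *)
Definition is_chart_map (f : set T1 -> R4 R) :=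
  forall eta, W eta -> f (leaf U eta) = Phi (dev eta).

Lemma leaf_eq eta eta' : W eta -> W eta' ->
  leaf U eta = leaf U eta' <-> Phi (dev eta) = Phi (dev eta').
Proof.
move=> We We'; have [_ WU inj] := gW; have [Ue _ _] := WU _ We; have [Ue' _ _] := WU _ We'.
by rewrite (leafP hM oU Ue Ue'); exact: inj.
Qed.

Lemma exists_chart_map : exists f, is_chart_map f.
Proof.
have ex (c : set T1) : exists z : R4 R, forall eta, W eta -> c = leaf U eta -> z = Phi (dev eta).
  have [[eta We Ec]|n] := pselect (chart_dom c).
    exists (Phi (dev eta)) => eta' We' Ec'; apply/(leaf_eq We We'); exact: etrans Ec Ec'.
  by exists (0, 0) => eta We Ec; exfalso; apply: n; exists eta.
have [f fP] := boolp.choice ex.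
by exists f => eta We; exact: (fP (leaf U eta) eta We erefl).
Qed.

Variable f : set T1 -> R4 R.
Hypothesis fP : is_chart_map f.

(** A leaf of the chart domain may be represented by a vector [a] far from [W]. The transport [Y]
    brings a neighbourhood of [a] into [W] without changing leaves, and there [f] is [Phi] composed
    with [dev]. *)
Lemma chart_transport a : U a -> chart_dom (leaf U a) -> exists b Y,
  [/\ W b, flow_equiv U a b, transports U a b Y &
      nbT a (fun eta => [/\ U eta, W (Y eta), leaf U eta = leaf U (Y eta) &
        f (leaf U eta) = Phi (dev (Y eta))])].
Proof.
move=> Ua [b Wb Eb]; have [oW WU inj] := gW; have [Ub Nb lb] := WU b Wb.
have fab : flow_equiv U a b by apply/(leafP hM oU Ua Ub).
have [Y [Ya nY pY sY cY]] := flow_transport hM oU fab.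
exists b, Y; split; [exact: Wb|exact: fab|exact: (And5 Ya nY pY sY cY)|].
have nW := pY _ ((T1_openP W).1 oW b Wb).
apply: (@filterS2 _ _ (nbT_filter a)) nY nW => eta fe We.
have [Ue UYe] := flow_equiv_sub fe.
have El : leaf U eta = leaf U (Y eta) by apply/(leafP hM oU Ue UYe).
by split; [exact: Ue|exact: We|exact: El|rewrite El; exact: fP].
Qed.

Lemma chart_open : geodesics_open U chart_dom.
Proof.
have [oW WU inj] := gW; split.
  by move=> _ [eta We <-]; exists eta => //; have [] := WU eta We.
apply/T1_openP => a [Ua /= Va].
have [b [Y [Wb fab _ nY]]] := chart_transport Ua Va.
apply: (@filterS _ _ (nbT_filter a)) nY => eta [Ue WY El _]; split; first exact: Ue.
by rewrite /= El; exists (Y eta).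
Qed.

Lemma chart_inj c c' : chart_dom c -> chart_dom c' -> f c = f c' -> c = c'.
Proof.
move=> [eta We <-] [eta' We' <-]; rewrite !fP// => E; exact/leaf_eq.
Qed.

(** Every point near [Phi (dev eta)] is lifted by [sect], with the angle of [eta], to a vector that
    still lies in [W] and has its leaf in [V']. *)
Lemma chart_open_map V' : geodesics_open U V' -> V' `<=` chart_dom -> open (f @` V').
Proof.
move=> [V'U oV'] V'V; rewrite openE => _ [c V'c <-].
have [eta We Ec] := V'V c V'c; have [oW WU inj] := gW; have [Ue Ne le] := WU eta We.
have V'e : (U `&` leaf U @^-1` V') eta by split; rewrite //= Ec.
have nP := @filterI _ _ (nbT_filter eta) _ _ ((T1_openP _).1 oV' eta V'e) ((T1_openP W).1 oW eta We).
have n1 := dev_near_surj D Ne nP.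
have n2 := near_sect (devT_TAdS D Ne) le n1.
rewrite -Ec fP//; apply: filterS n2 => z [z1 z2 Hz].
have [h1 h2 h3] := sectP (angle_unit (devT_TAdS D Ne) le) z1 z2.
have [eta' [Ne' Ee' [[Ue' V'e'] We']]] := Hz h1.
by exists (leaf U eta') => //; rewrite fP// Ee'.
Qed.

Lemma smooth_Phi_dev b : N (base b) -> 0 < lc (dev b).1 (dev b).2 ->
  smooth_T1 (fun eta => Phi (dev eta)) b.
Proof.
move=> Nb lb; apply: smooth_T1_comp (smooth_devT D Nb) _.
exact: near_smooth_Phi (devT_TAdS D Nb) lb.
Qed.

Lemma chart_smooth : T1_smooth (U `&` leaf U @^-1` chart_dom) (f \o leaf U).
Proof.
have [_ oV] := chart_open; have [oW WU inj] := gW.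
apply/(T1_smoothP _ _ oV) => a [Ua Va].
have [b [Y [Wb fab [Ya _ pY sY cY] nY]]] := chart_transport Ua Va.
have [Ub Nb lb] := WU b Wb.
apply: (smooth_T1_ext _ (sY _ (smooth_Phi_dev Nb lb))).
by apply: (@filterS _ _ (nbT_filter a)) nY => eta [_ _ _ /= ->].
Qed.

(** The curve with prescribed velocity is built at a vector [b] of [W] in the same leaf as [a], then
    transported back to [a], which keeps the leaves and hence the values of [f]. *)
Lemma chart_submersion : T1_submersion (U `&` leaf U @^-1` chart_dom) (f \o leaf U).
Proof.
have [oW WU inj] := gW => a w [Ua Va].
have [b [Y [Wb fab _]]] := chart_transport Ua Va.
have [Ub Nb lb] := WU b Wb.
have [X [X0 sX nX]] := exists_curve w Nb lb ((T1_openP W).1 oW b Wb).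
have [Z [Zb fZ pZ sZ cZ]] := flow_transport hM oU (flow_equiv_sym fab).
have [sZX _] := cZ X 0 X0 sX.
exists (fun s => Z (X s)); first by split; [rewrite X0|exact: sZX].
have fZ' : nbT (X 0) (fun eta => flow_equiv U eta (Z eta)) by rewrite X0.
have E : \forall s \near (0 : R), f (leaf U (Z (X s))) = Phi (dev b) + s *: w.
  apply: filterS2 (smooth_curve_near sX fZ') nX => s fs [_ WXs Es].
  have [UX UZ] := flow_equiv_sub fs.
  have El : leaf U (X s) = leaf U (Z (X s)) by apply/(leafP hM oU UX UZ).
  by rewrite -El fP.
have D0 : is_derive (0 : R) 1 (fun s : R => Phi (dev b) + s *: w) w.
  have := @is_derive_line R (R4 R) (R4 R) id (Phi (dev b)) w 0 (smooth_at_differentiable (smooth_at_id _)).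
  by rewrite derive_id.
have E1 : 'D_1 (fun s => f (leaf U (Z (X s)))) 0 = 'D_1 (fun s : R => Phi (dev b) + s *: w) 0.
  exact: near_eq_derive E.
rewrite derive1E; apply: (etrans E1).
by have [] := D0.
Qed.

Lemma chart_image : f @` chart_dom `<=` @H2 R `*` @H2 R.
Proof.
move=> _ [_ [eta We <-] <-]; have [_ WU _] := gW; have [Ue Ne le] := WU eta We.
rewrite fP//; exact: H2_Phi (devT_TAdS D Ne) le.
Qed.

(** Transporting the curve into [W] preserves [Ml] and [Mr], and in [W] they are the pull-backs by
    [Phi] given by [M_hyp]. *)
Lemma chart_induced : induced_form U chart_dom f (@Ml R M) (fun z w => hyp z.1 w.1) /\
  induced_form U chart_dom f (@Mr R M) (fun z w => hyp z.2 w.2).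
Proof.
have [oW WU inj] := gW.
suff main (X : R -> T1) t j : U (X t) -> chart_dom (leaf U (X t)) -> smooth_curve X t ->
    dom j (base (X t)) ->
    hyp (f (leaf U (X t))).1 (derive1 (f \o leaf U \o X) t).1
      = Ml j (coord j (X t)) (velocity j X t) /\
    hyp (f (leaf U (X t))).2 (derive1 (f \o leaf U \o X) t).2
      = Mr j (coord j (X t)) (velocity j X t).
  by split=> X t j UX VX sX jX; have [] := main X t j UX VX sX jX.
move=> UX VX sX jX.
have [b [Y [Wb fab [Ya _ pY sY cY] nY]]] := chart_transport UX VX.
have [Ub Nb lb] := WU b Wb.
have [sYX M1] := cY X t erefl sX.
have [k kb] := dom_cover (base b).
have [M2 M3] := M1 j k jX kb.
rewrite -{1}Ya in M2; rewrite -{1}Ya in M3.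
have NY : N (base (Y (X t))) by rewrite Ya.
have lY : 0 < lc (dev (Y (X t))).1 (dev (Y (X t))).2 by rewrite Ya.
have kY : dom k (base (Y (X t))) by rewrite Ya.
have [M4 M5] := M_hyp D sYX NY lY kY.
have E : \forall s \near t, f (leaf U (X s)) = Phi (dev (Y (X s))).
  by apply: filterS (smooth_curve_near sX nY) => s [].
have E0 := nbhs_singleton E.
have E1 : derive1 (f \o leaf U \o X) t = 'D_1 (fun s => Phi (dev (Y (X s)))) t.
  by rewrite derive1E; exact: near_eq_derive E.
have h1 := congr2 (fun z u : R4 R => hyp z.1 u.1) E0 E1.
have h2 := congr2 (fun z u : R4 R => hyp z.2 u.2) E0 E1.
exact: (conj (etrans h1 (esym (etrans M2 M4))) (etrans h2 (esym (etrans M3 M5)))).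
Qed.

End Chart.

Lemma adapted_isometric U W xi : T1_open U -> adapted U W -> W xi ->
  isometric_H2H2_at U (leaf U xi).
Proof.
move=> oU gW Wx; have [f fP] := exists_chart_map oU gW.
have [i1 i2] := chart_induced oU gW fP.
exists (chart_dom U W), f, (fun z w => hyp z.1 w.1), (fun z w => hyp z.2 w.2); split.
  split; first by exists xi.
  - split.
    + exact: chart_open fP.
    + exact: chart_inj.
    + exact: chart_open_map.
    + exact: chart_smooth.
    + exact: chart_submersion.
  - exact: chart_image.
split; [exact: i1|exact: i2|by []].
Qed.

End Quotient.

(** * Geodesics of a developed region and of the whole manifold *)

Section Final.
Variables (R : realType) (M : lorentz3 R) (hM : locally_AdS M).
Local Notation vec := 'rV[R]_4.
Local Notation E3 := 'rV[R]_3.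
Local Notation T1 := (T1t M).
Implicit Types (xi eta zeta a b : T1).
Variables (N : set M) (d : M -> vec) (i : idx M) (B : set vec) (H : vec -> E3).
Hypothesis D : is_dev N d i B H.
Local Notation dev := (@devT R M d i).

Definition dev_region : set T1 := [set eta | N (base eta) /\ 0 < lc (dev eta).1 (dev eta).2].

Lemma open_dev_region : T1_open dev_region.
Proof. by apply/T1_openP => eta [Ne le]; exact: nbT_lc D _ Ne le. Qed.

(** A flow line inside the region never leaves the domain of [dev], so it develops to rotations
    throughout and [Phi] is locally constant along it. *)
Lemma Phi_flow eta eta' : flow_equiv dev_region eta eta' -> Phi (dev eta) = Phi (dev eta').
Proof.
move=> [I [c [a [b [[oI iI Ia Ib] [gc cU <- <-]]]]]].
apply: (@interval_propagation R I (fun s => Phi (dev (c a)) = Phi (dev (c s))) a b) => //.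
move=> t It; have [Nt lt] : dev_region (c t) by apply: cU; exists t.
have [e e0 He] := geodesic_rot D oI gc It Nt.
apply/nbhs_ballP; exists e => // s; rewrite -ball_normE /= distrC => /He[_ _ ->] _.
by rewrite Phi_rot//; exact: (devT_TAdS D Nt).
Qed.

Lemma dev_region_isometric c : geodesics dev_region c -> isometric_H2H2_at dev_region c.
Proof.
move=> [xi Ux <-]; have [Nx lx] := Ux.
have [W gW Wx] := exists_adapted D open_dev_region Ux Nx lx
  (@filterT _ _ (nbT_filter xi)) (fun eta eta' _ _ => @Phi_flow eta eta').
exact: (adapted_isometric hM D open_dev_region gW Wx).
Qed.

Lemma open_setT : T1_open (setT : set T1).
Proof. by apply/T1_openP => xi _; exact: filterT. Qed.

Lemma manifold_isometric xi : N (base xi) -> 0 < lc (dev xi).1 (dev xi).2 ->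
  manifold_at setT (leaf setT xi) -> isometric_H2H2_at setT (leaf setT xi).
Proof.
move=> Nx lx [V [f [Vx [[VU oV] _ _ sf subf]]]].
have Qx := devT_TAdS D Nx; have ix := dev_dom D Nx.
have Sx : ([set: T1] `&` leaf setT @^-1` V) xi by split.
have fR4 : findim (R4 R) by exact: findim_prod.
have sfx := (T1_smoothP _ fR4 oV).1 sf xi Sx.
have [F [sF nF]] := smooth_T1_chart fR4 sfx ix.
(* The chart [f] read along the section of [Phi] through [dev xi], with the angle of [xi] held
   fixed. *)
pose g (z : R4 R) := F (tmap H (sect (angle (dev xi)) z)).
have [z1 z2] := H2_Phi Qx lx.
have sg : smooth_at g (Phi (dev xi)).
  apply: (@smooth_at_comp _ _ _ _ (fun z => tmap H (sect (angle (dev xi)) z)) F).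
    apply: smooth_at_comp; first exact: smooth_at_sect.
    rewrite sect_angle//; apply: smooth_at_tmap; apply: (dev_smooth_inv D).
    exact: dev_base D _ Nx.
  by rewrite sect_angle// (tmap_inv D Nx); exact: nbhs_singleton sF.
have [P nP [PU PE]] := near_flow_equiv D open_setT I Nx lx.
have sPhi := smooth_Phi_dev D Nx lx.
(* [f] factors as [g \o Phi \o dev]; as [f] is a submersion and both sides have
   dimension 4, [g] is locally injective. *)
have Eg : nbT xi (fun eta => f (leaf setT eta) = g (Phi (dev eta))).
  have n1 := dev_near_surj D Nx (@filterI _ _ (nbT_filter xi) _ _ nP nF).
  have n2 := smooth_T1_continuous sPhi (near_sect Qx lx n1).
  apply: (@filterS2 _ _ (nbT_filter xi)) nP n2 => eta Pe [h1 h2 h3].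
  have [q1 q2 q3] := sectP (angle_unit Qx lx) h1 h2.
  have [eta' [Ne' Ee' [Pe' Fe']]] := h3 q1.
  (* [eta] and the vector [eta'] of the section over the same value of [Phi] are joined by a short
     flow line, hence have the same leaf. *)
  have fe : flow_equiv setT eta eta' by apply: PE => //; rewrite Ee' q3.
  rewrite ((leafP hM open_setT I I).2 fe) /g -Ee' (tmap_inv D Ne').
  exact: Fe' (dev_dom D Ne').
have dg : forall w : R4 R, exists v, 'd g (Phi (dev xi)) v = w.
  move=> w; have [X [X0 sX] Dw] := subf xi w Sx.
  have sPX : smooth_T1 (fun eta => Phi (dev eta)) (X 0) by rewrite X0.
  have EgX : nbT (X 0) (fun eta => f (leaf setT eta) = g (Phi (dev eta))) by rewrite X0.
  have sY := smooth_curve_comp fR4 sX sPX.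
  exists ('D_1 (fun s => Phi (dev (X s))) 0).
  have gX : differentiable g (Phi (dev (X 0))) by rewrite X0; exact: smooth_at_differentiable.
  have DY : is_derive (0 : R) 1 (fun s => Phi (dev (X s))) ('D_1 (fun s => Phi (dev (X s))) 0).
    by apply/derivableP/derivable1_diffP; exact: (smooth_at_differentiable sY).
  have [_ E1] := is_derive_comp_R DY gX.
  have E2 : 'D_1 (fun s => f (leaf setT (X s))) 0 = 'D_1 (fun s => g (Phi (dev (X s)))) 0.
    exact: near_eq_derive (smooth_curve_near sX EgX).
  rewrite -[in RHS]Dw derive1E -[in LHS]X0; exact: (esym (etrans E2 E1)).
have [N0 nN0 inj] := locally_injective fR4 sg dg.
have n3 := smooth_T1_continuous sPhi nN0.
have nW0 := @filterI _ _ (nbT_filter xi) _ _ Eg n3.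
have [|W gW Wx] := exists_adapted D open_setT I Nx lx nW0.
  (* Flow equivalent vectors have the same leaf, hence the same [f], hence the same [g] of [Phi],
     and [g] is injective on [N0]. *)
  move=> eta eta' [E Ne] [E' Ne'] fe; apply: inj; [exact/mem_set|exact/mem_set|].
  by rewrite -E -E' ((leafP hM open_setT I I).2 fe).
exact: (adapted_isometric hM D open_setT gW Wx).
Qed.

End Final.

Theorem lemma4p13 (R : realType) (M : lorentz3 R) (hM : locally_AdS M) :
  (forall xi : T1t M, exists U : set (T1t M),
     [/\ T1_open U, U xi & forall c, geodesics U c -> isometric_H2H2_at U c])
  /\
  (forall c : set (T1t M), geodesics setT c -> manifold_at setT c ->
     isometric_H2H2_at setT c).
Proof.
split=> [xi|_ [xi _ <-]]; have [N [d [i [B [H [D Nx lx]]]]]] := exists_dev xi hM.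
  exists (dev_region N d i); split; [exact: (open_dev_region D)|by split|].
  exact: (dev_region_isometric hM D).
exact: (manifold_isometric hM D Nx lx).
Qed.
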